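(* Let $k>n$ be positive integers and let $E\subset\mathbb{R}^k$ be a (Lebesgue) measurable set. If $f\colon E\to\mathbb{H}^n$ is locally Lipschitz (with respect to the Euclidean metric on $E$ and the Carnot–Carathéodory metric $d_{cc}$ on $\mathbb{H}^n$), then for almost every $x\in E$ the image of $\operatorname{ap}d(\pi\circ f)_x$ is an isotropic subspace of $\mathbb{R}^{2n}$, where $\pi\colon\mathbb{R}^{2n+1}\to\mathbb{R}^{2n}$ is the orthogonal projection $\pi(x_1,y_1,\ldots,x_n,y_n,t)=(x_1,y_1,\ldots,x_n,y_n)$.
   Context: The Heisenberg group $\mathbb{H}^n$ is $\mathbb{C}^n\times\mathbb{R}=\mathbb{R}^{2n+1}$, with points $(z,t)=(x_1,y_1,\ldots,x_n,y_n,t)$, $z_j=x_j+iy_j$, and group law $(z,t)*(z',t')=\left(z+z',\,t+t'+2\,\mathrm{Im}\sum_{j=1}^n z_j\overline{z_j'}\right)$. The left-invariant horizontal vector fields are $X_j=\frac{\partial}{\partial x_j}+2y_j\frac{\partial}{\partial t}$, $Y_j=\frac{\partial}{\partial y_j}-2x_j\frac{\partial}{\partial t}$ ($j=1,\ldots,n$). The horizontal space at $p$ is $H_p\mathbb{H}^n=\mathrm{span}\{X_1(p),\ldots,X_n(p),Y_1(p),\ldots,Y_n(p)\}$, equipped with the inner product making these $2n$ vectors orthonormal. An absolutely continuous curve $\gamma\colon[a,b]\to\mathbb{R}^{2n+1}$ is horizontal if $\gamma'(s)\in H_{\gamma(s)}\mathbb{H}^n$ for almost every $s$; its length is the integral of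 the norm of $\gamma'$ with respect to this inner product. The Carnot–Carathéodory metric $d_{cc}(p,q)$ is the infimum of lengths of horizontal curves joining $p$ to $q$. $\mathbb{H}^n$ is always regarded as the metric space $(\mathbb{H}^n,d_{cc})$. The standard symplectic form on $\mathbb{R}^{2n}$ is $\omega=\sum_{i=1}^n dx_i\wedge dy_i$, i.e. $\omega(v,w)=\sum_{i=1}^n(v^{x_i}w^{y_i}-v^{y_i}w^{x_i})$. A vector subspace $V\subset\mathbb{R}^{2n}$ is isotropic if $\omega(v,w)=0$ for all $v,w\in V$. A function $u\colon E\to\mathbb{R}$ is approximately differentiable at almost every point of $E$ if for every $\varepsilon>0$ there are a set $K\subset E$ with $\mathcal{H}^k(E\setminus K)<\varepsilon$ ($\mathcal{H}^k$ being Lebesgue measure on $\mathbb{R}^k$) and $g\in C^1(\mathbb{R}^k)$ that agrees with $u$ on $K$; at a density point $x$ of $K$ the approximate derivative is $\operatorname{ap}du_x=dg_x$ (independent of the choice of $g$ and $K$). For maps into $\mathbb{R}^m$ this is understood componentwise. A locally Lipschitz map $f\colon E\to\mathbb{H}^n$ is locally Lipschitz as a map into Euclidean $\mathbb{R}^{2n+1}$, hence $f$ and $\pi\circ f$ are approximately differentiable a.e. in $E$. *)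

(* Defs.v *)
From HB Require Import structures.
From mathcomp Require Import all_boot all_order all_algebra.
From mathcomp Require Import all_classical all_reals all_analysis.

Set Implicit Arguments.
Unset Strict Implicit.
Unset Printing Implicit Defensive.

Import Order.TTheory GRing.Theory Num.Theory.
Import numFieldNormedType.Exports.

Local Open Scope classical_set_scope.
Local Open Scope ring_scope.

(** ** Euclidean space and Lebesgue measure on [R^k] *)

(* The canonical norm on matrices is the sup norm, hence a separate
   Euclidean one. *)
Definition enorm (R : realType) (m : nat) (v : 'rV[R]_m) : R :=
  Num.sqrt (\sum_j v 0 j ^+ 2).

Definition eball (R : realType) (m : nat) (x : 'rV[R]_m) (r : R) :
  set 'rV[R]_m := [set y | enorm (y - x) < r].

Definition box (R : realType) (k : nat) (ab : 'rV[R]_k * 'rV[R]_k) :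
  set 'rV[R]_k := [set x | forall j, ab.1 0 j <= x 0 j <= ab.2 0 j].

(* The truncation at 0 gives volume 0 to the empty box. *)
Definition box_volume (R : realType) (k : nat) (ab : 'rV[R]_k * 'rV[R]_k) :
  \bar R := (\prod_j Num.max 0 (ab.2 0 j - ab.1 0 j))%:E.

Definition box_cover (R : realType) (k : nat) (A : set 'rV[R]_k) :
    set (set ('rV[R]_k * 'rV[R]_k)) :=
  [set Q | countable Q /\ A `<=` \bigcup_(ab in Q) box ab].

Definition lebesgue_outer (R : realType) (k : nat) (A : set 'rV[R]_k) :
    \bar R :=
  ereal_inf [set \esum_(ab in Q) box_volume ab | Q in box_cover A].

Section lebesgue_outer_measure.
Local Open Scope ereal_scope.
Context (R : realType) (k : nat).
Implicit Types (A B : set 'rV[R]_k) (Q : set ('rV[R]_k * 'rV[R]_k)).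
Local Notation mu := (@lebesgue_outer R k).

Lemma box_volume_ge0 (ab : 'rV[R]_k * 'rV[R]_k) : 0 <= box_volume ab.
Proof. by rewrite lee_fin prodr_ge0// => j _; rewrite le_max lexx. Qed.

Lemma le_esum_bigcup (Q : (set ('rV[R]_k * 'rV[R]_k))^nat) :
  \esum_(ab in \bigcup_n Q n) box_volume ab <=
  \sum_(n <oo) \esum_(ab in Q n) box_volume ab.
Proof.
rewrite seqDU_bigcup_eq (esum_bigcupT _ _ (@trivIset_seqDU _ Q) box_volume_ge0).
rewrite nneseries_esumT; last by move=> n; apply: esum_ge0 => *; exact: box_volume_ge0.
apply: le_esum => n _; rewrite esum_mkcond [leRHS]esum_mkcond.
apply: le_esum => ab _.
case: ifPn => [|_]; last by case: ifP => // _; exact: box_volume_ge0.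
by rewrite inE => -[Qab _]; rewrite mem_set.
Qed.

Lemma lebesgue_outer_ge0 A : 0 <= mu A.
Proof.
apply: le_ereal_inf_tmp => _ [Q _ <-]; apply: esum_ge0 => ab _.
exact: box_volume_ge0.
Qed.

Lemma lebesgue_outer0 : mu set0 = 0.
Proof.
apply/eqP; rewrite eq_le lebesgue_outer_ge0 andbT; apply: ereal_inf_lbound.
by exists set0; [split=> //; exact: countable0|rewrite esum_set0].
Qed.

Lemma le_lebesgue_outer : {homo mu : A B / A `<=` B >-> A <= B}.
Proof.
move=> A B AB; apply: ereal_inf_le_tmp => _ [Q [cQ BQ] <-].
by exists Q => //; split=> //; exact: subset_trans BQ.
Qed.

Lemma lebesgue_outer_sigma_subadditive : sigma_subadditive mu.
Proof.
move=> A; have [[i ioo]|] := pselect (exists i, mu (A i) = +oo).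
  rewrite (eseries_pinfty _ _ ioo) ?leey// => n _.
  by rewrite -ltNye (lt_le_trans _ (lebesgue_outer_ge0 _)).
rewrite -forallNE => Aoo.
apply/lee_addgt0Pr => _/posnumP[e].
rewrite (le_trans _ (epsilon_trick _ _ _))//; last first.
  by move=> n; exact: lebesgue_outer_ge0.
pose P n Q := box_cover (A n) Q /\
  \esum_(ab in Q) box_volume ab <= mu (A n) + (e%:num / (2 ^ n.+1)%:R)%:E.
have [Q PQ] : {Q & forall n, P n (Q n)}.
  apply: (@choice _ _ P) => n.
  have muAn : mu (A n) \is a fin_num.
    rewrite ge0_fin_numE ?lebesgue_outer_ge0// ltey.
    by apply/eqP; exact: Aoo.
  have en : (0 < e%:num / (2 ^ n.+1)%:R)%R by [].
  have [_ [Q QA <-] Qlt] := lb_ereal_inf_adherent en muAn.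
  by exists Q; split=> //; exact/ltW.
apply: (@le_trans _ _ (\esum_(ab in \bigcup_n Q n) box_volume ab)).
  apply: ereal_inf_lbound; exists (\bigcup_n Q n) => //; split.
    by apply: bigcup_countable => // n _; have [[]] := PQ n.
  move=> x [n _ Anx]; have [[_ /(_ x Anx)[ab Qab xab]] _] := PQ n.
  by exists ab => //; exists n.
apply: (le_trans (le_esum_bigcup Q)); apply: lee_nneseries => n _.
  by move=> *; apply: esum_ge0 => *; exact: box_volume_ge0.
by have [] := PQ n.
Qed.

HB.instance Definition _ := isOuterMeasure.Build R _ mu lebesgue_outer0
  lebesgue_outer_ge0 le_lebesgue_outer lebesgue_outer_sigma_subadditive.

End lebesgue_outer_measure.

Definition lebesgue_outer_measure (R : realType) (k : nat) :
  {outer_measure set 'rV[R]_k -> \bar R} := @lebesgue_outer R k.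

(* [R^k] with the sigma-algebra of Lebesgue measurable (i.e. Caratheodory
   measurable) sets *)
Notation lebesgue_space R k :=
  (caratheodory_type (lebesgue_outer_measure R k)).

Definition lebesgue_rV (R : realType) (k : nat) :
    {measure set (lebesgue_space R k) -> \bar R} :=
  lebesgue_outer_measure R k : set (lebesgue_space R k) -> \bar R.

Definition lebesgue_measurable (R : realType) (k : nat) (A : set 'rV[R]_k) :=
  (lebesgue_outer_measure R k).-cara.-measurable A.

(** ** The Heisenberg group with its Carnot-Caratheodory metric *)

(* A point is a pair (z, t); the coordinates of z in R^(2n) are listed as
   x_1, .., x_n, y_1, .., y_n. *)
Notation heis R n := ('rV[R]_(n + n) * R)%type.

Section heisenberg.
Context (R : realType) (n : nat).
Local Notation H := (heis R n).

Definition xc (v : 'rV[R]_(n + n)) (j : 'I_n) : R := v 0 (lshift n j).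
Definition yc (v : 'rV[R]_(n + n)) (j : 'I_n) : R := v 0 (rshift n j).

Definition heis_proj (p : H) : 'rV[R]_(n + n) := p.1.

Definition heisX (j : 'I_n) (p : H) : H :=
  (delta_mx 0 (lshift n j), 2 * yc p.1 j).
Definition heisY (j : 'I_n) (p : H) : H :=
  (delta_mx 0 (rshift n j), - (2 * xc p.1 j)).

(* the horizontal vector with coordinates c in the frame X_j(p), Y_j(p) *)
Definition hvec (p : H) (c : 'rV[R]_(n + n)) : H :=
  \sum_(j < n) (xc c j *: heisX j p + yc c j *: heisY j p).

Definition hspace (p : H) : set H := range (hvec p).

Lemma hvec1 (p : H) (c : 'rV[R]_(n + n)) : (hvec p c).1 = c.
Proof.
rewrite /hvec (raddf_sum (@fst 'rV[R]_(n + n) R)) /=.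
apply/rowP => i; rewrite summxE.
case: (split_ordP i) => j ->.
- rewrite (bigD1 j)//= big1 => [|l lj].
    by rewrite !mxE !eqxx eq_lrshift mulr1 mulr0 !addr0.
  by rewrite !mxE eq_lshift eq_lrshift eq_sym (negbTE lj) !mulr0 addr0.
- rewrite (bigD1 j)//= big1 => [|l lj].
    by rewrite !mxE !eqxx eq_rlshift mulr1 mulr0 add0r addr0.
  by rewrite !mxE eq_rshift eq_rlshift eq_sym (negbTE lj) !mulr0 addr0.
Qed.

(* By [hvec1] the coordinates of a horizontal vector v in the frame
   X_j(p), Y_j(p) are v.1, so that [hnorm v] is the norm of v for the inner
   product making this frame orthonormal. *)
Definition hnorm (v : H) : R := enorm v.1.

End heisenberg.

(* epsilon-delta absolute continuity on [a, b] *)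
Definition abs_continuous (R : realType) (V : normedModType R)
    (g : R -> V) (a b : R) : Prop :=
  forall e : R, 0 < e -> exists2 d : R, 0 < d &
    forall (N : nat) (s t : 'I_N -> R),
      (forall i, [/\ a <= s i, s i <= t i & t i <= b]) ->
      trivIset setT (fun i => `]s i, t i[%classic) ->
      \sum_i (t i - s i) < d ->
      \sum_i `|g (t i) - g (s i)| < e.

Definition horizontal_curve (R : realType) (n : nat)
    (g : R -> heis R n) (a b : R) : Prop :=
  abs_continuous g a b /\
  {ae (@lebesgue_measure R), forall s, s \in `[a, b] ->
    derivable g s 1 /\ hspace (g s) ('D_1 g s)}.

Definition curve_length (R : realType) (n : nat)
    (g : R -> heis R n) (a b : R) : \bar R :=
  (\int[@lebesgue_measure R]_(s in `[a, b]) (hnorm ('D_1 g s))%:E)%E.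

Definition dcc (R : realType) (n : nat) (p q : heis R n) : \bar R :=
  ereal_inf [set l | exists (a b : R) (g : R -> heis R n),
    [/\ a < b, horizontal_curve g a b, g a = p, g b = q
      & l = curve_length g a b]].

(* Only the restriction of f to E matters. *)
Definition locally_lipschitz (R : realType) (k n : nat) (E : set 'rV[R]_k)
    (f : 'rV[R]_k -> heis R n) : Prop :=
  forall x, E x -> exists r C : R, 0 < r /\
    forall y z, (E `&` eball x r) y -> (E `&` eball x r) z ->
      (dcc (f y) (f z) <= (C * enorm (y - z))%:E)%E.

(** ** Isotropic subspaces *)

Definition omega (R : realType) (n : nat) (v w : 'rV[R]_(n + n)) : R :=
  \sum_(i < n) (xc v i * yc w i - yc v i * xc w i).

Definition isotropic (R : realType) (n : nat)
    (V : {vspace 'rV[R]_(n + n)}) : Prop :=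
  forall v w, v \in V -> w \in V -> omega v w = 0.

(** ** Approximate derivatives *)

Definition C1 (R : realType) (k : nat) (g : 'rV[R]_k -> R) : Prop :=
  (forall x, differentiable g x) /\
  (forall v, continuous (fun x => 'd g x v)).

Definition density_point (R : realType) (k : nat) (K : set 'rV[R]_k)
    (x : 'rV[R]_k) : Prop :=
  fine (lebesgue_rV R k (K `&` eball x r)) / fine (lebesgue_rV R k (eball x r))
    @[r --> 0^'+] --> (1 : R).

Definition is_ap_diff1 (R : realType) (k : nat) (E : set 'rV[R]_k)
    (u : 'rV[R]_k -> R) (x : 'rV[R]_k) (l : 'rV[R]_k -> R) : Prop :=
  exists (K : set 'rV[R]_k) (g : 'rV[R]_k -> R),
    [/\ lebesgue_measurable K /\ K `<=` E, C1 g, {in K, g =1 u},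
        density_point K x & l = 'd g x].

(* L is an approximate derivative of u : E -> R^m at x *)
Definition is_ap_diff (R : realType) (k m : nat) (E : set 'rV[R]_k)
    (u : 'rV[R]_k -> 'rV[R]_m) (x : 'rV[R]_k)
    (L : 'Hom('rV[R]_k, 'rV[R]_m)) : Prop :=
  forall j, is_ap_diff1 E (fun y => u y 0 j) x (fun v => L v 0 j).

(* Main.v *)
From HB Require Import structures.
From mathcomp Require Import all_boot all_order all_algebra.
From mathcomp Require Import all_classical all_reals all_analysis.
From mathcomp Require Import measurable_realfun ring lra.
Require Import Defs.

Set Implicit Arguments.
Unset Strict Implicit.
Unset Printing Implicit Defensive.

Import Order.TTheory GRing.Theory Num.Theory.
Import numFieldNormedType.Exports.

Local Open Scope classical_set_scope.
Local Open Scope ring_scope.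

(** Write z for the horizontal part of a point of the Heisenberg group and t
    for its last coordinate.

    Horizontal curves satisfy t' = - 2 omega (z, z').  Along such a curve of
    length l issued from p, the quantity t + 2 omega (z(p), z) therefore has
    derivative 2 omega (z(p) - z, z'), where z(p) - z = O(l), and it varies by
    O(l^2).  This gives [dcc_le]: if the distance of p and q is at most c,
    then t(q) - t(p) + 2 omega (z(p), z(q)) = O(c^2).

    Isotropy follows from this estimate at every point x where an approximate
    derivative L exists ([isotropic_ap_diff]).  Given a and b, go once around
    the triangle x, x + s a, x + s b, each edge being cut into N pieces and
    each vertex being moved by o(s) into the set K, of density 1 at x, on
    which z agrees with a C^1 map.  The increments of t along this closed
    polygon add up to 0.  By [dcc_le] they are
    - 2 omega (z_i, z_(i+1)) + O(s^2 / N^2), and the numbers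
    omega (z_i, z_(i+1)) add up to s^2 omega (L a, L b) + o(s^2), twice the
    symplectic area of the image triangle.  Hence omega (L a, L b) = O(1 / N)
    for all N.

    Existence of L almost everywhere is a Lusin property of the components of
    z, which are locally Lipschitz: a Lipschitz function u agrees with a C^1
    function outside a set of small measure ([lusin_C1]).  On lines u has a
    derivative almost everywhere ([lipschitz_ae_slope]); by [null_lines] and
    the density theorem [dense_at_ae], off a set of small measure u is affine
    up to eps h at every small scale h, uniformly ([approx_set_large]).  The
    average v of u at scale h is affine with the same slope up to the same
    error, so its gradient is within O(eps) of that slope, v has a Lipschitz
    gradient, and u - v is eps-Lipschitz on a set of almost full measure
    ([lusin_step]).  Extend u - v from there to an eps-Lipschitz function on
    R^k and repeat with a smaller eps: the sum of the successive averages
    converges in C^1 and equals u on the intersection of the sets.  Almost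
    every point of E is a density point of such a set of agreement inside E,
    hence a point of approximate differentiability. *)

(** * Slopes, and monotonicity from slopes given almost everywhere *)

Section RealLine.
Context (R : realType).
Notation leb := (@lebesgue_measure R).
Implicit Types (a b s x y : R) (phi F G h : R -> R).

(** Continuous induction: the supremum of the points of [a, b] where P holds
    can be passed as long as it is not b. *)
Lemma real_induction a b (P : R -> Prop) : a <= b -> P a ->
  (forall c, a <= c <= b -> exists2 d : R, 0 < d & forall x y, a <= x -> x <= c -> c <= y -> y <= b ->
     c - d < x -> y < c + d -> P x -> P y) -> P b.
Proof.
move=> ab Pa H; pose S := [set x | a <= x <= b /\ P x].
have Sa : S a by split; rewrite ?lexx.
have hS : has_sup S by split; [exists a|exists b => x [/andP[]]].
have ub : ubound S (sup S) by exact: ub_le_sup hS.2.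
have sb : sup S <= b by apply: ge_sup; [exists a|move=> x [/andP[]]].
have as_ : a <= sup S by exact: ub.
have [|d d0 Hd] := H (sup S); first by rewrite as_.
have [x [/andP[ax xb] Px] xd] := sup_adherent d0 hS.
have xs : x <= sup S by apply: ub; split; rewrite ?ax.
pose y := Num.min b (sup S + d / 2).
have yb : y <= b by rewrite /y ge_min lexx.
have sy : sup S <= y by rewrite le_min sb lerDl ltW// divr_gt0.
have yd : y < sup S + d.
  by rewrite /y gt_min; apply/orP; right; rewrite ltrD2l gtr_pMr// invf_lt1// ltr1n.
have Py : P y by exact: (Hd x y).
have := ub y (conj (introT andP (conj (le_trans as_ sy) yb)) Py).
rewrite /y ge_min => /orP[bs|]; last by rewrite gerDl leNgt divr_gt0.
by move: Py; rewrite /y min_l// (le_trans bs)// lerDl ltW// divr_gt0.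
Qed.

Definition has_slope phi s (m : R) := forall e : R, 0 < e -> exists2 d : R, 0 < d &
  forall t, `|t| < d -> `|phi (s + t) - phi s - t * m| <= e * `|t|.

(** A bound for straddling increments, with x on the left and y on the right of s,
    as [real_induction] produces them. *)
Definition slope_le phi s (m : R) := forall e : R, 0 < e -> exists2 d : R, 0 < d &
  forall x y, s - d < x -> x <= s -> s <= y -> y < s + d -> phi y - phi x <= (m + e) * (y - x).

Lemma has_slope_le phi s m : has_slope phi s m -> slope_le phi s m.
Proof.
move=> H e e0; have [d d0 Hd] := H e e0; exists d => // x y dx xs sy yd.
have := Hd (y - s); rewrite ger0_norm ?subr_ge0// ltrBlDl => /(_ yd).
have := Hd (x - s); rewrite ler0_norm ?subr_le0// => /(_ _); rewrite ltrNl ltrBrDl => /(_ dx).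
rewrite !(addrC s) !subrK !ler_norml => /andP[h1 h2] /andP[h3 h4]; lra.
Qed.

Lemma slope_leW phi s m l : m <= l -> slope_le phi s m -> slope_le phi s l.
Proof.
move=> ml H e /H[d d0 Hd]; exists d => // x y h1 h2 h3 h4.
apply: (le_trans (Hd x y h1 h2 h3 h4)); rewrite ler_wpM2r ?lerD2r//.
by rewrite subr_ge0 (le_trans h2).
Qed.

Lemma slope_leB F G s m l : slope_le F s m -> has_slope G s l ->
  slope_le (fun x => F x - G x) s (m - l).
Proof.
move=> HF HG e e0; have e2 : 0 < e / 2 by rewrite divr_gt0.
have [d d0 Hd] := HF _ e2.
have [d' d'0 Hd'] := HG _ e2.
exists (Num.min d d'); first by rewrite lt_min d0.
move=> x y; rewrite ltrBlDr -ltrBlDl lt_min => /andP[dx d'x] xs sy.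
rewrite -ltrBlDl lt_min => /andP[yd yd'].
have := Hd x y; rewrite ltrBlDr -ltrBlDl dx xs sy -ltrBlDl yd => /(_ isT isT isT isT).
have := Hd' (y - s); rewrite ger0_norm ?subr_ge0// => /(_ yd').
have := Hd' (x - s); rewrite ler0_norm ?subr_le0// opprB => /(_ d'x).
rewrite !(addrC s) !subrK !ler_norml => /andP[h1 h2] /andP[h3 h4]; lra.
Qed.

Lemma derivable_eps (V : normedModType R) (g : R -> V) s : derivable g s 1 ->
  forall e : R, 0 < e -> exists2 d : R, 0 < d &
  forall t, `|t| < d -> `|g (s + t) - g s - t *: 'D_1 g s| <= e * `|t|.
Proof.
move=> /cvgrPdist_le H e e0; have [d /= d0 Hd] := H e e0; exists d => // t td.
have [->|t0] := eqVneq t 0; first by rewrite addr0 subrr scale0r subr0 !normr0 mulr0.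
have := Hd t; rewrite /ball_ /= sub0r normrN => /(_ td t0).
rewrite -(ler_pM2l (_ : 0 < `|t|)) ?normr_gt0// -normrZ scalerBr scalerA divff// scale1r.
by rewrite distrC [t *: 1]mulr1 (addrC t) mulrC.
Qed.

Lemma derivable_has_slope phi s : derivable phi s 1 -> has_slope phi s (phi^`()%classic s).
Proof. by move=> /derivable_eps; rewrite derive1E. Qed.

Lemma lebesgue_disjoint_itv (N : nat) (s t : 'I_N -> R) (U : set R) :
  measurable U -> (forall i, s i <= t i) ->
  (forall i, `]s i, t i[%classic `<=` U) ->
  trivIset setT (fun i => `]s i, t i[%classic) ->
  ((\sum_i (t i - s i))%:E <= leb U)%E.
Proof.
move=> mU st stU tr.
have E : leb (\big[setU/set0]_(i < N) `]s i, t i[%classic) = (\sum_i (t i - s i))%:E.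
  rewrite measure_bigsetU_ord//.
  rewrite -sumEFin; apply: eq_bigr => i _.
  transitivity (if (s i < t i)%R then (t i)%:E - (s i)%:E else 0)%E.
    exact: lebesgue_measure_itv.
  have := st i; rewrite le_eqVlt => /predU1P[->|h]; first by rewrite ltxx subrr.
  by rewrite h EFinB.
rewrite -E; apply: le_measure; rewrite ?inE//.
  by apply: bigsetU_measurable => i _; exact: measurable_itv.
by move=> x; rewrite -bigcup_seq => -[i _]; exact: stU.
Qed.

(** The upper half of absolute continuity.  It is stable under subtraction of a
    nondecreasing function ([upper_acB]), such as the primitive of a nonnegative
    integrable function. *)
Definition upper_ac phi a b := forall e : R, 0 < e -> exists2 d : R, 0 < d &
    forall (N : nat) (s t : 'I_N -> R),
      (forall i, [/\ a <= s i, s i <= t i & t i <= b]) ->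
      trivIset setT (fun i => `]s i, t i[%classic) ->
      \sum_i (t i - s i) < d ->
      \sum_i (phi (t i) - phi (s i)) <= e.

(** A negligible set where the slope is unknown is enclosed in an open set U of
    small measure.  Going from a to b by continuous induction, an increment is
    small by the slope condition outside of U, and the increments over disjoint
    intervals inside of U are small in total by absolute continuity. *)
Lemma upper_ac_le phi a b (Z : set R) : a <= b -> upper_ac phi a b ->
  leb.-negligible Z ->
  (forall s, a < s -> s < b -> ~ Z s -> slope_le phi s 0) -> phi b <= phi a.
Proof.
move=> ab ac [Z' [mZ' Z'0 ZZ']] slo.
pose Z1 := Z' `|` [set a; b].
have mZ1 : measurable Z1.
  apply: measurableU => //.
  by apply: measurableU; exact: measurable_set1.
have Z10 : leb Z1 = 0%E.
  apply: null_set_setU => //; first by apply: measurableU; exact: measurable_set1.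
  by apply: null_set_setU; [exact: measurable_set1|exact: measurable_set1|exact: lebesgue_measure_set1|exact: lebesgue_measure_set1].
apply/ler_addgt0Pr => e e0.
have [d d0 Hd] := ac (e / 2) (divr_gt0 e0 (ltr0n _ 2)).
have [|U [oU ZU Ud]] := @lebesgue_regularity_outer R Z1 d mZ1 _ d0.
  by suff : (leb Z1 < +oo)%E by []; rewrite Z10.
have mU : measurable U by exact: open_measurable.
have leU : (leb U < d%:E)%E.
  have -> : U = Z1 `|` (U `\` Z1) 
    by apply/seteqP; split=> [x Ux|x [/ZU|[]]//]; case: (pselect (Z1 x)); [left|right].
  apply: (@le_lt_trans _ _ (leb Z1 + leb (U `\` Z1))%E).
    by apply: measureU2 => //; exact: measurableD.
  by rewrite Z10 add0e.
pose c := e / 2 / (b - a + 1).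
have c0 : 0 < c by rewrite !divr_gt0// ltr_pwDr// subr_ge0.
(* The intervals ]s i, t i[ are those crossed inside of U on the way from
   a to x. *)
pose P x := exists (N : nat) (s t : 'I_N -> R),
  [/\ forall i, [/\ a <= s i, s i <= t i & t i <= x],
      forall i, `]s i, t i[%classic `<=` U,
      trivIset setT (fun i => `]s i, t i[%classic) &
      phi x - phi a <= c * (x - a) + \sum_i (phi (t i) - phi (s i))].
have : P b.
  apply: (@real_induction a b) => //.
    exists 0%N, (fun=> 0), (fun=> 0); split; try by case.
    by rewrite big_ord0 !subrr mulr0 addr0.
  move=> s /andP[as_ sb]; have [sU|sU] := pselect (U s).
    have /nbhs_ballP[r /= r0 rU] : nbhs s U by exact: open_nbhs_nbhs.
    exists r => // x y ax xs sy yb rx yr [N [u [v [h1 h2 h3 h4]]]].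
    have xyU : `]x, y[%classic `<=` U.
      move=> z; rewrite /= in_itv/= => /andP[xz zy]; apply: rU.
      by rewrite -ball_normE /ball_ /= ltr_distlC; apply/andP; split; lra.
    exists N.+1, (fun i => if unlift ord0 i is Some j then u j else x),
     (fun i => if unlift ord0 i is Some j then v j else y); split.
    - move=> i; case: unliftP => [j _|_]; last by split=> //; exact: le_trans sy.
      by have [? ? ?] := h1 j; split=> //; rewrite (le_trans _ sy)// (le_trans _ xs).
    - by move=> i; case: unliftP => [j _|_].
    - move=> i j _ _; case: unliftP => [i' ->|->]; case: unliftP => [j' ->|->] //.
      + by move=> /(h3 _ _ I I) ->.
      + move=> [z []]; rewrite /= !in_itv/= => /andP[_ zv] /andP[xz _].
        by have [_ _ vx] := h1 i'; have := lt_trans xz (lt_le_trans zv vx); rewrite ltxx.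
      + move=> [z []]; rewrite /= !in_itv/= => /andP[xz _] /andP[_ zv].
        by have [_ _ vx] := h1 j'; have := lt_trans xz (lt_le_trans zv vx); rewrite ltxx.
    - rewrite big_ord_recl unlift_none; under eq_bigr => i _ do rewrite liftK.
      have : 0 <= c * (y - x) by apply: mulr_ge0; [exact: ltW|rewrite subr_ge0 (le_trans xs)].
      lra.
  have [asl sbl] : a < s /\ s < b.
    split; rewrite lt_neqAle ?as_ ?sb andbT; apply/eqP => E; apply: sU; apply: ZU; right;
    by [left|right].
  have [r r0 Hr] := slo s asl sbl (fun zs => sU (ZU _ (or_introl (ZZ' _ zs)))) c c0.
  exists r => // x y ax xs sy yb rx yr [N [u [v [h1 h2 h3 h4]]]].
  exists N, u, v; split=> //.
    by move=> i; have [? ? ?] := h1 i; split=> //; rewrite (le_trans _ sy)// (le_trans _ xs).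
  have := Hr x y rx xs sy yr; rewrite add0r; lra.
move=> [N [u [v [h1 h2 h3 h4]]]].
have S : \sum_i (phi (v i) - phi (u i)) <= e / 2.
  apply: Hd => //; rewrite -lte_fin; apply: le_lt_trans leU.
  by apply: lebesgue_disjoint_itv => // i; have [] := h1 i.
have : c * (b - a) <= e / 2.
  rewrite /c -mulrA ler_piMr ?divr_ge0 ?ltW// mulrC ltr_pdivrMr ?mul1r ?ltrDl// ltr_pwDr// subr_ge0.
  by [].
lra.
Qed.

Lemma upper_acB phi G a b : upper_ac phi a b ->
  (forall x y, x <= y -> G x <= G y) -> upper_ac (fun x => phi x - G x) a b.
Proof.
move=> ac ndG e e0; have [d d0 Hd] := ac e e0; exists d => // N s t h1 h2 h3.
apply: le_trans (Hd N s t h1 h2 h3); apply: ler_sum => i _.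
have [_ st _] := h1 i; have := ndG _ _ st; lra.
Qed.

(** Subtract from F the primitive G of h, extended by 0 outside of D; almost
    everywhere on ]a, b[ the difference has slope at most 0. *)
Lemma upper_ac_le_integral F a b (D : set R) h : a <= b -> upper_ac F a b ->
  measurable D -> leb.-negligible (`]a, b[%classic `\` D) ->
  measurable_fun D h -> (forall s, D s -> 0 <= h s) ->
  (forall s, D s -> slope_le F s (h s)) ->
  ((F b - F a)%:E <= \int[leb]_(s in D) (h s)%:E)%E.
Proof.
move=> ab ac mD nD mh h0 slo.
(* If the integral is infinite there is nothing to prove; otherwise h is
   integrable and the Lebesgue differentiation theorem applies to it. *)
have [->|foo] := eqVneq (\int[leb]_(s in D) (h s)%:E)%E +oo%E; first by rewrite leey.
pose k := h \_ D.
have kE : (EFin \o k) = ((EFin \o h) \_ D).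
  by apply/funext => x; rewrite /k /= /patch; case: ifP.
have k0 x : 0 <= k x by rewrite /k /patch; case: ifPn => //; rewrite inE; exact: h0.
have intk : leb.-integrable setT (EFin \o k).
  rewrite kE; apply/(integrable_mkcond _ _).1 => //.
  apply/integrableP; split; first exact/measurable_EFinP.
  rewrite ltey; apply: contra_neq foo => <-.
  by apply: eq_integral => x; rewrite inE => Dx; rewrite /= ger0_norm// h0.
have intky y : leb.-integrable `]-oo, y] (EFin \o k) by exact: integrableS intk.
have locf : locally_integrable setT k.
  apply: open_integrable_locally => //; exact: openT.
have FTC := FTC1Ny intky locf.
set G := (fun x : R => _) in FTC.
have GE x : (G x)%:E = (\int[leb]_(t in `]-oo, x]) (k t)%:E)%E.
  rewrite /G /Rintegral fineK//; apply: integrable_fin_num => //; exact: intky.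
have ndG x y : x <= y -> G x <= G y.
  move=> xy; rewrite -lee_fin !GE; apply: ge0_subset_integral => //.
  - by apply/measurable_EFinP; move/integrableP: (intky y) => [/measurable_EFinP].
  - by move=> t _; rewrite lee_fin.
  - by apply: subset_itvl; rewrite bnd_simp.
have : F b - G b <= F a - G a.
  apply: (@upper_ac_le (fun x => F x - G x) a b ((`]a, b[%classic `\` D) `|`
     [set x | ~ (derivable G x 1 /\ (G^`())%classic x = k x)])) => //.
  - exact: upper_acB.
  - apply: negligibleU => //.
  - move=> s as_ sb /not_orP[/not_andP h1 /contrapT[dG eG]].
    have Ds : D s by apply: contrapT => Ds; case: h1 => //; apply; rewrite /= in_itv/= as_.
    have -> : 0 = h s - k s by rewrite /k patchE mem_set// subrr.
    apply: slope_leB; first exact: slo.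
    by rewrite -eG; exact: derivable_has_slope.
move=> FG; apply: (@le_trans _ _ (G b - G a)%:E); first by rewrite lee_fin; lra.
apply: (@le_trans _ _ (G b)%:E).
  rewrite lee_fin gerBl -lee_fin GE; apply: integral_ge0 => t _; by rewrite lee_fin.
rewrite GE integral_mkcond [leRHS]integral_mkcond -kE.
apply: ge0_le_integral => //.
- by move=> x _; rewrite erestrict_ge0// => t; rewrite lee_fin.
- by apply/(measurable_restrictT _ _).1 => //; case/integrableP: (intky b).
- by case/integrableP: intk.
- by move=> x _; rewrite /patch; case: ifP => //; rewrite lee_fin.
Qed.

End RealLine.

(** * Lebesgue measure of boxes *)

Section Boxes.
Context (R : realType) (k : nat).
Notation V := ('rV[R]_k).
Implicit Types (A B : set V) (x y : V) (ab : V * V).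

Definition upd (x : V) (j : 'I_k) (c : R) : V :=
  \row_i (if i == j then c else x 0 i).

Lemma updE x j c i : upd x j c 0 i = if i == j then c else x 0 i.
Proof. by rewrite mxE. Qed.

Lemma box_volumeE ab (j : 'I_k) : (box_volume ab =
  (Num.max 0 (ab.2 0 j - ab.1 0 j) *
   \prod_(i | i != j) Num.max 0 (ab.2 0 i - ab.1 0 i))%:E)%E.
Proof. by rewrite /box_volume (bigD1 j). Qed.

Lemma lebesgue_outer_box_le ab : (lebesgue_outer (box ab) <= box_volume ab)%E.
Proof.
apply: ereal_inf_lbound; exists [set ab].
  by split; [exact: countable1 | rewrite bigcup_set1].
by rewrite esum_set1// box_volume_ge0.
Qed.

Lemma le_lebesgue_outer_cover A (q : nat -> V * V) :
  A `<=` \bigcup_n box (q n) ->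
  (lebesgue_outer A <= \sum_(n <oo) box_volume (q n))%E.
Proof.
move=> Aq; apply: (le_trans (le_lebesgue_outer Aq)).
apply: (le_trans (lebesgue_outer_sigma_subadditive _)).
by apply: lee_nneseries => n _ *; [exact: lebesgue_outer_ge0|exact: lebesgue_outer_box_le].
Qed.

(** Countable covers are enumerated by natural numbers; the missing indices are
    filled with an empty box, which has volume 0 because k > 0. *)
Lemma lebesgue_outer_lt_cover A (e : \bar R) : (0 < k)%N ->
  (lebesgue_outer A < e)%E ->
  exists q : nat -> V * V, A `<=` \bigcup_n box (q n) /\
    (\sum_(n <oo) box_volume (q n) < e)%E.
Proof.
move=> k0 /ereal_inf_lt[_ [Q [cQ AQ] <-] Qe].
have [f fQ] := (elimT (countable_injP Q) cQ).
pose dummy : V * V := (const_mx 1, const_mx 0).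
have dummyV : box_volume dummy = 0%E.
  rewrite (box_volumeE _ (Ordinal k0)) !mxE.
  by rewrite (_ : Num.max _ _ = 0) ?mul0r// sub0r; apply/max_idPl; rewrite oppr_le0.
pose P n ab := Q ab /\ f ab = n.
pose q n := if pselect (exists ab, P n ab) is left h then sval (cid h) else dummy.
have qf ab : Q ab -> q (f ab) = ab.
  move=> Qab; rewrite /q; case: pselect => [h|[]]; last by exists ab.
  by case: (cid h) => /= c [Qc fc]; apply: fQ; rewrite ?inE.
exists q; split.
  move=> x /AQ[ab Qab xab]; exists (f ab) => //; by rewrite qf.
apply: le_lt_trans Qe.
rewrite nneseries_esumT; last by move=> *; exact: box_volume_ge0.
rewrite (_ : \esum_(ab in Q) _ = \esum_(n in f @` Q) box_volume (q n))%E.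
  rewrite [leRHS]esum_mkcond; apply: le_esum => n _.
  case: ifPn => // nQ; rewrite /q; case: pselect => [[ab [Qab fab]]|_].
    by move/negP: nQ => []; rewrite inE; exists ab.
  by rewrite dummyV.
rewrite (@reindex_esum R _ _ Q (f @` Q) f (fun n => box_volume (q n))).
  by apply: eq_esum => ab Qab /=; rewrite qf.
by split=> // ab Qab; exists ab.
Qed.

(** A box of a cover is cut by the hyperplane at height c into two boxes whose
    volumes add up to its own.  The two inclusions in the hypotheses allow for
    both the open and the closed half-space. *)
Lemma measurable_halfspace (j : 'I_k) (c : R) (H : set V) :
  (forall x, x 0 j < c -> H x) -> (forall x, H x -> x 0 j <= c) ->
  lebesgue_measurable H.
Proof.
move=> ltH leH; apply: le_caratheodory_measurable => X.
rewrite leNgt; apply/negP => /(lebesgue_outer_lt_cover (leq_ltn_trans (leq0n _) (ltn_ord j))).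
move=> [q [Xq]]; apply/negP; rewrite -leNgt.
pose q1 n : V * V := ((q n).1, upd (q n).2 j (Num.min ((q n).2 0 j) c)).
pose q2 n : V * V := (upd (q n).1 j (Num.max ((q n).1 0 j) c), (q n).2).
apply: (@le_trans _ _ (\sum_(n <oo) box_volume (q1 n) +
                      \sum_(n <oo) box_volume (q2 n))%E).
  apply: leeD; apply: le_lebesgue_outer_cover => x [/Xq[n _ xn] Hx]; exists n => // i.
    rewrite updE; case: eqP => [->|_]; last exact: xn.
    by rewrite le_min (leH _ Hx) andbT; exact: xn.
  rewrite updE; case: eqP => [->|_]; last exact: xn.
  have [xn1 xn2] := andP (xn j); rewrite ge_max xn1 xn2 !andbT.
  by rewrite leNgt; apply/negP => /ltH.
rewrite -nneseriesD; try by move=> *; exact: box_volume_ge0.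
apply: lee_nneseries => n _ *; first by rewrite adde_ge0// box_volume_ge0.
rewrite !(box_volumeE _ j) /= !updE !eqxx -EFinD lee_fin.
under eq_bigr => i ij do rewrite updE (negbTE ij).
under [X in _ + _ * X]eq_bigr => i ij do rewrite updE (negbTE ij).
rewrite -mulrDl ler_wpM2r//; first by apply: prodr_ge0 => i _; rewrite le_max lexx.
set a := (q n).1 0 j; set b := (q n).2 0 j.
by move: a b => a b; rewrite !maxEle minEle; do ![case: ifPn; rewrite -?ltNge => ?]; lra.
Qed.

Lemma measurable_box ab : lebesgue_measurable (box ab).
Proof.
rewrite (_ : box ab = \bigcap_(j in [set: 'I_k])
   (~` [set x | x 0 j < ab.1 0 j] `&` [set x | x 0 j <= ab.2 0 j])); last first.
  apply/seteqP; split=> x xab j => [_|]; last first.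
    by have [/negP] := xab j I; rewrite -leNgt => -> /=.
  by have /andP[h1 h2] := xab j; split => //=; apply/negP; rewrite -leNgt.
apply: fin_bigcap_measurable => [|j _]; first exact: finite_finset.
apply: measurableI; first apply: measurableC.
- by apply: (@measurable_halfspace j (ab.1 0 j)) => // x /= /ltW.
- by apply: (@measurable_halfspace j (ab.2 0 j)) => // x /= /ltW.
Qed.

Definition cube (x : V) (r : R) : set V :=
  box (x - const_mx r, x + const_mx r).

Lemma cubeP x r y : cube x r y <-> forall j, `|y 0 j - x 0 j| <= r.
Proof.
by split=> h j; move: (h j); rewrite /= !mxE ler_distl.
Qed.

Lemma cube_volume x (r : R) : 0 <= r ->
  box_volume (x - const_mx r, x + const_mx r) = ((2 * r) ^+ k)%:E.
Proof.
move=> r0; rewrite /box_volume; congr EFin; rewrite -[in RHS](card_ord k) -prodr_const.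
apply: eq_bigr => j _; rewrite /= !mxE; rewrite max_r; lra.
Qed.

(** The integral of the indicator function of the box [ab] over the first m
    coordinates, as a function of the remaining ones. *)
Definition wbox (m : nat) (ab : V * V) (x : V) : R :=
  \prod_(j < k) if (j < m)%N then Num.max 0 (ab.2 0 j - ab.1 0 j)
               else \1_(`[ab.1 0 j, ab.2 0 j]) (x 0 j).

Lemma wbox_ge0 m ab x : 0 <= wbox m ab x.
Proof.
by apply: prodr_ge0 => j _; case: ifP => // _; rewrite le_max lexx.
Qed.

Lemma wbox0 ab x : wbox 0 ab x = \1_(box ab) x.
Proof.
rewrite /wbox indicE; case: (boolP (x \in _)) => [|/negP].
  rewrite inE => xab; rewrite big1// => j _ /=.
  by rewrite indicE mem_set//= in_itv/= xab.
move=> xab; have [j xj] : exists j, ~ (ab.1 0 j <= x 0 j <= ab.2 0 j).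
  by apply/existsNP => h; apply: xab; rewrite inE.
rewrite (bigD1 j)//= indicE memNset ?mul0r//= in_itv/=; exact/negP.
Qed.

Lemma wboxT ab x : (wbox k ab x)%:E = box_volume ab.
Proof. by congr EFin; apply: eq_bigr => j _; rewrite ltn_ord. Qed.

Lemma integral_wbox (j : 'I_k) ab x :
  (\int[@lebesgue_measure R]_t (wbox j ab (upd x j t))%:E = (wbox j.+1 ab x)%:E)%E.
Proof.
pose c := \prod_(i < k | i != j) (if (i < j.+1)%N then Num.max 0 (ab.2 0 i - ab.1 0 i)
               else \1_(`[ab.1 0 i, ab.2 0 i]) (x 0 i)).
have E t : wbox j ab (upd x j t) = c * \1_(`[ab.1 0 j, ab.2 0 j]) t.
  rewrite /wbox (bigD1 j)//= ltnn updE eqxx mulrC; congr (_ * _).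
  apply: eq_bigr => i ij; rewrite updE (negbTE ij) ltnS (leq_eqVlt i j).
  by have -> : (nat_of_ord i == j) = false by apply/negbTE.
have c0 : 0 <= c.
  by apply: prodr_ge0 => i _; case: ifP => // _; rewrite le_max lexx.
under eq_integral => t _ do rewrite E EFinM.
rewrite ge0_integralZl//; last by apply/measurable_EFinP; apply: measurable_indic.
rewrite integral_indic// setIT [X in (_ * X)%E](lebesgue_measure_itv `[ab.1 0 j, ab.2 0 j]) /=.
rewrite /wbox (bigD1 j)//= ltnSn mulrC EFinM; congr (_ * _)%E.
rewrite lte_fin; case: ltP => aj; last by rewrite (max_idPl _)// subr_le0.
by rewrite (max_idPr _)// subr_ge0 ltW.
Qed.

(** Integrate the inequality between the indicator function of a box and the sum
    of those of the covering boxes, one coordinate after the other. *)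
Lemma box_volume_le_cover ab (q : nat -> V * V) :
  box ab `<=` \bigcup_n box (q n) ->
  (box_volume ab <= \sum_(n <oo) box_volume (q n))%E.
Proof.
move=> abq.
suff H m x : (m <= k)%N -> ((wbox m ab x)%:E <= \sum_(n <oo) (wbox m (q n) x)%:E)%E.
  rewrite -(wboxT _ 0); under eq_eseriesr => n _ do rewrite -(wboxT _ 0).
  exact: H.
elim: m x => [|m IH] x mk.
  rewrite wbox0 indicE; case: (boolP (x \in _)) => [|_]; last first.
    by apply: nneseries_ge0 => n _ _; rewrite lee_fin wbox_ge0.
  rewrite inE => /abq[n _ xn].
  apply: (@le_trans _ _ (\sum_(0 <= i < n.+1) (wbox 0 (q i) x)%:E)%E); last first.
    by apply: nneseries_lim_ge => i _; rewrite lee_fin wbox_ge0.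
  rewrite big_nat_recr//= wbox0 indicE mem_set//= leeDr//.
  by apply: sume_ge0 => i _; rewrite lee_fin wbox_ge0.
rewrite -(integral_wbox (Ordinal mk)).
under eq_eseriesr => n _ do rewrite -(integral_wbox (Ordinal mk)).
have mw (c : V * V) : measurable_fun [set: R] (fun t : R => wbox (Ordinal mk) c (upd x (Ordinal mk) t)).
  rewrite /wbox; apply: measurable_prod => j _.
  case: (j < Ordinal mk)%N; first exact: measurable_cst.
  under eq_fun => t do rewrite updE.
  by case: (j == Ordinal mk); [exact: measurable_indic|exact: measurable_cst].
rewrite -integral_nneseries//; last by move=> n t _; rewrite lee_fin wbox_ge0.
apply: ge0_le_integral => //.
- by move=> t _; rewrite lee_fin wbox_ge0.
- by apply/measurable_EFinP; exact: mw.
- apply: ge0_emeasurable_sum => [n t _ _|n _]; first by rewrite lee_fin wbox_ge0.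
  by apply/measurable_EFinP; exact: mw.
- by move=> t _; apply: IH; exact: ltnW.
- by move=> n; by apply/measurable_EFinP; exact: mw.
Qed.

Lemma lebesgue_outer_box ab : (0 < k)%N -> lebesgue_outer (box ab) = box_volume ab.
Proof.
move=> k0; apply/eqP; rewrite eq_le lebesgue_outer_box_le /= leNgt; apply/negP.
move=> /(lebesgue_outer_lt_cover k0)[q [/box_volume_le_cover h]].
by apply/negP; rewrite -leNgt.
Qed.

Lemma lebesgue_outer_cube x r : (0 < k)%N -> 0 <= r ->
  lebesgue_outer (cube x r) = ((2 * r) ^+ k)%:E.
Proof. by move=> k0 r0; rewrite lebesgue_outer_box// cube_volume. Qed.

End Boxes.

(** * Regularity of Lebesgue measure *)

Section Regularity.
Context (R : realType) (k : nat).
Notation V := ('rV[R]_k).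
Implicit Types (A B : set V) (x y : V) (ab : V * V).

Lemma norm_le_coord x (j : 'I_k) : `|x 0 j| <= `|x|.
Proof.
rewrite [leRHS]mx_normrE (bigD1 (0, j))//= le_max lexx//.
Qed.

Lemma norm_leP x (r : R) : 0 <= r -> `|x| <= r <-> forall j, `|x 0 j| <= r.
Proof.
move=> r0; split=> [xr j|xr]; first exact: le_trans (norm_le_coord x j) xr.
rewrite [leLHS]mx_normrE; elim/big_ind: _ => // [a b ar br|[i j] _ /=].
  by rewrite ge_max ar.
by rewrite (ord1 i).
Qed.

Lemma norm_ltP x (r : R) : 0 < r -> `|x| < r <-> forall j, `|x 0 j| < r.
Proof.
move=> r0; split=> [xr j|xr]; first exact: le_lt_trans (norm_le_coord x j) xr.
rewrite [ltLHS]mx_normrE; elim/big_ind: _ => // [a b ar br|[i j] _ /=].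
  by rewrite gt_max ar.
by rewrite (ord1 i).
Qed.

Lemma cube_normP x r y : 0 <= r -> cube x r y <-> `|y - x| <= r.
Proof.
by move=> r0; rewrite cubeP norm_leP//; split=> h j; move: (h j); rewrite !mxE.
Qed.

Lemma coord_le_enorm m (v : 'rV[R]_m) j : `|v 0 j| <= enorm v.
Proof.
rewrite -sqrtr_sqr ler_wsqrtr// (bigD1 j)//= lerDl.
by apply: sumr_ge0 => i _; exact: sqr_ge0.
Qed.

Lemma open_lebesgue_measurable U : open U -> lebesgue_measurable (U : set V).
Proof.
move=> oU.
pose c (p : 'rV[rat]_k * rat) := cube (map_mx (@ratr R) p.1) (ratr p.2).
have -> : U = \bigcup_p (if pselect (c p `<=` U) then c p else set0).
  apply/seteqP; split=> x; last first.
    by move=> [p _]; case: pselect => // h; exact: h.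
  move=> Ux; have /nbhs_ballP[e /= e0 xeU] : nbhs x U by exact: open_nbhs_nbhs.
  have [r] := rat_in_itvoo (divr_gt0 e0 (ltr0n _ 2)); rewrite in_itv/= => /andP[r0 r1].
  have H j : exists q : rat, x 0 j - ratr r < ratr q < x 0 j + ratr r.
    have [|q] := @rat_in_itvoo R (x 0 j - ratr r) (x 0 j + ratr r); first lra.
    by rewrite in_itv/= => ?; exists q.
  pose q := \row_j sval (cid (H j)).
  exists (q, r) => //=; case: pselect => h.
    apply/cubeP => j; rewrite /= !mxE; case: cid => /= s /andP[? ?].
    by rewrite ler_distl; apply/andP; split; lra.
  exfalso; apply: h => y /cubeP /= yq; apply: xeU.
  rewrite -ball_normE /ball_ /=; apply/norm_ltP => // j.
  have := yq j; rewrite /= !mxE; case: cid => /= s /andP[? ?].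
  rewrite ler_distl => /andP[? ?]; rewrite ltr_distl; apply/andP; split; lra.
apply: countable_bigcupT_measurable; first exact: countableP.
by move=> p; case: (pselect (c p `<=` U)) => h //=; exact: measurable_box.
Qed.

Lemma closed_lebesgue_measurable F : closed F -> lebesgue_measurable (F : set V).
Proof.
move=> cF; rewrite -[F]setCK; apply: measurableC.
by apply: open_lebesgue_measurable; exact: closed_openC.
Qed.

(** The volume is continuous in the amount of the enlargement; the factors
    Num.max 0 (b - a) + 2 t dominate the sides of the enlarged box even when the
    original one is empty. *)
Lemma box_enlarge ab (d : R) : 0 < d -> exists t : R, 0 < t /\
  (box_volume (ab.1 - const_mx t, ab.2 + const_mx t)%R <= box_volume ab + d%:E)%E.
Proof.
move=> d0.
pose F (t : R) := \prod_(j < k) (Num.max 0 (ab.2 0 j - ab.1 0 j) + t *+ 2).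
have : F t @[t --> (0:R)] --> F 0.
  apply: cvg_big => [x|j _]; first exact: mul_continuous.
  by apply: cvgD; [exact: cvg_cst|apply: cvgMn; exact: cvg_id].
move=> /cvgrPdist_lt /(_ _ d0) /nbhs_ballP[e /= e0 He].
have e2 : 0 < e / 2 by rewrite divr_gt0.
exists (e / 2); split=> //.
have /He /= : ball (0:R) e (e / 2).
  by rewrite -ball_normE /= sub0r normrN gtr0_norm// ltr_pdivrMr// mulr2n mulrDr mulr1 ltrDl.
rewrite ltr_distlC => /andP[_ Fe].
rewrite /box_volume -EFinD lee_fin.
have F0 : F 0 = \prod_(j < k) Num.max 0 (ab.2 0 j - ab.1 0 j).
  by apply: eq_bigr => j _; rewrite mul0rn addr0.
rewrite -F0; apply: le_trans (ltW Fe).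
apply: ler_prod => j _; rewrite le_max lexx /= !mxE.
rewrite ge_max; apply/andP; split.
  by rewrite addr_ge0 ?le_max ?lexx// mulrn_wge0// ltW.
have : ab.2 0 j - ab.1 0 j <= Num.max 0 (ab.2 0 j - ab.1 0 j) by rewrite le_max lexx orbT.
by rewrite mulr2n; lra.
Qed.

Lemma outer_regular A (e : \bar R) : (0 < k)%N -> (lebesgue_outer A < e)%E ->
  exists U : set V, [/\ open U, A `<=` U & (lebesgue_outer U < e)%E].
Proof.
move=> k0 /(lebesgue_outer_lt_cover k0)[q [Aq qe]].
set s := (\sum_(n <oo) _)%E in qe.
have s0 : (0 <= s)%E by apply: nneseries_ge0 => *; exact: box_volume_ge0.
have [d d0 sde] : exists2 d : R, 0 < d & (s + d%:E < e)%E.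
  move: s0 qe; rewrite /s; case: (\sum_(n <oo) _)%E => [r| |]// _; case: e => [e| |]//.
    by rewrite lte_fin => re; exists ((e - r) / 2); rewrite -?EFinD ?lte_fin; lra.
  by move=> _; exists 1 => //; rewrite -EFinD ltry.
have H n : exists t : R, 0 < t /\ (box_volume ((q n).1 - const_mx t, (q n).2 + const_mx t)%R
    <= box_volume (q n) + (d / (2 ^ n.+1)%:R)%:E)%E.
  by apply: box_enlarge; rewrite divr_gt0// ltr0n expn_gt0.
have [t Ht] := choice H.
pose q' n := ((q n).1 - const_mx (t n), (q n).2 + const_mx (t n)).
pose U := \bigcup_n \bigcup_(x in box (q n)) (ball x (t n) : set V).
have Uq : U `<=` \bigcup_n box (q' n).
  move=> y [n _ [x xn]]; rewrite -ball_normE /ball_ /= => xy; exists n => // j.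
  have /(norm_ltP _ (Ht n).1)/(_ j) := xy.
  have /andP[h1 h2] := xn j; rewrite /= !mxE ltr_distl => /andP[? ?]; apply/andP; split; lra.
exists U; split.
- by apply: bigcup_open => n _; apply: bigcup_open => x _; exact: ball_open.
- move=> x /Aq[n _ xn]; exists n => //; exists x => //; apply: ballxx; exact: (Ht n).1.
- apply: le_lt_trans sde; apply: (le_trans (le_lebesgue_outer_cover Uq)).
  apply: le_trans (epsilon_trick _ _ _) => //; last 2 first.
  + by move=> n; exact: box_volume_ge0.
  + exact: ltW.
  apply: lee_nneseries => n _ *; first exact: box_volume_ge0.
  exact: (Ht n).2.
Qed.

Lemma compact_cube x (r : R) : 0 <= r -> compact (cube x r).
Proof.
move=> r0; have -> : cube x r = [set y | forall i, `[x 0 i - r, x 0 i + r]%classic (y 0 i)].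
  by apply/seteqP; split=> y h i; move: (h i); rewrite /= !mxE in_itv.
by apply: (@rV_compact R k (fun i => `[x 0 i - r, x 0 i + r]%classic)) => i; exact: segment_compact.
Qed.

Lemma lebesgue_measureD A B : lebesgue_measurable B -> B `<=` A ->
  (lebesgue_outer B < +oo)%E ->
  lebesgue_outer (A `\` B) = (lebesgue_outer A - lebesgue_outer B)%E.
Proof.
move=> mB BA Boo; have := mB A; rewrite /= setIidr// => ->.
rewrite -setDE addeAC subee ?add0e// ge0_fin_numE//; exact: lebesgue_outer_ge0.
Qed.

(** Take the complement in the cube of an open set that covers the rest of the
    cube tightly. *)
Lemma inner_regular A x (r e : R) : (0 < k)%N -> 0 <= r -> lebesgue_measurable A ->
  A `<=` cube x r -> 0 < e ->
  exists C : set V, [/\ compact C, C `<=` A & (lebesgue_outer (A `\` C) < e%:E)%E].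
Proof.
move=> k0 r0 mA AQ e0.
have fin B : B `<=` cube x r -> (lebesgue_outer B < +oo)%E.
  move=> BQ; apply: (le_lt_trans (le_lebesgue_outer BQ)).
  by rewrite lebesgue_outer_cube// ltry.
have fD : lebesgue_outer (cube x r `\` A) \is a fin_num.
  by rewrite ge0_fin_numE ?lebesgue_outer_ge0//; apply: fin; exact: subDsetl.
have [] := @outer_regular (cube x r `\` A) (lebesgue_outer (cube x r `\` A) + e%:E)%E k0.
  by rewrite lteDl// lte_fin.
move=> U [oU AU Ue]; exists (cube x r `\` U); split.
- apply: (@subclosed_compact _ _ (cube x r)) => //; last exact: compact_cube.
  rewrite setDE; apply: closedI; last exact: open_closedC.
  by apply: compact_closed; [exact: norm_hausdorff|exact: compact_cube].
- move=> y [yQ yU]; apply: contrapT => yA; apply: yU; exact: AU.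
- have mQA : lebesgue_measurable (cube x r `\` A).
    by apply: measurableD => //; exact: measurable_box.
  apply: (@le_lt_trans _ _ (lebesgue_outer (U `\` (cube x r `\` A)))).
    apply: le_lebesgue_outer => y [Ay]; move=> /not_andP h; split.
      by apply: contrapT => Uy; case: h => // h; apply: h; exact: AQ.
    by move=> [].
  rewrite lebesgue_measureD//; last by apply: fin; exact: subDsetl.
  by rewrite lteBlDl.
Qed.

End Regularity.

(** * The density theorem *)

Section Density.
Context (R : realType) (k : nat).
Notation V := ('rV[R]_k).
Notation mu := (@lebesgue_outer R k).
Implicit Types (A B K U : set V) (x y : V).

Definition disjoint_cubes (p q : V * R) : bool :=
  `[< cube p.1 p.2 `&` cube q.1 q.2 = set0 >].

Lemma ex_max_radius (p0 : V * R) (s : seq (V * R)) :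
  exists2 p, p \in p0 :: s & forall q, q \in p0 :: s -> q.2 <= p.2.
Proof.
elim: s p0 => [|p1 s IH] p0; first by exists p0; rewrite ?inE// => q; rewrite inE => /eqP ->.
have [p ps pmax] := IH p1.
have [h|h] := leP p0.2 p.2.
  by exists p => [|q]; rewrite inE ?ps ?orbT// => /orP[/eqP -> //|/pmax].
exists p0 => [|q]; rewrite inE ?eqxx// => /orP[/eqP -> //|/pmax /le_trans]; apply; exact: ltW.
Qed.

(** Greedy selection by decreasing radius: a cube meeting a larger selected one
    lies in its threefold enlargement. *)
Lemma vitali_cubes (s : seq (V * R)) : (forall p, p \in s -> 0 <= p.2) ->
  exists D : seq (V * R), [/\ {subset D <= s}, pairwise disjoint_cubes D &
    forall p, p \in s -> exists2 q, q \in D & cube p.1 p.2 `<=` cube q.1 (3 * q.2)].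
Proof.
have [m] := ubnP (size s); elim: m s => // m IH [|p0 s0] szs s_ge0.
  by exists [::]; split.
have [p ps pmax] := ex_max_radius p0 s0; move: (p0 :: s0) ps pmax s_ge0 szs => s ps pmax s_ge0 szs.
have [|q|D [Ds pD Dcov]] := IH [seq q <- s | disjoint_cubes p q].
- rewrite size_filter; rewrite -(count_predC (disjoint_cubes p)) in szs.
  rewrite ltnS in szs; apply: leq_trans szs; rewrite -addn1 leq_add2l -has_count.
  apply/hasP; exists p => //=; apply/negP => /asboolP h.
  have : (set0 : set V) p.1 by rewrite -h; split; apply/cubeP => j; rewrite subrr normr0 s_ge0.
  by [].
- by rewrite mem_filter => /andP[_ /s_ge0].
exists (p :: D); split.
- by move=> q; rewrite inE => /orP[/eqP -> //|/Ds]; rewrite mem_filter => /andP[].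
- by rewrite pairwise_cons pD andbT; apply/allP => q /Ds; rewrite mem_filter => /andP[].
move=> q qs; case: (boolP (disjoint_cubes p q)) => [pq|/asboolPn/eqP/set0P[z [zp zq]]].
  have [|q' q'D qq'] := Dcov q; first by rewrite mem_filter pq.
  by exists q' => //; rewrite inE q'D orbT.
exists p; first by rewrite inE eqxx.
move=> y /cubeP yq; apply/cubeP => j.
have := yq j; move/cubeP/(_ j): zp; move/cubeP/(_ j): zq; have := pmax _ qs.
rewrite !ler_distl => ? /andP[? ?] /andP[? ?] /andP[? ?]; apply/andP; split; lra.
Qed.

Lemma sum_disjoint_cubes (D : seq (V * R)) A : pairwise disjoint_cubes D ->
  (forall p, p \in D -> cube p.1 p.2 `<=` A) ->
  forall K, (\sum_(p <- D) mu (cube p.1 p.2 `\` K) <= mu (A `\` K))%E.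
Proof.
elim: D A => [|p D IH] A; first by move=> _ _ K; rewrite big_nil lebesgue_outer_ge0.
rewrite pairwise_cons => /andP[/allP pD DD] DA K; rewrite big_cons.
have -> : mu (A `\` K) = (mu ((A `\` K) `&` cube p.1 p.2) + mu ((A `\` cube p.1 p.2) `\` K))%E.
  rewrite [LHS](measurable_box (p.1 - const_mx p.2, p.1 + const_mx p.2)); congr (_ + mu _)%E.
  by rewrite !setDE -!setIA; congr (_ `&` _); rewrite setIC.
apply: leeD.
  apply: le_lebesgue_outer => x [xp xK]; split=> //; split=> //.
  by apply: (DA p) => //; rewrite inE eqxx.
apply: IH => // q qD x xq; split; first by apply: (DA q) => //; rewrite inE qD orbT.
move=> xp; have /asboolP h := pD _ qD.
by have : (set0 : set V) x by rewrite -h.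
Qed.


Lemma finite_cover_outer (I : eqType) (s : seq I) (F : I -> set V) A :
  (forall x, A x -> exists2 i, i \in s & F i x) -> (mu A <= \sum_(i <- s) mu (F i))%E.
Proof.
elim: s A => [|i s IH] A H.
  rewrite big_nil -(@lebesgue_outer0 R k); apply: le_lebesgue_outer => x /H[i]; by rewrite in_nil.
rewrite big_cons; apply: (@le_trans _ _ (mu (F i) + mu (A `\` F i))%E).
  apply: le_trans (outer_measureU2 (lebesgue_outer_measure R k) _ _).
  by apply: le_lebesgue_outer => x Ax; case: (pselect (F i x)); [left|right].
rewrite leeD2l//; apply: IH => x [/H[i']]; rewrite inE => /orP[/eqP -> //|i's xi _].
by exists i'.
Qed.

(** Density 1 at x measured with cubes, the balls of the sup norm, which unlike
    Euclidean balls have an explicit volume; see [density_point_dense] and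
    [dense_density_point] for the equivalence with the Euclidean notion. *)
Definition dense_at K x := forall c : R, 0 < c -> exists2 r0 : R, 0 < r0 &
  forall r, 0 < r -> r < r0 -> (mu (cube x r `\` K) <= (c * (2 * r) ^+ k)%:E)%E.

(** The Vitali covering argument.  Enclose the set N of bad points in an open U
    with mu (U \ K) <= d.  Finitely many disjoint bad cubes inside of U have
    threefold enlargements covering N up to measure d; each of them loses a
    proportion c of its volume to U \ K, so that their total volume is at most
    d / c, and N has measure at most 3^k d / c + d. *)
Lemma bad_density_null K (c M : R) : (0 < k)%N -> lebesgue_measurable K -> 0 < c -> 0 <= M ->
  mu [set x | [/\ K x, cube 0 M x & forall r0 : R, 0 < r0 -> exists r : R,
     [/\ 0 < r, r < r0 & ((c * (2 * r) ^+ k)%:E < mu (cube x r `\` K))%E]]] = 0%E.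
Proof.
move=> k0 mK c0 M0; set N := [set x | _].
have cubefin x r A : 0 <= r -> A `<=` cube x r -> (mu A < +oo)%E.
  move=> r0 Ar; apply: (le_lt_trans (le_lebesgue_outer Ar)).
  by rewrite lebesgue_outer_cube// ltry.
have NM : N `<=` cube 0 M by move=> x [].
have Nfin : mu N \is a fin_num.
  by rewrite ge0_fin_numE ?lebesgue_outer_ge0//; exact: cubefin NM.
apply/eqP; rewrite eq_le lebesgue_outer_ge0 andbT.
apply/lee_addgt0Pr => e e0; rewrite add0e.
pose C := 3 ^+ k / c + 1.
have C0 : 0 < C by rewrite addr_gt0// divr_gt0// exprn_gt0.
pose d := e / C.
have d0 : 0 < d by rewrite divr_gt0.
have [] := @outer_regular R k N (mu N + d%:E)%E k0; first by rewrite lteDl// lte_fin.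
move=> U [oU NU Ud].
have UK : (mu (U `\` K) <= d%:E)%E.
  have : (mu N + mu (U `\` K) <= mu N + d%:E)%E.
    apply: le_trans (ltW Ud); rewrite [leRHS](mK U); apply: leeD => //.
    by apply: le_lebesgue_outer => x Nx; split; [exact: NU|case: Nx].
  by rewrite leeD2lE.
have H x : exists r : R, N x ->
    [/\ 0 < r, r < 1, cube x r `<=` U & ((c * (2 * r) ^+ k)%:E < mu (cube x r `\` K))%E].
  case: (pselect (N x)) => Nx; last by exists 0.
  have /nbhs_ballP[a /= a0 xaU] : nbhs x U by apply: open_nbhs_nbhs; split=> //; exact: NU.
  have [_ _ /(_ (Num.min a 1))] := Nx.
  rewrite lt_min a0 ltr01 => /(_ isT)[r [r0]]; rewrite lt_min => /andP[ra r1] h.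
  exists r => _; split=> // y /(cube_normP _ _ (ltW r0)) yx; apply: xaU.
  by rewrite -ball_normE /ball_ /= distrC (le_lt_trans yx).
have [r Hr] := choice H.
pose W := \bigcup_(x in N) (ball x (r x) : set V).
have oW : open W by apply: bigcup_open => x _; exact: ball_open.
have WM : W `<=` cube 0 (M + 1).
  move=> y [x Nx]; rewrite -ball_normE /ball_ /= => xy.
  have [r0 r1 _ _] := Hr _ Nx.
  apply/cube_normP; first by rewrite addr_ge0.
  have /cube_normP := NM _ Nx; rewrite !subr0 => /(_ M0) xM.
  rewrite -(subrK x y) (le_trans (ler_normD _ _))// addrC lerD// distrC ltW//.
  exact: lt_trans r1.
have [||Cp [cC CW Cd]] := @inner_regular R k W 0 (M + 1) d k0 _ _ WM d0.
- by rewrite addr_ge0.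
- exact: open_lebesgue_measurable.
have [s [sN Cs]] : exists s : seq (V * R), (forall p, p \in s -> N p.1 /\ p.2 = r p.1) /\
    Cp `<=` [set x | exists2 p, p \in s & cube p.1 p.2 x].
  have : cover_compact Cp by rewrite -compact_cover.
  move=> /(_ V N (fun x => ball x (r x))) [|x Cx|F FN CF].
  - by move=> x Nx; exact: ball_open.
  - by have [y Ny yx] := CW _ Cx; exists y.
  exists [seq (x, r x) | x <- finmap.enum_fset F]; split.
    by move=> p /mapP[x xF ->] /=; split=> //; have := FN _ xF; rewrite inE.
  move=> x /CF[y /= yF]; rewrite -ball_normE /ball_ /= => yx.
  exists (y, r y); first by apply/mapP; exists y.
  apply/cube_normP => /=; last by rewrite distrC ltW.
  by apply: ltW; apply: le_lt_trans yx.
have [|D [Ds pD Dcov]] := @vitali_cubes s.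
  by move=> p /sN[Np ->]; have [/ltW] := Hr _ Np.
have DN p : p \in D -> N p.1 /\ p.2 = r p.1 by move/Ds/sN.
have CD : (mu Cp <= \sum_(p <- D) ((3 * (2 * p.2)) ^+ k)%:E)%E.
  have CpD : Cp `<=` [set x | exists2 p, p \in [seq (q.1, 3 * q.2) | q <- D] & cube p.1 p.2 x].
    move=> x /Cs[p /Dcov[q qD pq] xp].
    by exists (q.1, 3 * q.2); [apply/mapP; exists q|exact: pq].
  apply: (le_trans (finite_cover_outer CpD)).
  rewrite big_map; rewrite [leLHS]big_seq [leRHS]big_seq; apply: lee_sum => p /DN[Np pr].
  have [r0 _ _ _] := Hr _ Np; rewrite /= lebesgue_outer_cube//; last first.
    by rewrite pr mulr_ge0// ltW.
  by rewrite lee_fin mulrCA.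
have DU : (\sum_(p <- D) (c * (2 * p.2) ^+ k)%:E <= d%:E)%E.
  apply: le_trans UK; apply: le_trans (@sum_disjoint_cubes D U pD _ K); last first.
    by move=> p /DN[Np ->]; have [] := Hr _ Np.
  rewrite [leLHS]big_seq [leRHS]big_seq; apply: lee_sum => p /DN[Np ->].
  by have [_ _ _ /ltW] := Hr _ Np.
move: CD DU; rewrite !sumEFin => CD; rewrite lee_fin -mulr_sumr => DU.
apply: (@le_trans _ _ (mu Cp + mu (W `\` Cp))%E).
  apply: le_trans (outer_measureU2 (lebesgue_outer_measure R k) _ _).
  apply: le_lebesgue_outer => x Nx.
  have Wx : W x by exists x => //; apply: ballxx; have [] := Hr _ Nx.
  by case: (pselect (Cp x)); [left|right].
apply: (le_trans (leeD CD (ltW Cd))); rewrite -EFinD lee_fin.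
under eq_bigr => p _ do rewrite exprMn.
have -> : e = C * d by rewrite /d mulrC divfK// gt_eqF.
rewrite -mulr_sumr /C mulrDl mul1r lerD2r -mulrA ler_pM2l ?exprn_gt0//.
by rewrite mulrC ler_pdivlMr// mulrC.
Qed.

Lemma null_subset A B : A `<=` B -> mu B = 0%E -> mu A = 0%E.
Proof.
move=> AB B0; apply/eqP; rewrite eq_le lebesgue_outer_ge0 andbT -B0.
exact: le_lebesgue_outer.
Qed.

Lemma null_bigcup (F : nat -> set V) : (forall n, mu (F n) = 0%E) ->
  mu (\bigcup_n F n) = 0%E.
Proof.
move=> F0; apply/eqP; rewrite eq_le lebesgue_outer_ge0 andbT.
apply: (le_trans (lebesgue_outer_sigma_subadditive _)).
by rewrite eseries0.
Qed.

Lemma null_setU A B : mu A = 0%E -> mu B = 0%E -> mu (A `|` B) = 0%E.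
Proof.
move=> A0 B0; apply/eqP; rewrite eq_le lebesgue_outer_ge0 andbT.
apply: (le_trans (outer_measureU2 (lebesgue_outer_measure R k) _ _)).
by rewrite [X in (X + _)%E]A0 [X in (_ + X)%E]B0 adde0.
Qed.

Lemma nat_above (y : R) : exists n : nat, y < n%:R.
Proof.
by exists (Num.bound `|y|); exact: le_lt_trans (ler_norm y) (archi_boundP (normr_ge0 y)).
Qed.

Lemma small_inv (c : R) : 0 < c -> exists n : nat, n.+1%:R^-1 < c.
Proof.
move=> c0; have [n cn] := nat_above c^-1; exists n.
rewrite invf_plt ?posrE//; apply: lt_trans cn _.
by rewrite ltr_nat.
Qed.

Lemma in_large_cube x : exists n : nat, cube 0 n%:R x.
Proof.
have [n xn] := nat_above `|x|; exists n; apply/cube_normP => //.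
by rewrite subr0 ltW.
Qed.

(** The Lebesgue density theorem. *)
Lemma dense_at_ae K : (0 < k)%N -> lebesgue_measurable K ->
  mu [set x | K x /\ ~ dense_at K x] = 0%E.
Proof.
move=> k0 mK.
pose N n m := [set x | [/\ K x, cube 0 m%:R x & forall r0 : R, 0 < r0 -> exists r : R,
     [/\ 0 < r, r < r0 & (((n.+1%:R^-1) * (2 * r) ^+ k)%:E < mu (cube x r `\` K))%E]]].
apply: (@null_subset _ (\bigcup_n \bigcup_m N n m)); last first.
  apply: null_bigcup => n; apply: null_bigcup => m.
  by apply: bad_density_null => //; rewrite ?invr_gt0.
move=> x [Kx /existsNP[c /not_implyP[c0 h]]].
have [n nc] := small_inv c0; have [m xm] := in_large_cube x.
exists n => //; exists m => //; split=> // r0 r00; apply: contrapT => h'.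
apply: h; exists r0 => // r rp rr0; rewrite leNgt; apply/negP => hr.
apply: h'; exists r; split=> //; apply: le_lt_trans hr.
by rewrite lee_fin ler_wpM2r ?exprn_ge0 ?mulr_ge0 ?ltW.
Qed.

Lemma dense_atS K K' x : K `<=` K' -> dense_at K x -> dense_at K' x.
Proof.
move=> KK' Kx c c0; have [r0 r00 H] := Kx c c0; exists r0 => // r rp rr0.
apply: le_trans (H r rp rr0); apply: le_lebesgue_outer; exact: setDS.
Qed.

Lemma dense_atT x : dense_at setT x.
Proof.
move=> c c0; exists 1 => // r rp _; rewrite setDT lebesgue_outer0 lee_fin.
by rewrite mulr_ge0 ?exprn_ge0 ?mulr_ge0 ?ltW.
Qed.

Lemma dense_atI K K' x : dense_at K x -> dense_at K' x -> dense_at (K `&` K') x.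
Proof.
move=> Kx K'x c c0.
have c2 : 0 < c / 2 by rewrite divr_gt0.
have [r0 r00 H] := Kx _ c2; have [r1 r10 H'] := K'x _ c2.
exists (Num.min r0 r1); first by rewrite lt_min r00.
move=> r rp; rewrite lt_min => /andP[rr0 rr1].
have -> : cube x r `\` (K `&` K') = (cube x r `\` K) `|` (cube x r `\` K').
  by rewrite setDIr.
apply: (le_trans (outer_measureU2 (lebesgue_outer_measure R k) _ _)).
have := leeD (H r rp rr0) (H' r rp rr1); move/le_trans; apply.
by rewrite -EFinD lee_fin -mulrDl -splitr.
Qed.

Lemma dense_at_bigcap m (K : 'I_m -> set V) x : (forall j, dense_at (K j) x) ->
  dense_at [set y | forall j, K j y] x.
Proof.
move=> H.
suff : dense_at (\big[setI/setT]_(j < m) K j) x.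
  by apply: dense_atS => y h j; move: h; rewrite (bigD1 j)//= => -[].
by apply: (big_ind (fun A => dense_at A x)); [exact: dense_atT|move=> A B; exact: dense_atI|move=> j _; exact: H].
Qed.

(** A set of density 1 at x comes e r close to every point of the ball of radius
    r around x: otherwise it would miss a cube of radius e r. *)
Lemma dense_at_meets K x (e : R) : (0 < k)%N -> dense_at K x -> 0 < e ->
  exists2 r0 : R, 0 < r0 & forall r, 0 < r -> r < r0 ->
    forall v, `|v| <= r -> exists2 p, K p & `|p - (x + v)| <= e * r.
Proof.
move=> k0 Kx e0.
have e1 : 0 < 1 + e by rewrite addr_gt0.
(* Half of the proportion of volume that a cube of radius e r takes in a
   cube of radius (1 + e) r. *)
pose c := (e / (1 + e)) ^+ k / 2.
have c0 : 0 < c by rewrite divr_gt0// exprn_gt0// divr_gt0.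
have [r0 r00 H] := Kx _ c0.
exists (r0 / (1 + e)); first by rewrite divr_gt0.
move=> r rp rr0 v vr; apply: contrapT => h.
have rr : 0 < r * (1 + e) by rewrite mulr_gt0.
have er : 0 < e * r by rewrite mulr_gt0.
have := H _ rr; rewrite -ltr_pdivlMr// => /(_ rr0).
apply/negP; rewrite -ltNge.
apply: (@lt_le_trans _ _ (mu (cube (x + v) (e * r)))); last first.
  apply: le_lebesgue_outer => y /(cube_normP _ _ (ltW er)) yr; split.
    apply/cube_normP; first exact: ltW; rewrite mulrDr mulr1 (mulrC r e).
    rewrite (_ : y - x = v + (y - (x + v))); last by apply/rowP => i; rewrite !mxE; ring.
    by rewrite (le_trans (ler_normD _ _))// lerD.
  by move=> Ky; apply: h; exists y.
rewrite lebesgue_outer_cube ?ltW// lte_fin.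
rewrite /c mulrAC -exprMn ltr_pdivrMr//.
rewrite (_ : e / (1 + e) * (2 * (r * (1 + e))) = 2 * (e * r)); last by field; rewrite gt_eqF.
by rewrite ltr_pMr ?ltr1n// exprn_gt0// mulr_gt0.
Qed.

Lemma norm_le_enorm x : `|x| <= enorm x.
Proof.
by apply/norm_leP => [|j]; [exact: sqrtr_ge0|exact: coord_le_enorm].
Qed.

Lemma enorm_le_norm x : enorm x <= k%:R * `|x|.
Proof.
have kx : 0 <= k%:R * `|x| by rewrite mulr_ge0.
rewrite -[leRHS]ger0_norm// -sqrtr_sqr ler_wsqrtr// exprMn.
apply: (@le_trans _ _ (\sum_(j < k) `|x| ^+ 2)).
  by apply: ler_sum => j _; rewrite -(real_normK (num_real (x 0 j))) lerXn2r ?nnegrE// norm_le_coord.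
rewrite sumr_const card_ord -[leLHS]mulr_natl ler_wpM2r ?sqr_ge0//.
by rewrite -natrX ler_nat; case: (k) => // m; rewrite leq_pmulr.
Qed.

Lemma eball_sub_cube x (r : R) : 0 < r -> eball x r `<=` cube x r.
Proof.
move=> r0 y; rewrite /eball /= => /ltW xy; apply/cube_normP; first exact: ltW.
exact: le_trans (norm_le_enorm _) xy.
Qed.

Lemma cube_sub_eball x (r : R) : 0 < r -> cube x r `<=` eball x (k.+1%:R * r).
Proof.
move=> r0 y /(cube_normP _ _ (ltW r0)) xy; rewrite /eball /=.
apply: (le_lt_trans (enorm_le_norm _)); apply: (@le_lt_trans _ _ (k%:R * r)).
  by rewrite ler_wpM2l.
by rewrite ltr_pM2r// ltr_nat.
Qed.

(** The density quotient differs from 1 by the proportion of the ball outside K;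
    the bounds compare the volume of the ball with that of cubes. *)
Lemma density_ratioE K x (r : R) : (0 < k)%N -> lebesgue_measurable K -> 0 < r ->
  [/\ 0 < fine (mu (eball x r)), fine (mu (eball x r)) <= (2 * r) ^+ k,
   (2 * r / k.+1%:R) ^+ k <= fine (mu (eball x r)),
   mu (eball x r `\` K) = (fine (mu (eball x r `\` K)))%:E &
   fine (lebesgue_rV R k (K `&` eball x r)) / fine (lebesgue_rV R k (eball x r)) =
   1 - fine (mu (eball x r `\` K)) / fine (mu (eball x r))].
Proof.
move=> k0 mK r0.
have fin A : A `<=` cube x r -> mu A \is a fin_num.
  move=> AQ; rewrite ge0_fin_numE ?lebesgue_outer_ge0//.
  by apply: (le_lt_trans (le_lebesgue_outer AQ)); rewrite lebesgue_outer_cube ?ltW// ltry.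
have Bc := @eball_sub_cube x _ r0.
have fB := fin _ Bc.
have fBK : mu (eball x r `\` K) \is a fin_num.
  by apply: fin; apply: subset_trans Bc; exact: subDsetl.
have fIK : mu (eball x r `&` K) \is a fin_num.
  by apply: fin; apply: subset_trans Bc; exact: subIsetl.
have lo : (2 * r / k.+1%:R) ^+ k <= fine (mu (eball x r)).
  rewrite -lee_fin fineK// -mulrA -(lebesgue_outer_cube x k0); last by rewrite divr_ge0// ltW.
  apply: le_lebesgue_outer; apply: (subset_trans (@cube_sub_eball x _ _)).
    by rewrite divr_gt0.
  by rewrite mulrC divfK.
have B0 : 0 < fine (mu (eball x r)).
  by apply: lt_le_trans lo; rewrite exprn_gt0// divr_gt0// mulr_gt0.
split=> //; last 2 first.
- by rewrite fineK.
- have E : mu (eball x r) = (mu (eball x r `&` K) + mu (eball x r `\` K))%E by exact: mK.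
  rewrite -[X in X - _](divff (lt0r_neq0 B0)) -mulrBl; congr (_ / _).
  by rewrite setIC [in RHS]E fineD//= addrK.
- rewrite -lee_fin fineK// -(lebesgue_outer_cube x k0 (ltW r0)); exact: le_lebesgue_outer.
Qed.

Lemma density_point_dense K x : (0 < k)%N -> lebesgue_measurable K ->
  density_point K x -> dense_at K x.
Proof.
move=> k0 mK H c c0.
pose c' := c / k.+1%:R ^+ k.
have c'0 : 0 < c' by rewrite divr_gt0// exprn_gt0.
move/cvgrPdist_lt: H => /(_ _ c'0) [a /= a0 Ha].
exists (a / k.+1%:R); first by rewrite divr_gt0.
move=> r r0 ra.
have kr0 : 0 < k.+1%:R * r by rewrite mulr_gt0.
have [B0 Bup _ EB Er] := density_ratioE x k0 mK kr0.
have := Ha (k.+1%:R * r); rewrite /ball_ /= sub0r normrN gtr0_norm// mulrC -ltr_pdivlMr//.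
rewrite mulrC => /(_ ra kr0); rewrite Er opprB addrCA subrr addr0 => h.
apply: (@le_trans _ _ (mu (eball x (k.+1%:R * r) `\` K))).
  by apply: le_lebesgue_outer; apply: setSD; exact: cube_sub_eball.
rewrite EB lee_fin.
have {}h := le_lt_trans (ler_norm _) h; rewrite ltr_pdivrMr// in h.
apply: (le_trans (ltW h)); apply: (@le_trans _ _ (c' * (2 * (k.+1%:R * r)) ^+ k)).
  by rewrite ler_wpM2l// ltW.
by rewrite mulrCA exprMn mulrA /c' divfK// expf_neq0.
Qed.

Lemma dense_density_point K x : (0 < k)%N -> lebesgue_measurable K ->
  dense_at K x -> density_point K x.
Proof.
move=> k0 mK H; apply/cvgrPdist_le => e e0.
pose c := e / k.+1%:R ^+ k.
have c0 : 0 < c by rewrite divr_gt0// exprn_gt0.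
have [a a0 Ha] := H c c0.
exists a => //= r; rewrite /ball_ /= sub0r normrN => ra r0.
rewrite gtr0_norm// in ra.
have [B0 _ Blo EB ->] := density_ratioE x k0 mK r0.
rewrite opprB addrCA subrr addr0.
rewrite ger0_norm; last by rewrite divr_ge0// fine_ge0// lebesgue_outer_ge0.
rewrite ler_pdivrMr//; apply: (@le_trans _ _ (c * (2 * r) ^+ k)).
  rewrite -lee_fin -EB; apply: le_trans (Ha _ r0 ra).
  by apply: le_lebesgue_outer; apply: setSD; exact: eball_sub_cube.
apply: le_trans (ler_wpM2l (ltW e0) Blo).
by rewrite /c expr_div_n mulrAC mulrA.
Qed.

End Density.

(** * Increments along horizontal curves *)

Section SlopeMeasurable.
Context (R : realType).
Notation leb := (@lebesgue_measure R).

Lemma le_integral_subset (A B : set R) (f : R -> \bar R) : A `<=` B ->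
  (forall x, (0 <= f x)%E) -> (\int[leb]_(x in A) f x <= \int[leb]_(x in B) f x)%E.
Proof.
move=> AB f0; rewrite !ge0_integralE//; apply: ereal_sup_le => _ [h hA <-].
exists h => // x; apply: le_trans (hA x) _; rewrite /patch.
by case: ifPn => [xA|_]; [rewrite mem_set//; apply: AB; exact: set_mem|case: ifP].
Qed.

Definition clamp (a b s : R) : R := Num.max a (Num.min b s).

Lemma clamp_id a b s : a <= s -> s <= b -> clamp a b s = s.
Proof. by move=> as_ sb; rewrite /clamp min_r// max_r. Qed.

Lemma clamp_itv a b s : a <= b -> a <= clamp a b s <= b.
Proof. by move=> ab; rewrite /clamp le_max lexx ge_max ab ge_min lexx. Qed.

Lemma clamp_lip a b s t : a <= b -> `|clamp a b s - clamp a b t| <= `|s - t|.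
Proof.
move=> ab; have /andP[h1 h2] : - `|s - t| <= s - t <= `|s - t| by rewrite -ler_norml.
have cl z : [\/ z <= a /\ clamp a b z = a, a <= z <= b /\ clamp a b z = z |
    b <= z /\ clamp a b z = b].
  rewrite /clamp; have [bz|zb] := leP b z; first by rewrite max_r//; apply: Or33.
  have [az|za] := leP a z; first by apply: Or32; rewrite (ltW zb).
  by apply: Or31; rewrite ltW.
rewrite ler_norml; case: (cl s) => -[? ->]; case: (cl t) => -[? ->];
  by apply/andP; split; lra.
Qed.

(** A slope is a limit of difference quotients; phi is made continuous on the
    whole line by clamping its argument to [a, b]. *)
Lemma measurable_slope (phi m : R -> R) a b (D : set R) : a <= b ->
  (forall e : R, 0 < e -> exists2 d : R, 0 < d & forall s t, a <= s <= b -> a <= t <= b ->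
     `|s - t| < d -> `|phi s - phi t| <= e) ->
  measurable D -> (forall s, D s -> a < s < b) ->
  (forall s, D s -> has_slope phi s (m s)) -> measurable_fun D m.
Proof.
move=> ab uc mD Dab slo.
pose psi s := phi (clamp a b s).
have cpsi : continuous psi.
  move=> s; apply/cvgrPdist_le => e e0; have [d d0 Hd] := uc e e0.
  apply/nbhs_ballP; exists d => //= t; rewrite /ball_ /= => st.
  by apply: Hd; rewrite ?clamp_itv//; exact: le_lt_trans (clamp_lip _ _ ab) st.
have mpsi : measurable_fun setT psi by exact: continuous_measurable_fun.
pose f (n : nat) s := n.+1%:R * (psi (s + n.+1%:R^-1) - psi s).
apply: (@measurable_fun_cvg _ _ R D f) => [n|s Ds].
  apply: measurable_funTS; apply: measurable_funM; first exact: measurable_cst.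
  apply: measurable_funB => //.
  by apply: measurableT_comp => //; apply: measurable_funD => //; exact: measurable_cst.
apply/cvgrPdist_lt => e e0.
have [d d0 Hd] := slo s Ds _ (divr_gt0 e0 (ltr0n _ 2)).
have /andP[as_ sb] := Dab _ Ds.
have cv : (n.+1%:R^-1 : R) @[n --> \oo] --> (0 : R) by exact: cvg_harmonic.
have b0 : 0 < Num.min d (b - s) by rewrite lt_min d0 subr_gt0.
move/cvgrPdist_lt/(_ _ b0): cv; apply: filterS => n.
rewrite sub0r normrN => nd.
have n0 : 0 < n.+1%:R^-1 :> R by rewrite invr_gt0.
have := nd; rewrite gtr0_norm// lt_min => /andP[nd1 nb].
have ib : s + n.+1%:R^-1 <= b by rewrite -lerBrDl ltW.
have ia : a <= s + n.+1%:R^-1 by rewrite (le_trans (ltW as_))// lerDl ltW.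
rewrite /f /psi (clamp_id ia ib) (clamp_id (ltW as_) (ltW sb)).
have := Hd n.+1%:R^-1; rewrite gtr0_norm// => /(_ nd1).
rewrite -(ler_pM2l (_ : (0:R) < n.+1%:R))// mulrCA divff ?pnatr_eq0// mulr1.
rewrite -[X in X * `|_|](gtr0_norm (_ : (0:R) < n.+1%:R))// -normrM.
rewrite mulrBr (mulrA _ _^-1) divff ?pnatr_eq0// mul1r distrC => /le_lt_trans; apply.
by rewrite gtr_pMr// invf_lt1// ltr1n.
Qed.


End SlopeMeasurable.

Section Curves.
Context (R : realType) (n : nat).
Notation leb := (@lebesgue_measure R).
Notation H := (heis R n).

Lemma omegaBl (u v w : 'rV[R]_(n + n)) : omega (u - v) w = omega u w - omega v w.
Proof.
rewrite /omega -sumrB; apply: eq_bigr => i _; rewrite /xc /yc !mxE; ring.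
Qed.

Lemma omegaDr (u v w : 'rV[R]_(n + n)) : omega u (v + w) = omega u v + omega u w.
Proof.
rewrite /omega -big_split; apply: eq_bigr => i _; rewrite /xc /yc !mxE /=; ring.
Qed.

Lemma omegaZr (u v : 'rV[R]_(n + n)) a : omega u (a *: v) = a * omega u v.
Proof.
rewrite /omega mulr_sumr; apply: eq_bigr => i _; rewrite /xc /yc !mxE /=; ring.
Qed.

Lemma omegaxx (u : 'rV[R]_(n + n)) : omega u u = 0.
Proof. by rewrite /omega big1// => i _; rewrite mulrC subrr. Qed.

Lemma hvec2 (p : H) c : (hvec p c).2 = - (2 * omega p.1 c).
Proof.
rewrite /hvec (raddf_sum (@snd 'rV[R]_(n + n) R)) /omega mulr_sumr -sumrN.
apply: eq_bigr => i _ /=; rewrite /xc /yc /GRing.scale /=; ring.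
Qed.


Lemma omega_le (u v : 'rV[R]_(n + n)) (r : R) : (forall j, `|u 0 j| <= r) ->
  `|omega u v| <= 2 * n%:R * r * enorm v.
Proof.
move=> ur; apply: (le_trans (ler_norm_sum _ _ _)).
apply: (@le_trans _ _ (\sum_(i < n) 2 * (r * enorm v))).
  apply: ler_sum => i _; rewrite mulr2n mulrDl mul1r.
  by rewrite (le_trans (ler_normB _ _))// lerD// normrM ler_pM// ?ur// coord_le_enorm.
by rewrite sumr_const card_ord -[leLHS]mulr_natl; rewrite -!mulrA mulrCA.
Qed.

Lemma ac_dist (V : normedModType R) (g : R -> V) a b : abs_continuous g a b ->
  forall e : R, 0 < e -> exists2 d : R, 0 < d & forall s t, a <= s <= b -> a <= t <= b ->
     `|s - t| < d -> `|g s - g t| <= e.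
Proof.
move=> ac e e0; have [d d0 Hd] := ac e e0; exists d => // s t.
wlog st : s t / s <= t => [hw|/andP[as_ sb] /andP[at_ tb] std].
  have [st|ts] := leP s t; first exact: hw.
  by move=> ? ? ?; rewrite distrC; apply: hw => //; rewrite ?ltW// distrC.
have := Hd 1%N (fun=> s) (fun=> t); rewrite !big_ord1 distrC => h; apply/ltW/h.
- by move=> _; split.
- by move=> i j _ _ _; rewrite (ord1 i) (ord1 j).
- by move: std; rewrite distrC ger0_norm// subr_ge0.
Qed.

(* The coordinates of z and the function t + 2 omega (z(p), z) are bounded
   linear functionals of the point, which are treated together. *)
Section functional.
Context (L : H -> R) (C : R).
Context (L_lin : forall (a : R) (u v : H), L (a *: u + v) = a * L u + L v).
Context (L_bnd : forall v : H, `|L v| <= C * `|v|).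
Context (g : R -> H) (a b : R) (g_hor : horizontal_curve g a b).

Let LB u v : L (u - v) = L u - L v.
Proof. by rewrite addrC -scaleN1r L_lin mulN1r addrC. Qed.

Let C1_gt0 : 0 < C + 1 \/ forall v, L v = 0.
Proof.
have [C0|C0] := leP 0 C; first by left; rewrite ltr_wpDl.
right => v; apply/eqP; rewrite -normr_le0 (le_trans (L_bnd v))//.
by rewrite nmulr_rle0.
Qed.

Lemma functional_upper_ac x : x <= b -> upper_ac (L \o g) a x.
Proof.
move=> xb e e0; case: C1_gt0 => [C0|L0]; last first.
  by exists 1 => // N s t _ _ _; rewrite big1 ?ltW// => i _; rewrite /= !L0 subrr.
have [d d0 Hd] := g_hor.1 (e / (C + 1)) (divr_gt0 e0 C0).
exists d => // N s t h1 h2 h3; have := Hd N s t _ h2 h3.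
rewrite ltr_pdivlMr// => /(_ _)/ltW h.
apply: le_trans (h _); last by move=> i; have [? ? tx] := h1 i; split=> //; exact: le_trans tx xb.
rewrite mulr_suml; apply: ler_sum => i _ /=; rewrite -LB.
apply: (le_trans (ler_norm _)); apply: (le_trans (L_bnd _)).
by rewrite mulrC ler_wpM2l// lerDl.
Qed.

Lemma functional_has_slope s : derivable g s 1 -> has_slope (L \o g) s (L ('D_1 g s)).
Proof.
move=> /derivable_eps D e e0; case: C1_gt0 => [C0|L0]; last first.
  by exists 1 => // t _; rewrite /= !L0 mulr0 !subr0 normr0 mulr_ge0// ltW.
have [d d0 Hd] := D _ (divr_gt0 e0 C0); exists d => // t td.
have := Hd t td; rewrite mulrAC ler_pdivlMr// => h.
apply: le_trans h.
rewrite /= (_ : _ - _ = L (g (s + t) - g s - t *: 'D_1 g s)).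
  by apply: (le_trans (L_bnd _)); rewrite mulrC ler_wpM2l// lerDl.
rewrite !LB; congr (_ - _).
by have := L_lin t ('D_1 g s) 0; rewrite addr0 => ->; have := LB 0 0; rewrite !subrr => ->; rewrite addr0.
Qed.
End functional.

Lemma measurable_hnorm (g : R -> H) a b (D : set R) : a <= b -> abs_continuous g a b ->
  measurable D -> (forall s, D s -> a < s < b /\ derivable g s 1) ->
  measurable_fun D (fun s => hnorm ('D_1 g s)).
Proof.
move=> ab ac mD Dg.
apply: (@measurableT_comp _ _ _ _ _ _ (@Num.sqrt R)).
  by apply: continuous_measurable_fun; exact: sqrt_continuous.
apply: measurable_sum => j; apply: measurable_funX.
apply: (@measurable_slope _ (fun s => (g s).1 0 j) _ a b) => //.
- move=> e e0; have [d d0 Hd] := ac_dist ac e0; exists d => // s t h1 h2 h3.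
  apply: le_trans (Hd s t h1 h2 h3); rewrite [leRHS]/Num.norm /= le_max.
  by have := norm_le_coord ((g s).1 - (g t).1) j; rewrite !mxE => ->.
- by move=> s /Dg[].
- move=> s /Dg[_ ds].
  apply: (@functional_has_slope (fun v => v.1 0 j) 1) => //.
  + by move=> c u v; rewrite /= !mxE.
  + move=> v; rewrite mul1r [leRHS]/Num.norm /= le_max norm_le_coord//.
Qed.

(** The functional L varies along the curve at a rate of at most m times the
    speed; [upper_ac_le_integral] integrates this rate. *)
Lemma curve_functional_le (L : H -> R) (C m : R) (g : R -> H) a b x :
  (forall (a : R) (u v : H), L (a *: u + v) = a * L u + L v) ->
  (forall v : H, `|L v| <= C * `|v|) ->
  horizontal_curve g a b -> a <= x -> x <= b -> 0 <= m ->
  (forall s c, a <= s <= b -> L (hvec (g s) c) <= m * enorm c) ->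
  ((L (g x) - L (g a))%:E <= m%:E * curve_length g a b)%E.
Proof.
move=> L_lin L_bnd hg ax xb m0 Lm.
have [ac [N [mN N0 NN]]] := hg.
pose D := `]a, x[%classic `\` N.
have mD : measurable D by apply: measurableD => //; exact: measurable_itv.
have Dab s : D s -> [/\ a < s, s < b, derivable g s 1 & hspace (g s) ('D_1 g s)].
  move=> [/=]; rewrite in_itv/= => /andP[as_ sx] Ns.
  have sb := lt_le_trans sx xb.
  suff [dg hs] : derivable g s 1 /\ hspace (g s) ('D_1 g s) by split.
  by apply: contrapT => h; apply: Ns; apply: NN => /= /(_ _); rewrite in_itv/= !ltW// => /(_ isT).
have ab := le_trans ax xb.
have mh : measurable_fun D (fun s => hnorm ('D_1 g s)).
  by apply: (measurable_hnorm ab ac mD) => s /Dab[-> ->].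
have hn0 (v : H) : 0 <= hnorm v by exact: sqrtr_ge0.
apply: (@le_trans _ _ (\int[leb]_(s in D) (m * hnorm ('D_1 g s))%:E)%E).
  apply: (@upper_ac_le_integral _ (L \o g) a x D (fun s => m * hnorm ('D_1 g s))) => //.
  - exact: (functional_upper_ac L_lin L_bnd hg).
  - by exists N; split=> // s [sx /not_andP[]// /contrapT].
  - by apply: measurable_funM => //; exact: measurable_cst.
  - by move=> s _; rewrite mulr_ge0.
  - move=> s /Dab[as_ sb dg [c _ hc]].
    apply: (@slope_leW _ _ _ (L ('D_1 g s))); last first.
      exact/has_slope_le/(functional_has_slope L_lin L_bnd).
    by rewrite -hc /hnorm hvec1 Lm// (ltW as_) ltW.
under eq_integral do rewrite EFinM.
rewrite ge0_integralZl_EFin//; [|by move=> s _; rewrite lee_fin|exact/measurable_EFinP].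
apply: lee_wpmul2l; first by rewrite lee_fin.
apply: le_integral_subset => [s /Dab[/ltW as_ /ltW sb _ _]|s]; last by rewrite lee_fin.
by rewrite /= in_itv/= as_.
Qed.

Lemma curve_functional_norm (L : H -> R) (C m l : R) (g : R -> H) a b x :
  (forall (a : R) (u v : H), L (a *: u + v) = a * L u + L v) ->
  (forall v : H, `|L v| <= C * `|v|) ->
  horizontal_curve g a b -> a <= x -> x <= b -> 0 <= m ->
  (curve_length g a b <= l%:E)%E ->
  (forall s c, a <= s <= b -> `|L (hvec (g s) c)| <= m * enorm c) ->
  `|L (g x) - L (g a)| <= m * l.
Proof.
move=> L_lin L_bnd hg ax xb m0 gl Lm.
have ml : (m%:E * curve_length g a b <= (m * l)%:E)%E by rewrite EFinM lee_wpmul2l// lee_fin.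
rewrite ler_norml; apply/andP; split; rewrite -lee_fin; last first.
  apply: (le_trans _ ml); apply: (curve_functional_le L_lin L_bnd hg) => // s c sab.
  exact: le_trans (ler_norm _) (Lm s c sab).
rewrite EFinN leeNl -EFinN opprB addrC -[X in - _ + X]opprK.
apply: (le_trans _ ml).
apply: (@curve_functional_le (fun v => - L v) C m g a b x) => //.
- by move=> c u v; rewrite L_lin opprD mulrN.
- by move=> v; rewrite normrN.
- move=> s c sab; apply: le_trans (Lm s c sab).
  by rewrite -normrN ler_norm.
Qed.

(** Along a curve of length l from p, every coordinate of z changes by at most l,
    and the functional t + 2 omega (z(p), z) changes at the rate
    2 omega (z(p) - z, z'), which is at most 4 n l times the speed. *)
Lemma dcc_le (p q : H) (c : R) : (dcc p q <= c%:E)%E ->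
  `|q.1 - p.1| <= c /\ `|q.2 - p.2 + 2 * omega p.1 q.1| <= 4 * n%:R * c ^+ 2.
Proof.
move=> pqc.
have key l : c < l -> [/\ 0 <= l, forall j, `|(q.1 - p.1) 0 j| <= l &
    `|q.2 - p.2 + 2 * omega p.1 q.1| <= 4 * n%:R * l ^+ 2].
  move=> cl; have : (dcc p q < l%:E)%E by apply: le_lt_trans pqc _; rewrite lte_fin.
  move=> /ereal_inf_lt[_ [a [b [g [ab hg ga gb ->]]]] /ltW gl].
  have coord x j : a <= x -> x <= b -> `|((g x).1 - (g a).1) 0 j| <= l.
    move=> ax xb; rewrite -[l]mul1r 2!mxE.
    apply: (@curve_functional_norm (fun v => v.1 0 j) 1 1 l g a b x) => //.
    - by move=> r u v; rewrite /= !mxE.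
    - by move=> v; rewrite mul1r [leRHS]/Num.norm /= le_max norm_le_coord.
    - by move=> s d _; rewrite hvec1 mul1r coord_le_enorm.
  have l0 : 0 <= l.
    rewrite -lee_fin; apply: le_trans gl; apply: integral_ge0 => s _.
    by rewrite lee_fin sqrtr_ge0.
  split=> //; first by move=> j; rewrite -gb -ga coord// ltW.
  have main : `|(g b).2 + 2 * omega p.1 (g b).1 - ((g a).2 + 2 * omega p.1 (g a).1)|
      <= 4 * n%:R * l * l; last first.
    move: main; rewrite ga gb omegaxx mulr0 addr0 addrAC => main.
    by rewrite expr2 mulrA.
  apply: (@curve_functional_norm (fun v => v.2 + 2 * omega p.1 v.1)
    (1 + 2 * (2 * n%:R * `|p.1| * (n + n)%:R)) (4 * n%:R * l) l g a b b) => //.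
  - move=> r u v /=; rewrite omegaDr omegaZr /GRing.scale /=; ring.
  - move=> v; apply: (le_trans (ler_normD _ _)); rewrite [leRHS]mulrDl mul1r lerD//.
      by rewrite [leRHS]/Num.norm /= le_max lexx orbT.
    rewrite normrM ger0_norm// -[leRHS]mulrA ler_pM2l//.
    apply: (le_trans (omega_le _ (norm_le_coord _))).
    rewrite -!mulrA; do 3 ![apply: ler_wpM2l => //].
    apply: (le_trans (enorm_le_norm _)); rewrite ler_wpM2l//.
    by rewrite [leRHS]/Num.norm /= le_max lexx.
  - exact: ltW.
  - by rewrite !mulr_ge0.
  - move=> s d /andP[as_ sb]; rewrite hvec1 hvec2 addrC -mulrBr -omegaBl -normrN.
    rewrite -mulrN normrM ger0_norm//.
    rewrite (_ : 4 * n%:R * l * enorm d = 2 * (2 * n%:R * l * enorm d)); last by ring.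
    rewrite ler_pM2l// normrN omega_le// => j.
    by have := coord s j as_ sb; rewrite ga !mxE distrC.
have c0 : 0 <= c.
  rewrite leNgt; apply/negP => c0; have cc : c < c / 2 by move: c0; clear => c0; lra.
  by have [h _ _] := key _ cc; move: c0 h; clear => c0 h; lra.
split.
  apply/norm_leP => // j; apply/ler_addgt0Pr => e e0.
  by have [|_ h _] := key (c + e); [rewrite ltrDl|exact: h].
apply/ler_addgt0Pr => e e0.
pose K : R := 4 * n%:R * (2 * c + 1).
have K0 : 0 <= K by rewrite mulr_ge0 ?mulr_ge0 ?addr_ge0 ?mulr_ge0.
(* The distance being an infimum, the bound is known for all lengths c + d
   with d > 0; this d makes 4 n (c + d)^2 - 4 n c^2 at most e. *)
pose d := Num.min 1 (e / (K + 1)).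
have K1 : 0 < K + 1 by rewrite ltr_wpDl.
have d0 : 0 < d by rewrite lt_min ltr01 divr_gt0.
have dK : (K + 1) * d <= e by rewrite mulrC -ler_pdivlMr// ge_min lexx orbT.
have d1 : d <= 1 by rewrite ge_min lexx.
have [|_ _ h] := key (c + d); first by rewrite ltrDl.
apply: (le_trans h).
have : K * d <= (K + 1) * d by rewrite ler_wpM2r ?lerDl// ltW.
have : 4 * n%:R * d * (2 * c + d) <= 4 * n%:R * d * (2 * c + 1).
  by apply: ler_wpM2l; [rewrite !mulr_ge0// ltW|rewrite lerD2l].
move: dK; rewrite /K; clearbody d; clear; move: (n%:R : R) => N; lra.
Qed.

End Curves.

(** * Isotropy at points of approximate differentiability *)

Section Isotropy.
Context (R : realType) (n k : nat).
Notation V := ('rV[R]_k).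
Notation W := ('rV[R]_(n + n)).

Lemma linear_bound (m : nat) (L : {linear V -> 'rV[R]_m}) :
  exists2 C : R, 0 <= C & forall v, `|L v| <= C * `|v|.
Proof.
exists (\sum_(j < k) `|L (delta_mx 0 j)|); first exact: sumr_ge0.
move=> v; rewrite [in leLHS](row_sum_delta v) linear_sum mulr_suml.
apply: (le_trans (ler_norm_sum _ _ _)); apply: ler_sum => j _.
by rewrite linearZ normrZ mulrC ler_wpM2l// norm_le_coord.
Qed.

Lemma omega_norm (u v : W) : `|omega u v| <= 2 * n%:R * (n + n)%:R * (`|u| * `|v|).
Proof.
apply: (le_trans (omega_le _ (norm_le_coord u))).
rewrite (_ : 2 * n%:R * (n + n)%:R * (`|u| * `|v|) = 2 * n%:R * `|u| * ((n + n)%:R * `|v|)); last by ring.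
by rewrite ler_wpM2l ?mulr_ge0// enorm_le_norm.
Qed.

Lemma omegaDl (u v w : W) : omega (u + v) w = omega u w + omega v w.
Proof.
rewrite /omega -big_split; apply: eq_bigr => i _; rewrite /xc /yc !mxE /=; ring.
Qed.

Lemma omegaC (u v : W) : omega v u = - omega u v.
Proof. by rewrite /omega -sumrN; apply: eq_bigr => i _; ring. Qed.

Lemma omegaZl (u v : W) a : omega (a *: u) v = a * omega u v.
Proof.
rewrite /omega mulr_sumr; apply: eq_bigr => i _; rewrite /xc /yc !mxE /=; ring.
Qed.

Lemma omegaBr (u v w : W) : omega u (v - w) = omega u v - omega u w.
Proof. by rewrite omegaDr -scaleN1r omegaZr mulN1r. Qed.

Lemma omega_collinear (u d : W) (s t : R) :
  omega (u + s *: d) (u + t *: d) = (t - s) * omega u d.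
Proof.
rewrite omegaDl !omegaDr !omegaZl !omegaZr !omegaxx.
rewrite (omegaC u d); ring.
Qed.

Lemma omega_diff (u v u' v' : W) :
  omega u v - omega u' v' = omega (u - u') v + omega u' (v - v').
Proof. by rewrite omegaBl omegaBr; ring. Qed.

Section polygon.
Context (z : V -> W) (t : V -> R) (L : {linear V -> W}) (K : set V) (x : V) (z0 : W) (M : R).
Context (z_diff : forall e : R, 0 < e -> exists2 d : R, 0 < d &
  forall p, K p -> `|p - x| < d -> `|z p - z0 - L (p - x)| <= e * `|p - x|).
Context (M_ge0 : 0 <= M).
Context (t_quad : exists2 d : R, 0 < d & forall p q, K p -> K q -> `|p - x| < d ->
  `|q - x| < d -> `|t q - t p + 2 * omega (z p) (z q)| <= M * `|q - p| ^+ 2).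
Context (K_meets : forall e : R, 0 < e -> exists2 d : R, 0 < d &
  forall r, 0 < r -> r < d -> forall v, `|v| <= r -> exists2 p, K p & `|p - (x + v)| <= e * r).

Let cn : R := 2 * n%:R * (n + n)%:R.

(** The edge from v to w, in the scale s, with vertices P (v_i) in K close to
    x + s v_i.  The term 2 omega z0 (z (P w) - z (P v)) comes from replacing z by
    z - z0 in omega (z_i, z_(i+1)); it cancels around a closed polygon.  For the
    linear map L the numbers omega (L v_i, L v_(i+1)) are exactly
    omega (L v, L w) / N.+1. *)
Lemma polygon_edge (P : V -> V) (A C s e eta : R) (N : nat) (v w : V) :
  0 < s -> 0 <= A -> 0 <= C -> (forall u, `|L u| <= C * `|u|) -> 0 <= e -> 0 <= eta -> eta <= 1 ->
  2 * e <= A / N.+1%:R ->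
  (forall u, `|u| <= A -> `|P u - (x + s *: u)| <= e * s) ->
  (forall u, `|u| <= A -> `|z (P u) - z0 - s *: L u| <= eta * s) ->
  (forall u u', `|u| <= A -> `|u'| <= A ->
     `|t (P u') - t (P u) + 2 * omega (z (P u)) (z (P u'))| <= M * `|P u' - P u| ^+ 2) ->
  `|w - v| <= A -> `|v| <= A -> `|w| <= A ->
  `|t (P w) - t (P v) + 2 * omega z0 (z (P w) - z (P v)) + 2 * s ^+ 2 * omega (L v) (L w)| <=
    N.+1%:R * (M * (2 * A / N.+1%:R * s) ^+ 2 + 2 * cn * s ^+ 2 * eta * (2 * (C * A) + 1)).
Proof.
move=> s0 A0 C0 LC e0 eta0 eta1 eN HP Hz Ht wv vA wA.
pose vi (i : nat) := v + (i%:R / N.+1%:R) *: (w - v).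
have v0 : vi 0%N = v by rewrite /vi mul0r scale0r addr0.
have vN : vi N.+1 = w by rewrite /vi divff// scale1r addrC subrK.
(* F telescopes to the left-hand side; its increments are one application of
   the estimate on t and the comparison of z with L. *)
pose F i := t (P (vi i)) + 2 * omega z0 (z (P (vi i))) + (i%:R / N.+1%:R) * (2 * s ^+ 2 * omega (L v) (L w)).
have -> : t (P w) - t (P v) + 2 * omega z0 (z (P w) - z (P v)) + 2 * s ^+ 2 * omega (L v) (L w)
   = \sum_(0 <= i < N.+1) (F i.+1 - F i).
  rewrite telescope_sumr// /F v0 vN omegaBr divff// mul0r; ring.
apply: (le_trans (ler_norm_sum _ _ _)).
have vA' i : (i <= N.+1)%N -> `|vi i| <= A.
  move=> iN; have i0 : 0 <= i%:R / N.+1%:R :> R by rewrite divr_ge0.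
  have i1 : 0 <= 1 - i%:R / N.+1%:R :> R by rewrite subr_ge0 ler_pdivrMr// mul1r ler_nat.
  rewrite (_ : vi i = (1 - i%:R / N.+1%:R) *: v + (i%:R / N.+1%:R) *: w); last first.
    by rewrite /vi scalerBr scalerBl scale1r; apply/rowP => j; rewrite !mxE; ring.
  rewrite (le_trans (ler_normD _ _))// !normrZ !ger0_norm//.
  rewrite (_ : A = (1 - i%:R / N.+1%:R) * A + (i%:R / N.+1%:R) * A); last by ring.
  by rewrite lerD// ler_wpM2l.
have viS i : vi i.+1 - vi i = N.+1%:R^-1 *: (w - v).
  rewrite /vi opprD addrACA subrr add0r -scalerBl; congr (_ *: _).
  by rewrite -mulrBl -natrB// subSnn mul1r.
have step i : (i < N.+1)%N -> `|F i.+1 - F i| <=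
    M * (2 * A / N.+1%:R * s) ^+ 2 + 2 * cn * s ^+ 2 * eta * (2 * (C * A) + 1).
  move=> iN; have h1 := vA' i (ltnW iN); have h2 := vA' i.+1 iN.
  set W1 := z (P (vi i)) - z0; set W2 := z (P (vi i.+1)) - z0.
  set l1 := s *: L (vi i); set l2 := s *: L (vi i.+1).
  have d1 : `|W1 - l1| <= eta * s by exact: Hz.
  have d2 : `|W2 - l2| <= eta * s by exact: Hz.
  have l12 : omega l1 l2 = N.+1%:R^-1 * (s ^+ 2 * omega (L v) (L w)).
    have Lvi m : L (vi m) = L v + (m%:R / N.+1%:R) *: (L w - L v).
      by rewrite /vi linearD linearZ linearB.
    rewrite omegaZl omegaZr !Lvi omega_collinear omegaBr omegaxx.
    by rewrite subr0 -mulrBl -natrB// subSnn; ring.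
  have -> : F i.+1 - F i = (t (P (vi i.+1)) - t (P (vi i)) + 2 * omega (z (P (vi i))) (z (P (vi i.+1))))
      - 2 * (omega W1 W2 - omega l1 l2).
    rewrite l12 /F /W1 /W2 !omegaBl !omegaBr omegaxx (omegaC z0 (z (P (vi i)))).
    by rewrite -natr1; ring.
  rewrite (le_trans (ler_normB _ _))// lerD//.
    apply: (le_trans (Ht _ _ h1 h2)); rewrite ler_wpM2l// lerXn2r ?nnegrE//.
      by rewrite !mulr_ge0// ltW.
    rewrite (_ : P (vi i.+1) - P (vi i) = (P (vi i.+1) - (x + s *: vi i.+1)) -
       (P (vi i) - (x + s *: vi i)) + s *: (vi i.+1 - vi i)); last first.
      by apply/rowP => j; rewrite !mxE; ring.
    rewrite viS; apply: (le_trans (ler_normD _ _)).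
    rewrite (_ : 2 * A / N.+1%:R * s = A / N.+1%:R * s + s * (N.+1%:R^-1 * A)); last by ring.
    rewrite lerD//.
      apply: (le_trans (ler_normB _ _)); apply: (le_trans (lerD (HP _ h2) (HP _ h1))).
      by rewrite -mulrDl ler_wpM2r ?(ltW s0)//; move: eN; rewrite mulr_natl mulr2n.
    by rewrite !normrZ (gtr0_norm s0) gtr0_norm// !ler_wpM2l// ltW.
  rewrite normrM ger0_norm// -!mulrA ler_pM2l//.
  have -> : omega W1 W2 - omega l1 l2 = omega (W1 - l1) W2 + omega l1 (W2 - l2).
    exact: omega_diff.
  have L1 : `|l1| <= s * (C * A).
    by rewrite normrZ gtr0_norm// ler_pM2l// (le_trans (LC _))// ler_wpM2l.
  have L2 : `|W2| <= s * (C * A + 1).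
    rewrite -(subrK l2 W2) (le_trans (ler_normD _ _))// addrC mulrDr mulr1 lerD//.
      by rewrite normrZ gtr0_norm// ler_pM2l// (le_trans (LC _))// ler_wpM2l.
    by apply: le_trans d2 _; rewrite ler_piMl// ltW.
  have cn0 : 0 <= cn by rewrite !mulr_ge0.
  apply: (le_trans (ler_normD _ _)).
  rewrite [leRHS](_ : _ = cn * ((eta * s) * (s * (C * A + 1))) + cn * ((s * (C * A)) * (eta * s))); last by rewrite /cn; ring.
  by rewrite lerD// (le_trans (omega_norm _ _))// ler_wpM2l// ler_pM.
apply: (@le_trans _ _ (\sum_(0 <= i < N.+1) (M * (2 * A / N.+1%:R * s) ^+ 2 + 2 * cn * s ^+ 2 * eta * (2 * (C * A) + 1)))).
  by apply: ler_sum_nat => i /andP[_ iN]; exact: step.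
by rewrite sumr_const_nat subn0 -[leLHS]mulr_natl.
Qed.

(** Add up [polygon_edge] over the edges 0 a, a b and b 0 of a triangle, with
    errors e and eta of the order 1 / N^2 obtained by taking s small. *)
Lemma omega_image_eq0 (a b : V) : omega (L a) (L b) = 0.
Proof.
have [C C0 LC] := linear_bound L.
pose A : R := `|a| + `|b| + 1.
have A1 : 1 <= A by rewrite lerDr addr_ge0.
have A0 : 0 <= A by exact: le_trans A1.
have cn0 : 0 <= cn by rewrite !mulr_ge0.
pose C' : R := 3 * (4 * M * A ^+ 2 + 2 * cn * (2 * (C * A) + 1)).
suff H (N : nat) : 2 * `|omega (L a) (L b)| <= C' / N.+1%:R.
  apply/eqP; rewrite -normr_le0 leNgt; apply/negP => h.
  have [N] := nat_above (C' / (2 * `|omega (L a) (L b)|)).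
  rewrite ltr_pdivrMr ?mulr_gt0// => hN; have := H N.
  rewrite ler_pdivlMr// mulrC => /le_lt_trans /(_ hN).
  by rewrite ltr_pM2r ?mulr_gt0// ltr_nat ltnNge leqnSn.
(* The tolerance: each of the 3 (N + 1) pieces may be off by O(s^2 / N^2). *)
pose dl : R := N.+1%:R^-1 ^+ 2.
have dl0 : 0 < dl by rewrite exprn_gt0// invr_gt0.
have N1 : N.+1%:R^-1 <= 1 :> R by rewrite invf_le1// ler1n.
have dlN : dl <= N.+1%:R^-1 by rewrite /dl expr2 ler_piMr// invr_ge0.
have dl1 : dl <= 1 by exact: le_trans N1.
pose e1 : R := dl / (2 * (A + 1)).
have A10 : 0 < A + 1 by rewrite ltr_wpDl.
have C10 : 0 < C + 1 by rewrite ltr_wpDl.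
have e10 : 0 < e1 by rewrite divr_gt0// mulr_gt0.
pose e : R := dl / (2 * (C + 1)).
have e0 : 0 < e by rewrite divr_gt0// mulr_gt0.
have e_dl : e * (2 * (C + 1)) = dl by rewrite /e divfK// gt_eqF// mulr_gt0.
have e1_dl : e1 * (2 * (A + 1)) = dl by rewrite /e1 divfK// gt_eqF// mulr_gt0.
have e_le : 2 * e <= dl.
  by rewrite -e_dl mulrA (mulrC e 2) ler_peMr ?lerDr// mulr_ge0// ltW.
have e_le1 : e <= 1 by rewrite (le_trans _ (le_trans e_le dl1))// ler_peMl ?(ltW e0)// ler1n.
have A_gt0 : 0 < A by exact: lt_le_trans A1.
have [d1 d10 Hd1] := z_diff e10.
have [d2 d20 Hd2] := t_quad.
have [d3 d30 Hd3] := K_meets (divr_gt0 e0 A_gt0).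
pose d := Num.min d1 (Num.min d2 d3).
have d0 : 0 < d by rewrite !lt_min d10 d20.
pose s := d / (2 * (A + 1)).
have s0 : 0 < s by rewrite divr_gt0// mulr_gt0.
have sd : (A + 1) * s < d.
  rewrite (_ : (A + 1) * s = d / 2); first by rewrite gtr_pMr// invf_lt1// ltr1n.
  by rewrite /s; field; rewrite gt_eqF.
have sd1 : (A + 1) * s < d1 by apply: (lt_le_trans sd); rewrite ge_min lexx.
have sd2 : (A + 1) * s < d2 by apply: (lt_le_trans sd); rewrite !ge_min lexx orbT.
have sd3 : A * s < d3.
  apply: (@le_lt_trans _ _ ((A + 1) * s)); first by rewrite ler_wpM2r ?lerDl// ltW.
  by apply: (lt_le_trans sd); rewrite !ge_min lexx !orbT.
have HP (u : V) : exists p : V, `|u| <= A -> K p /\ `|p - (x + s *: u)| <= e * s.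
  have [uA|] := leP `|u| A; last by exists 0.
  have As0 : 0 < A * s by rewrite mulr_gt0.
  have [|p Kp] := Hd3 _ As0 sd3 (s *: u).
    by rewrite normrZ gtr0_norm// mulrC ler_wpM2r// ltW.
  by rewrite mulrA divfK ?gt_eqF// => hp; exists p.
have [P {}HP] := choice HP.
have Px u : `|u| <= A -> `|P u - x| <= (A + 1) * s.
  move=> uA; have [_ h] := HP u uA.
  rewrite -[P u](subrK (x + s *: u)) -addrA (addrC x) addrK mulrDl mul1r addrC.
  rewrite (le_trans (ler_normD _ _))// addrC lerD//.
    by rewrite normrZ gtr0_norm// mulrC ler_wpM2r// ltW.
  by apply: le_trans h _; rewrite ler_piMl// ltW.
have Hz u : `|u| <= A -> `|z (P u) - z0 - s *: L u| <= dl * s.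
  move=> uA; have [Kp h] := HP u uA; have hx := Px u uA.
  have h1 := Hd1 _ Kp (le_lt_trans hx sd1).
  have -> : z (P u) - z0 - s *: L u = (z (P u) - z0 - L (P u - x)) + L (P u - (x + s *: u)).
    have -> : L (P u - (x + s *: u)) = L (P u - x) - s *: L u.
      by rewrite opprD addrA linearB linearZ_LR.
    by rewrite addrA subrK.
  rewrite (le_trans (ler_normD _ _))// [dl]splitr mulrDl lerD//.
    apply: (le_trans h1); apply: (@le_trans _ _ (e1 * ((A + 1) * s))).
      by rewrite ler_pM2l.
    by rewrite -e1_dl (_ : e1 * (2 * (A + 1)) / 2 * s = e1 * ((A + 1) * s))//; field.
  apply: (le_trans (LC _)); apply: (@le_trans _ _ ((C + 1) * (e * s))).
    by rewrite ler_pM// lerDl.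
  by rewrite -e_dl (_ : e * (2 * (C + 1)) / 2 * s = (C + 1) * (e * s))//; field.
have Ht u u' : `|u| <= A -> `|u'| <= A ->
     `|t (P u') - t (P u) + 2 * omega (z (P u)) (z (P u'))| <= M * `|P u' - P u| ^+ 2.
  move=> uA u'A; have [Ku _] := HP u uA; have [Ku' _] := HP u' u'A.
  by apply: Hd2 => //; [exact: le_lt_trans (Px u uA) sd2|exact: le_lt_trans (Px u' u'A) sd2].
have edge (v w : V) : `|w - v| <= A -> `|v| <= A -> `|w| <= A ->
  `|t (P w) - t (P v) + 2 * omega z0 (z (P w) - z (P v)) + 2 * s ^+ 2 * omega (L v) (L w)| <=
    N.+1%:R * (M * (2 * A / N.+1%:R * s) ^+ 2 + 2 * cn * s ^+ 2 * dl * (2 * (C * A) + 1)).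
  move=> wv vA wA; apply: (@polygon_edge P A C s e) => //; try exact: ltW.
  - by rewrite (le_trans e_le)// (le_trans dlN)// -[leLHS]mul1r ler_wpM2r// invr_ge0.
  - by move=> u /HP[].
have aA : `|a| <= A by rewrite /A -addrA lerDl addr_ge0.
have bA : `|b| <= A by rewrite /A addrAC addrC lerDl addr_ge0.
have baA : `|b - a| <= A.
  by rewrite (le_trans (ler_normB _ _))// addrC lerDl.
have := edge 0 a; rewrite subr0 normr0 => /(_ aA A0 aA) E1.
have := edge b 0; rewrite sub0r normrN normr0 => /(_ bA bA A0) E3.
have E2 := edge a b baA aA bA.
have s20 : 0 < s ^+ 2 by rewrite exprn_gt0.
rewrite -(ler_pM2l s20).
have -> : s ^+ 2 * (C' / N.+1%:R) = N.+1%:R * (M * (2 * A / N.+1%:R * s) ^+ 2 + 2 * cn * s ^+ 2 * dl * (2 * (C * A) + 1)) +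
   N.+1%:R * (M * (2 * A / N.+1%:R * s) ^+ 2 + 2 * cn * s ^+ 2 * dl * (2 * (C * A) + 1)) +
   N.+1%:R * (M * (2 * A / N.+1%:R * s) ^+ 2 + 2 * cn * s ^+ 2 * dl * (2 * (C * A) + 1)).
  have N0 : N.+1%:R != 0 :> R by rewrite pnatr_eq0.
  by rewrite /C' /dl; move: (N.+1%:R : R) N0 => m m0; field.
apply: le_trans (lerD (lerD E1 E2) E3).
apply: le_trans (le_trans (ler_normD _ _) (lerD (ler_normD _ _) (lexx _))).
rewrite linear0 -{1}(gtr0_norm s20) -{1}(gtr0_norm (ltr0n R 2)) -!normrM.
rewrite le_eqVlt; apply/orP; left; apply/eqP; congr (`| _ |).
have w0 (u : W) : omega 0 u = 0 by rewrite -(subrr u) omegaBl subrr.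
by rewrite w0 (omegaC 0) w0 !omegaBr; ring.
Qed.

End polygon.

Lemma rowB m (u v : 'rV[R]_m) j : (u - v) 0 j = u 0 j - v 0 j.
Proof. by rewrite !mxE. Qed.

Lemma differentiable_eps (g : V -> R) (x : V) : differentiable g x ->
  forall e : R, 0 < e -> exists2 d : R, 0 < d &
   forall p, `|p - x| < d -> `|g p - g x - 'd g x (p - x)| <= e * `|p - x|.
Proof.
move=> /diff_locally /eqaddoP H e e0.
have /nbhs_ballP[d /= d0 Hd] := H e e0.
exists d => // p px; have := Hd (p - x).
rewrite -ball_normE /ball_ /= sub0r normrN => /(_ px).
by rewrite /= !fctE /= subrK opprD addrA.
Qed.

(** The components of z come with different sets of agreement; their
    intersection still has density 1 at x. *)
Lemma isotropic_ap_diff (E : set V) (f : V -> heis R n) (x : V) (L : 'Hom(V, W)) :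
  (0 < n)%N -> (0 < k)%N -> locally_lipschitz E f -> E x ->
  is_ap_diff E (@heis_proj R n \o f) x L -> isotropic (limg L).
Proof.
move=> n0 k0 f_lip Ex apL.
have HKg j : exists Kg : set V * (V -> R), [/\ lebesgue_measurable Kg.1 /\ Kg.1 `<=` E,
    C1 Kg.2, {in Kg.1, Kg.2 =1 (fun y => (f y).1 0 j)},
    density_point Kg.1 x & (fun v => L v 0 j) = 'd (Kg.2) x].
  by have [K [g [h1 h2 h3 h4 h5]]] := apL j; exists (K, g).
have [Kg {}HKg] := choice HKg.
pose K := [set y | forall j, (Kg j).1 y].
have KE : K `<=` E.
  pose i0 : 'I_(n + n) := Ordinal (leq_trans n0 (leq_addr n n)).
  by move=> y /(_ i0) Ky; have [[_ h] _ _ _ _] := HKg i0; exact: h.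
have Kx : dense_at K x.
  apply: dense_at_bigcap => j; have [[mK _] _ _ dK _] := HKg j.
  exact: density_point_dense.
have [r [C [r0 fC]]] := f_lip x Ex.
suff main a b : omega (L a) (L b) = 0.
  by move=> v w /memv_imgP[a _ ->] /memv_imgP[b _ ->].
pose z0 : W := \row_j (Kg j).2 x.
pose C' := `|C| * k%:R.
apply: (@omega_image_eq0 (fun p => (f p).1) (fun p => (f p).2) L K x z0 (4 * n%:R * C' ^+ 2)).
- move=> e e0.
  have H j : exists2 d : R, 0 < d & forall p, K p -> `|p - x| < d ->
     `|((f p).1 - z0 - L (p - x)) 0 j| <= e * `|p - x|.
    have [_ [dg _] gf _ Lg] := HKg j.
    have [d d0 Hd] := differentiable_eps (dg x) e0.
    exists d => // p Kp px; have Lp : L (p - x) 0 j = 'd ((Kg j).2) x (p - x) by rewrite -Lg.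
    rewrite 2!rowB Lp mxE -gf ?inE//; exact: Hd.
  have H' j : exists d : R, 0 < d /\ forall p, K p -> `|p - x| < d ->
     `|((f p).1 - z0 - L (p - x)) 0 j| <= e * `|p - x| by have [d d0 h] := H j; exists d.
  have [d Hd] := choice H'.
  exists (\big[Num.min/1]_j d j).
    by apply: (big_ind (fun y => 0 < y)) => // [y y' y0 y'0|j _]; [rewrite lt_min y0|exact: (Hd j).1].
  move=> p Kp pd; apply/norm_leP; first by rewrite mulr_ge0// ltW.
  move=> j; apply: (Hd j).2 => //; apply: lt_le_trans pd _.
  by rewrite (bigD1 j)//= ge_min lexx.
- by rewrite !mulr_ge0.
- exists (r / k.+1%:R); first by rewrite divr_gt0.
  move=> p q Kp Kq px qx.
  have inball y : K y -> `|y - x| < r / k.+1%:R -> (E `&` eball x r) y.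
    move=> Ky yx; split; first exact: KE.
    apply: (le_lt_trans (enorm_le_norm _)); rewrite ltr_pdivlMr// mulrC in yx.
    by apply: le_lt_trans yx; rewrite ler_wpM2r// ler_nat.
  have pq : (dcc (f p) (f q) <= (C' * `|q - p|)%:E)%E.
    apply: le_trans (fC _ _ (inball _ Kp px) (inball _ Kq qx)) _.
    rewrite lee_fin; apply: (@le_trans _ _ (`|C| * enorm (p - q))).
      by rewrite ler_wpM2r ?ler_norm// sqrtr_ge0.
    by rewrite /C' -mulrA ler_wpM2l// (le_trans (enorm_le_norm _))// distrC.
  have [_ h] := dcc_le pq.
  by rewrite -[leRHS]mulrA -exprMn.
- by move=> e e0; exact: dense_at_meets.
Qed.

End Isotropy.

(** * Lipschitz functions on the line *)

Section Lipschitz1.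
Context (R : realType) (u : R -> R) (C : R).
Context (C_gt0 : 0 < C) (u_lip : forall x y, `|u x - u y| <= C * `|x - y|).
Notation leb := (@lebesgue_measure R).

Let v (x : R) := u x + C * x.

(** The function v x = u x + C x is the cumulative function of a measure that is
    absolutely continuous with density at most 2 C. *)
Lemma lip_cumul_mono x y : x <= y -> 0 <= v y - v x <= 2 * C * (y - x).
Proof.
move=> xy; have := u_lip y x; rewrite (ger0_norm (_ : 0 <= y - x)) ?subr_ge0//.
by rewrite ler_norml /v => /andP[h1 h2]; apply/andP; split; lra.
Qed.

Let v_nd : nondecreasing v.
Proof. by move=> x y /lip_cumul_mono/andP[+ _]; rewrite subr_ge0. Qed.

Let v_cont : continuous v.
Proof.
move=> x; apply: cvgD; last by apply: cvgM; [exact: cvg_cst|exact: cvg_id].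
apply/cvgrPdist_le => e e0; apply/nbhs_ballP; exists (e / C) => /=; first by rewrite divr_gt0.
move=> y; rewrite /ball_ /= ltr_pdivlMr// mulrC => /ltW xy.
exact: le_trans (u_lip x y) xy.
Qed.

Let v_rc := right_continuousW v_cont.
HB.instance Definition _ := isCumulative.Build R _ R v v_nd v_rc.

Local Notation nu := (lebesgue_stieltjes_measure v).

Let nu_itv x y : x <= y -> nu `]x, y] = (v y - v x)%:E.
Proof.
move=> xy; rewrite /lebesgue_stieltjes_measure /measure_extension measurable_mu_extE/=.
  exact: wlength_itv_bnd.
exact: is_ocitv.
Qed.

Let nu_dom : nu `<< leb.
Proof.
apply/null_content_dominatesP => A mA A0.
apply/eqP; rewrite eq_le measure_ge0 andbT; apply/lee_addgt0Pr => e e0; rewrite add0e.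
have C2 : 0 < 2 * C by rewrite mulr_gt0.
have : (leb A < (e / (2 * C))%:E)%E by rewrite A0 lte_fin divr_gt0.
move=> /ereal_inf_lt[_ [F [mF AF] <-] Fe].
apply: (@le_trans _ _ (\sum_(k <oo) wlength v (F k))%E).
  by apply: ereal_inf_lbound; exists F.
apply: (@le_trans _ _ (\sum_(k <oo) ((2 * C)%:E * wlength idfun (F k)))%E).
  apply: lee_nneseries => [k _ _|k _]; first exact: wlength_ge0.
  have [->|[[x y] /= xy ->]] := (ocitvP _).1 (mF k); first by rewrite !wlength0 mule0.
  rewrite wlength_itv_bnd; last exact: ltW.
  rewrite wlength_itv_bnd; last exact: ltW.
  rewrite -EFinM lee_fin.
  by have /andP[] := lip_cumul_mono (ltW xy).
rewrite nneseriesZl; last by move=> k _; exact: wlength_ge0.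
by rewrite -lee_pdivlMl// -EFinM mulrC ltW.
Qed.

(** Radon-Nikodym on ]-M, M] writes v as the primitive of an integrable function,
    to which the Lebesgue differentiation theorem applies. *)
Lemma lipschitz_ae_slope_bounded (M : R) : 0 < M ->
  leb.-negligible [set x | - M < x < M /\ ~ exists m, has_slope u x m].
Proof.
move=> M0.
pose I : set (measurableTypeR R) := `]- M, M]%classic.
have mI : measurable I by exact: measurable_itv.
have MM : - M <= M by rewrite ge0_cp// ltW.
pose num : {measure set (measurableTypeR R) -> \bar R} := nu.
have Ifin : (num I < +oo)%E by rewrite [num I]nu_itv// ltry.
pose nuM : {finite_measure set (measurableTypeR R) -> \bar R} := mfrestr mI Ifin.
have dom : nuM `<< leb.
  apply/null_content_dominatesP => A mA A0.
  apply/eqP; rewrite eq_le measure_ge0 andbT.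
  have /null_content_dominatesP h := nu_dom.
  rewrite -(h A mA A0); apply: (@le_measure _ _ _ num); rewrite ?inE//; exact: measurableI.
have [g [g0 gfin gint gE]] := radon_nikodym_sigma_finite dom.
pose f := fine \o g.
have fE : EFin \o f = g by apply/funext => x; rewrite /f /= fineK.
have intf : leb.-integrable setT (EFin \o f) by rewrite fE.
have intfy y : leb.-integrable `]-oo, y] (EFin \o f) by exact: integrableS intf.
have locf : locally_integrable setT f.
  by apply: open_integrable_locally => //; exact: openT.
have := FTC1Ny intfy locf; set G := (fun x : R => _) => FTC.
have GE x y : - M <= x -> x <= y -> y <= M -> v y - v x = G y - G x.
  move=> Mx xy yM; apply: EFin_inj; rewrite -nu_itv//.
  pose J : set R := `]x, y]%classic.
  have -> : nu J = nuM J.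
    have JI : J `&` I = J.
      apply: setIidl => t; rewrite /J /I /= !in_itv/= => /andP[xt ty].
      by rewrite (le_lt_trans Mx xt) (le_trans ty yM).
    by rewrite -{1}JI.
  rewrite gE//; last exact: measurable_itv.
  rewrite /G Rintegral_itvB// ?bnd_simp// /Rintegral fineK.
    by rewrite -fE.
  by apply: integrable_fin_num => //; exact: integrableS intf.
apply: negligibleS FTC => x /= [/andP[Mx xM]]; apply: contra_not => -[dG _].
exists (G^`()%classic x - C); have hG := derivable_has_slope dG.
move=> e e0; have [d d0 Hd] := hG e e0.
exists (Num.min d (Num.min (M - x) (M + x))).
  by rewrite !lt_min d0 subr_gt0 xM -ltrBlDl sub0r.
move=> t; rewrite !lt_min => /and3P[td tM1 tM2].
have := Hd t td.
have -> : G (x + t) - G x = v (x + t) - v x.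
  have /andP[? ?] : - `|t| <= t <= `|t| by rewrite -ler_norml.
  have [t0|t0] := leP 0 t; first by rewrite GE//; lra.
  by apply: oppr_inj; rewrite !opprB GE//; lra.
by rewrite /v; congr (`| _ | <= _); ring.
Qed.

End Lipschitz1.

Lemma lipschitz_ae_slope (R : realType) (u : R -> R) (C : R) :
  (forall x y, `|u x - u y| <= C * `|x - y|) ->
  (@lebesgue_measure R).-negligible [set x | ~ exists m, has_slope u x m].
Proof.
move=> u_lip.
have C0 : 0 <= C by have := u_lip 1 0; rewrite subr0 normr1 mulr1; exact: le_trans.
have u_lip' x y : `|u x - u y| <= (C + 1) * `|x - y|.
  by apply: le_trans (u_lip x y) _; rewrite ler_wpM2r// lerDl.
have C1 : 0 < C + 1 by rewrite ltr_wpDl.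
have H : (@lebesgue_measure R).-negligible (\bigcup_n
    [set x : R | - n.+1%:R < x < n.+1%:R /\ ~ exists m, has_slope u x m]).
  by apply: negligible_bigcup => n; exact: (lipschitz_ae_slope_bounded C1 u_lip').
apply: negligibleS H => x xu; exists (Num.bound `|x : R|) => //; split => //.
by rewrite -ltr_norml (lt_le_trans (archi_boundP (normr_ge0 (x : R))))// ler_nat.
Qed.

(** * Sets whose sections along parallel lines are null *)

Section NullLines.
Context (R : realType) (k : nat).
Notation V := ('rV[R]_k).
Notation mu := (@lebesgue_outer R k).
Notation leb := (@lebesgue_measure R).
Implicit Types (A B C K U : set V) (x y : V).

Lemma upd_id x j : upd x j (x 0 j) = x.
Proof. by apply/rowP => i; rewrite mxE; case: eqP => [->|]. Qed.

Lemma upd_upd x j s t : upd (upd x j s) j t = upd x j t.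
Proof. by apply/rowP => i; rewrite !mxE; case: eqP. Qed.

Lemma upd_lip x j s t : `|upd x j s - upd x j t| <= `|s - t|.
Proof. by apply/norm_leP => // i; rewrite !mxE; case: eqP => // _; rewrite subrr normr0. Qed.

Lemma updl_lip x y j t : `|upd x j t - upd y j t| <= `|x - y|.
Proof.
apply/norm_leP => // i; rewrite !mxE; case: eqP => _; first by rewrite subrr normr0.
by have := norm_le_coord (x - y) i; rewrite !mxE.
Qed.

Lemma lip_continuous (T1 T2 : normedModType R) (f : T1 -> T2) (L : R) :
  (forall x y : T1, `|f x - f y| <= L * `|x - y|) -> continuous f.
Proof.
move=> Lf x; apply/cvgrPdist_le => e e0.
have L0 : 0 < `|L| + 1 by rewrite ltr_wpDl.
apply/nbhs_ballP; exists (e / (`|L| + 1)) => /=; first by rewrite divr_gt0.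
move=> y; rewrite -ball_normE /ball_ /= ltr_pdivlMr// mulrC => /ltW xy.
apply: le_trans (Lf x y) _; apply: le_trans xy; rewrite ler_wpM2r//.
by rewrite (le_trans (ler_norm L))// lerDl.
Qed.

Lemma upd_continuous x j : continuous (upd x j).
Proof. by apply: (@lip_continuous R V _ 1) => s t; rewrite mul1r upd_lip. Qed.

Lemma closed_section C x j : compact C -> closed [set t | C (upd x j t)].
Proof.
move=> cC; have -> : [set t | C (upd x j t)] = upd x j @^-1` C by [].
apply: preimage_closed; first by move=> t _; exact: upd_continuous.
by apply: compact_closed => //; exact: norm_hausdorff.
Qed.

(** A cover of W by intervals becomes a cover of the tube over W by boxes of width
    s in the directions other than j. *)
Lemma slab_outer (c : V) (j : 'I_k) (s e : R) (W : set R) : 0 <= s ->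
  (leb W < e%:E)%E ->
  (mu [set y : V | (forall i, i != j -> (`|y 0 i - c 0 i| <= s / 2)%R) /\ W (y 0%R j)] <=
   (s ^+ k.-1 * e)%:E)%E.
Proof.
move=> s0 /ereal_inf_lt[_ [F [mF WF] <-] Fe].
have H n : exists p : R * R, [/\ p.1 <= p.2, forall t : R, F n t -> p.1 <= t <= p.2 &
    wlength idfun (F n) = (p.2 - p.1)%:E].
  have [->|[[x y] /= xy ->]] := (ocitvP _).1 (mF n).
    by exists (0, 0); split=> //=; rewrite wlength0 subrr.
  exists (x, y) => /=; split; first exact: ltW.
    by move=> t; rewrite /= in_itv/= => /andP[/ltW -> ->].
  by rewrite wlength_itv_bnd// ltW.
have [p Hp] := choice H.
pose q n : V * V := (upd (c - const_mx (s / 2)) j (p n).1, upd (c + const_mx (s / 2)) j (p n).2).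
apply: (@le_trans _ _ (\sum_(n <oo) box_volume (q n))%E).
  apply: le_lebesgue_outer_cover => y [ys /WF[n _ yn]]; exists n => // i; rewrite /= !updE.
  case: eqP => [->|/eqP ij]; first by have [_ h _] := Hp n; exact: h.
  by have := ys i ij; rewrite !mxE ler_distl.
apply: (@le_trans _ _ (\sum_(n <oo) ((s ^+ k.-1)%:E * wlength idfun (F n)))%E).
  apply: lee_nneseries => [n _ _|n _]; first exact: box_volume_ge0.
  have [p12 _ ->] := Hp n; rewrite (box_volumeE _ j) /= !updE eqxx -EFinM lee_fin.
  rewrite max_r ?subr_ge0// mulrC ler_wpM2r ?subr_ge0//.
  rewrite (eq_bigr (fun=> s)) => [|i ij]; last first.
    rewrite !updE (negbTE ij) !mxE max_r; lra.
  by rewrite prodr_const cardC1 card_ord.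
rewrite nneseriesZl; last by move=> n _; exact: wlength_ge0.
by rewrite EFinM lee_wpmul2l// ?lee_fin ?exprn_ge0// ltW.
Qed.

Lemma cell_index (N : nat) (s t : R) : 0 <= t -> t <= N.+1%:R * s ->
  exists p : 'I_N.+1, p%:R * s <= t /\ t <= p%:R * s + s.
Proof.
elim: N => [|N IH] t0 tN; first by exists ord0; rewrite mul0r add0r; move: tN; rewrite mul1r.
have [h|h] := leP t (N.+1%:R * s).
  by have [p hp] := IH t0 h; exists (widen_ord (leqnSn _) p).
by exists ord_max; rewrite /= ltW//; split=> //; move: tN; rewrite -(natr1 N.+1) mulrDl mul1r.
Qed.

(** Compactness: the sections of C along lines close to the one through x stay in
    any open neighbourhood W of the section through x. *)
Lemma tube C x j (W : set R) : compact C -> open W ->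
  (forall t, C (upd x j t) -> W t) ->
  exists2 d : R, 0 < d & forall y, C y -> (forall i, i != j -> `|y 0 i - x 0 i| < d) -> W (y 0 j).
Proof.
move=> cC oW CW.
pose C' := C `&` [set z : V | ~ W (z 0 j)].
have cC' : compact C'.
  apply: (@subclosed_compact _ _ C) => //; last exact: subIsetl.
  apply: closedI; first by apply: compact_closed => //; exact: norm_hausdorff.
  have -> : [set z : V | ~ W (z 0 j)] = (fun z : V => z 0 j) @^-1` (~` W) by [].
  by apply: preimage_closed; [move=> z _; exact: coord_continuous|exact: open_closedC].
pose phi z := upd z j (x 0 j).
have cphi : compact (phi @` C').
  apply: continuous_compact => //; apply: continuous_subspaceT.
  by apply: (@lip_continuous V V _ 1) => z z'; rewrite mul1r updl_lip.
have nx : ~ (phi @` C') x.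
  move=> [z [Cz Wz] zx]; apply: Wz; apply: CW.
  by rewrite -zx /phi upd_upd upd_id.
have oD : open (~` (phi @` C')).
  by apply: closed_openC; apply: compact_closed => //; exact: norm_hausdorff.
have /nbhs_ballP[d /= d0 Hd] : nbhs x (~` (phi @` C')) by exact: open_nbhs_nbhs.
exists d => // y Cy yx; apply: contrapT => Wy.
apply: (Hd (phi y)); last by exists y.
rewrite -ball_normE /ball_ /= distrC; apply/norm_ltP => // i; rewrite !mxE.
by case: eqP => [->|/eqP ij]; [rewrite subrr normr0|exact: yx].
Qed.


(** The covering argument behind the theorem of Fubini.  Each line has a tube
    around it in which C stays over an open set of measure less than e'.  Finitely
    many tubes cover C; cut the k.-1 directions other than j into cells narrower
    than these tubes.  There are (2 M / s)^k.-1 cells, and C has measure at most s^k.-1 e' over each of them. *)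
Lemma null_lines_compact C j : compact C ->
  (forall x, leb [set t | C (upd x j t)] = 0%E) -> mu C = 0%E.
Proof.
move=> cC C0.
have [M M0 CM] : exists2 M : R, 0 < M & forall x, C x -> `|x| <= M.
  have [M [_ HM]] := compact_bounded cC; exists (`|M| + 1); first by rewrite ltr_wpDl.
  by move=> x Cx; apply: (HM (`|M| + 1)) => //; rewrite (le_lt_trans (ler_norm M))// ltrDl.
apply/eqP; rewrite eq_le lebesgue_outer_ge0 andbT; apply/lee_addgt0Pr => e e0; rewrite add0e.
pose e' := e / (2 * M) ^+ k.-1.
have M2 : 0 < (2 * M) ^+ k.-1 by rewrite exprn_gt0// mulr_gt0.
have e'0 : 0 < e' by rewrite divr_gt0.
have H x : exists p : set R * R, [/\ (leb p.1 < e'%:E)%E, 0 < p.2 & forall y, C y ->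
    (forall i, i != j -> `|y 0 i - x 0 i| < p.2) -> p.1 (y 0 j)].
  pose S : set R := [set t | C (upd x j t)].
  have cS : closed S.
    exact: closed_section.
  have mS : measurable S by exact: closed_measurable.
  have [|W [oW SW We]] := @lebesgue_regularity_outer R S e' mS _ e'0.
    by suff : (leb S < +oo)%E by []; rewrite [leb S]C0.
  have [d d0 Hd] := @tube C x j W cC oW SW.
  exists (W, d); split=> //=.
  apply: le_lt_trans We; apply: (@le_trans _ _ (leb (S `|` (W `\` S)))).
    apply: le_measure; rewrite ?inE; first exact: open_measurable.
      by apply: measurableU => //; apply: measurableD => //; exact: open_measurable.
    by move=> t Wt; case: (pselect (S t)); [left|right].
  have mWS : measurable (W `\` S) by apply: measurableD => //; exact: open_measurable.
  apply: (@le_trans _ _ (leb S + leb (W `\` S))%E); first exact: measureU2.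
  have -> : leb S = 0%E by exact: C0.
  by rewrite add0e.
have [p Hp] := choice H.
have : cover_compact C by rewrite -compact_cover.
move=> /(_ V C (fun x => ball x ((p x).2 / 2))) [x Cx|x Cx|F FC CF].
- exact: ball_open.
- by exists x => //; apply: ballxx; have [_ h _] := Hp x; rewrite divr_gt0.
(* A cell of width s < d that meets C stays in one of the finitely many
   tubes. *)
pose d := \big[Num.min/1]_(x <- finmap.enum_fset F) ((p x).2 / 2).
have d0 : 0 < d.
  apply: (big_ind (fun a : R => 0 < a)) => // [a b a0 b0|x _]; first by rewrite lt_min a0.
  by have [_ h _] := Hp x; rewrite divr_gt0.
have dF x : x \in finmap.enum_fset F -> d <= (p x).2 / 2.
  rewrite /d; elim: (finmap.enum_fset F) => // a l IH; rewrite inE big_cons ge_min.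
  by case: eqP => [<-|_ /= /IH ->]; rewrite ?lexx ?orbT.
have [N hN] := nat_above (2 * M / d).
pose s := 2 * M / N.+1%:R.
have s0 : 0 < s by rewrite divr_gt0// mulr_gt0.
have sd : s < d.
  rewrite /s ltr_pdivrMr// [d * _]mulrC -ltr_pdivrMr//; apply: (lt_trans hN).
  by rewrite ltr_nat.
(* The centre of the cell with indices f; insub i is None just for i = j. *)
pose c (f : {ffun {i : 'I_k | i != j} -> 'I_N.+1}) : V :=
  \row_i (if insub i is Some i' then - M + (f i')%:R * s + s / 2 else 0).
pose cell f := [set y : V | C y /\ forall i, i != j -> `|y 0 i - c f 0 i| <= s / 2].
have cell_small f : (mu (cell f) <= (s ^+ k.-1 * e')%:E)%E.
  have [[y0 [Cy0 y0f]]|h] := pselect (exists y, cell f y); last first.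
    rewrite (_ : cell f = set0); last by apply/seteqP; split=> // y fy; case: h; exists y.
    by rewrite lebesgue_outer0 lee_fin mulr_ge0 ?exprn_ge0// ltW.
  have [x xF y0x] := CF _ Cy0.
  have [We _ HW] := Hp x.
  apply: le_trans (slab_outer (c f) j (ltW s0) We).
  apply: le_lebesgue_outer => y [Cy yf]; split=> //; apply: HW => // i ij.
  have h1 := yf i ij; have h2 := y0f i ij.
  move: y0x; rewrite /= -ball_normE /ball_ /= => y0x.
  have := le_lt_trans (norm_le_coord (x - y0) i) y0x; rewrite !mxE => h3.
  have := dF x xF => h4; have := sd => h5.
  move: h1 h2 h3 h4 h5; rewrite !ler_distl !ltr_distl => /andP[? ?] /andP[? ?] /andP[? ?] ? ?.
  apply/andP; split; lra.
apply: (le_trans (@finite_cover_outer R k _ (enum {ffun {i : 'I_k | i != j} -> 'I_N.+1}) cell C _)).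
  move=> y Cy.
  have hi (i : {i : 'I_k | i != j}) : exists q : 'I_N.+1,
      q%:R * s <= y 0 (val i) + M /\ y 0 (val i) + M <= q%:R * s + s.
    have := le_trans (norm_le_coord y (val i)) (CM y Cy); rewrite ler_norml => /andP[? ?].
    by apply: cell_index; [lra|rewrite /s mulrC divfK//; lra].
  have [q Hq] := choice hi.
  exists [ffun i => q i]; first by rewrite mem_enum.
  split=> // i ij; rewrite /c mxE insubT ffunE.
  have [] := Hq (Sub i ij); rewrite /= => ? ?.
  by rewrite ler_distl; apply/andP; split; lra.
apply: (@le_trans _ _ (\sum_(f <- enum {ffun {i : 'I_k | i != j} -> 'I_N.+1}) (s ^+ k.-1 * e')%:E)%E).
  by apply: lee_sum => f _; exact: cell_small.
rewrite sumEFin lee_fin big_enum /= sumr_const card_ffun card_ord card_sig.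
rewrite (eq_card (B := predC1 j))// cardC1 card_ord.
rewrite -[leLHS]mulr_natl natrX mulrA -exprMn /s mulrC (mulrC N.+1%:R) divfK// /e'.
by rewrite divfK// gt_eqF.
Qed.

Lemma null_lines A j : (0 < k)%N -> lebesgue_measurable A ->
  (forall x, leb.-negligible [set t | A (upd x j t)]) -> mu A = 0%E.
Proof.
move=> k0 mA A0.
apply: (@null_subset _ _ _ (\bigcup_n (A `&` cube 0 n%:R))).
  by move=> x Ax; have [n xn] := in_large_cube x; exists n.
apply: null_bigcup => n.
have mAn : lebesgue_measurable (A `&` cube 0 n%:R) by apply: measurableI => //; exact: measurable_box.
apply/eqP; rewrite eq_le lebesgue_outer_ge0 andbT; apply/lee_addgt0Pr => e e0; rewrite add0e.
have [||C [cC CA Ce]] := @inner_regular R k (A `&` cube 0 n%:R) 0 n%:R e k0 _ mAn _ e0 => //.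
apply: (@le_trans _ _ (mu C + mu ((A `&` cube 0 n%:R) `\` C))%E).
  apply: le_trans (outer_measureU2 (lebesgue_outer_measure R k) _ _).
  by apply: le_lebesgue_outer => x Ax; case: (pselect (C x)); [left|right].
rewrite (@null_lines_compact C j cC) ?add0e ?ltW// => x.
have cS : closed [set t | C (upd x j t)].
  exact: closed_section.
apply: measure_negligible; first exact: closed_measurable.
by apply: negligibleS (A0 x) => t /= /CA[].
Qed.

End NullLines.

(** * Affine approximation of Lipschitz functions *)

Section Gradient.
Context (R : realType) (k : nat).
Notation V := ('rV[R]_k).
Implicit Types (a w p x y : V) (u : V -> R).

Definition dot a w := \sum_j a 0 j * w 0 j.
Definition basis (j : 'I_k) : V := delta_mx 0 j.

Lemma dotDr a w y : dot a (w + y) = dot a w + dot a y.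
Proof. by rewrite /dot -big_split; apply: eq_bigr => j _; rewrite mxE mulrDr. Qed.

Lemma dotDl a w y : dot (w + y) a = dot w a + dot y a.
Proof. by rewrite /dot -big_split; apply: eq_bigr => j _; rewrite mxE mulrDl. Qed.

Lemma dotZr a t w : dot a (t *: w) = t * dot a w.
Proof. by rewrite /dot mulr_sumr; apply: eq_bigr => j _; rewrite mxE mulrCA. Qed.

Lemma dot0r a : dot a 0 = 0.
Proof. by rewrite -(scale0r 0) dotZr mul0r. Qed.

Lemma dotNl a w : dot (- a) w = - dot a w.
Proof. by rewrite /dot -sumrN; apply: eq_bigr => j _; rewrite mxE mulNr. Qed.

Lemma dot_basis a j : dot a (basis j) = a 0 j.
Proof.
rewrite /dot (bigD1 j)//= !mxE !eqxx mulr1 big1 ?addr0// => i ij.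
by rewrite !mxE (negbTE ij) mulr0.
Qed.

Lemma norm_dot_le a w : `|dot a w| <= k%:R * `|a| * `|w|.
Proof.
apply: le_trans (ler_norm_sum _ _ _) _.
apply: (@le_trans _ _ (\sum_(j < k) `|a| * `|w|)); last first.
  by rewrite sumr_const card_ord -[leLHS]mulr_natl mulrA.
by apply: ler_sum => j _; rewrite normrM ler_pM// norm_le_coord.
Qed.

Lemma norm_basis j : `|basis j| <= 1.
Proof. by apply/norm_leP => // i; rewrite mxE; case: eqP => _; case: eqP => _ /=; rewrite ?normr1 ?normr0. Qed.

Lemma norm_shift t j : `|t *: basis j| <= `|t|.
Proof. by rewrite normrZ ler_piMr// norm_basis. Qed.

Lemma upd_shift x j s t : upd x j s + t *: basis j = upd x j (s + t).
Proof. by apply/rowP => i; rewrite !mxE /=; case: eqP => _; rewrite ?mulr1// mulr0 addr0. Qed.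

(** Go from x to x + w by changing one coordinate after the other. *)
Lemma coord_walk u a x w c :
  (forall p j t, `|p - x| <= `|w| -> `|t| <= `|w| ->
     `|u (p + t *: basis j) - u p - t * a 0 j| <= c) ->
  `|u (x + w) - u x - dot a w| <= k%:R * c.
Proof.
move=> H; pose tr i := \row_j (if (j < i)%N then w 0 j else 0) : V.
suff : forall i, (i <= k)%N -> `|u (x + tr i) - u x - dot a (tr i)| <= i%:R * c.
  by move=> /(_ k (leqnn k)); rewrite (_ : tr k = w)//; apply/rowP => j; rewrite mxE ltn_ord.
elim=> [_|i IH ik].
  rewrite (_ : tr 0%N = 0); last by apply/rowP => j; rewrite !mxE.
  by rewrite addr0 subrr dot0r subr0 normr0 mul0r.
have -> : tr i.+1 = tr i + w 0 (Ordinal ik) *: basis (Ordinal ik).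
  apply/rowP => j; rewrite !mxE /= ltnS leq_eqVlt.
  have [ji|ji] := eqVneq (j : nat) i.
    have -> : j = Ordinal ik by exact: val_inj.
    by rewrite eqxx /= ltnn mulr1 add0r.
  by have -> : (j == Ordinal ik) = false; [apply/eqP => h; move: ji; rewrite h eqxx|rewrite mulr0 addr0].
have := IH (ltnW ik).
have := H (x + tr i) (Ordinal ik) (w 0 (Ordinal ik)).
rewrite addrAC subrr add0r => /(_ _ (norm_le_coord _ _)) => h1 h2.
have := h1 _; rewrite addrA dotDr dotZr dot_basis -natr1 mulrDl mul1r.
move=> /(_ _) h3; have {}h3 := h3 _; apply: le_trans (lerD h2 (h3 _)); last first.
  apply/norm_leP => // j; rewrite mxE; case: ifP => _; rewrite ?normr0//.
  exact: norm_le_coord.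
by apply: le_trans (ler_normD _ _); rewrite le_eqVlt; apply/orP; left; apply/eqP; congr `|_|; ring.
Qed.

End Gradient.

Section Rademacher.
Context (R : realType) (k : nat).
Notation V := ('rV[R]_k).
Notation mu := (@lebesgue_outer R k).
Implicit Types (a w p x y : V) (u : V -> R).

(** The points where u is affine with slope a, up to e times the distance, at all
    scales below h. *)
Definition affine_approx u (e h : R) a :=
  [set x | forall w, `|w| <= h -> `|u (x + w) - u x - dot a w| <= e * `|w|].

Definition line_approx u (e h : R) j (b : R) :=
  [set x | forall t, `|t| <= h -> `|u (x + t *: basis R j) - u x - t * b| <= e * `|t|].

Lemma closed_increment u (L b c : R) w : (forall x y, `|u x - u y| <= L * `|x - y|) ->
  closed [set x | `|u (x + w) - u x - b| <= c].
Proof.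
move=> uL.
have -> : [set x | `|u (x + w) - u x - b| <= c] =
    (fun x => `|u (x + w) - u x - b|) @^-1` [set t : R | t <= c] by [].
apply: preimage_closed; last exact: closed_le.
move=> x _; apply: (@lip_continuous R V R _ (2 * L)) => {}x y.
apply: (le_trans (ler_dist_dist _ _)).
have h1 := uL (x + w) (y + w); have h2 := uL x y.
rewrite (_ : x + w - (y + w) = x - y) in h1; last by rewrite opprD addrACA subrr addr0.
rewrite (_ : _ - _ = u (x + w) - u (y + w) - (u x - u y)); last by ring.
apply: (le_trans (ler_normB _ _)); lra.
Qed.

Lemma closed_affine_approx u (L e h : R) a : (forall x y, `|u x - u y| <= L * `|x - y|) ->
  closed (affine_approx u e h a).
Proof.
move=> uL.
have -> : affine_approx u e h a = \bigcap_(w in [set w : V | `|w| <= h])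
    [set x | `|u (x + w) - u x - dot a w| <= e * `|w|] by [].
by apply: closed_bigI => w _; exact: closed_increment uL.
Qed.

Lemma closed_line_approx u (L e h : R) j b : (forall x y, `|u x - u y| <= L * `|x - y|) ->
  closed (line_approx u e h j b).
Proof.
move=> uL.
have -> : line_approx u e h j b = \bigcap_(t in [set t : R | `|t| <= h])
    [set x | `|u (x + t *: basis R j) - u x - t * b| <= e * `|t|] by [].
by apply: closed_bigI => w _; exact: closed_increment uL.
Qed.

Lemma line_approxS u (e h h' : R) j b : h' <= h -> line_approx u e h j b `<=` line_approx u e h' j b.
Proof. by move=> hh x H t th; apply: H; exact: le_trans hh. Qed.

Lemma affine_approxS u (e h h' : R) a : h' <= h -> affine_approx u e h a `<=` affine_approx u e h' a.
Proof. by move=> hh x H t th; apply: H; exact: le_trans hh. Qed.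

Lemma null_countable_bigcup (T : countType) (F : T -> set V) :
  (forall i, mu (F i) = 0%E) -> mu (\bigcup_i F i) = 0%E.
Proof.
move=> F0; apply: (@null_subset _ _ _ (\bigcup_n (if unpickle n is Some i then F i else set0))).
  by move=> x [i _ Fx]; exists (pickle i) => //; rewrite pickleK.
by apply: null_bigcup => n; case: unpickle => [i|]; [exact: F0|exact: lebesgue_outer0].
Qed.

Lemma near_rat (b e : R) : 0 < e -> exists q : rat, `|ratr q - b| < e.
Proof.
move=> e0; have [|q] := @rat_in_itvoo R (b - e) (b + e); first lra.
by rewrite in_itv/= => bq; exists q; rewrite ltr_distl.
Qed.

(** For the line through a point in direction j, [lipschitz_ae_slope] provides a
    slope at almost every point, which is replaced with a rational number close
    to it; [null_lines] puts the lines together. *)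
Lemma line_approx_ae u (L e : R) j : (0 < k)%N -> (forall x y, `|u x - u y| <= L * `|x - y|) ->
  0 < e -> mu (~` \bigcup_(p : rat * nat) line_approx u e p.2.+1%:R^-1 j (ratr p.1)) = 0%E.
Proof.
move=> k0 uL e0; apply: (@null_lines _ _ _ j k0).
  apply: measurableC; apply: countable_bigcupT_measurable; first exact: countableP.
  by move=> p; apply: closed_lebesgue_measurable; exact: closed_line_approx uL.
move=> x; pose phi t := u (upd x j t).
have philip s t : `|phi s - phi t| <= `|L| * `|s - t|.
  apply: le_trans (uL _ _) _; apply: (@le_trans _ _ (`|L| * `|upd x j s - upd x j t|)).
    by rewrite ler_wpM2r// ler_norm.
  by rewrite ler_wpM2l// upd_lip.
apply: negligibleS (lipschitz_ae_slope philip) => s /= hs [m hm]; apply: hs.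
have e2 : 0 < e / 2 by rewrite divr_gt0.
have [d d0 Hd] := hm _ e2.
have [q qm] := near_rat m e2; have [n nd] := small_inv d0.
exists (q, n) => // t /= tn; rewrite upd_shift.
have := Hd t (le_lt_trans tn nd); rewrite /phi => h1.
have h2 : `|t * (m - ratr q)| <= e / 2 * `|t|.
  by rewrite normrM mulrC ler_wpM2r// distrC ltW.
rewrite (_ : _ - _ = u (upd x j (s + t)) - u (upd x j s) - t * m + t * (m - ratr q)); last by ring.
apply: (le_trans (ler_normD _ _)); lra.
Qed.

(** In the walk from x to x + w the intermediate points need not lie in the
    dense set; they are replaced with points of it at distance
    e / (2 L) times the length of w, at a cost of e for the Lipschitz function. *)
Lemma dense_line_approx u (L e h : R) a x : (0 < k)%N -> 0 < L ->
  (forall x y, `|u x - u y| <= L * `|x - y|) -> 0 < e -> 0 < h ->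
  dense_at [set y | forall j, line_approx u e h j (a 0 j) y] x ->
  exists2 h', 0 < h' & affine_approx u (k%:R * (2 * e)) h' a x.
Proof.
move=> k0 L0 uL e0 h0 dx.
have eL : 0 < e / (2 * L) by rewrite divr_gt0// mulr_gt0.
have [r0 r00 Hr] := dense_at_meets k0 dx eL.
exists (Num.min h r0 / 2); first by rewrite divr_gt0// lt_min h0.
move=> w; rewrite ler_pdivlMr//; rewrite le_min => /andP[wh wr].
have [->|w0] := eqVneq w 0; first by rewrite addr0 subrr dot0r subr0 !normr0 mulr0.
have wp : 0 < `|w| by rewrite normr_gt0.
rewrite -mulrA; apply: coord_walk => p j t px tw.
have [|q Kq] := Hr `|w| wp _ (p - x) px; first lra.
rewrite [x + (p - x)]addrC subrK => qp.
have := Kq j t; rewrite (le_trans tw) => [/(_ isT) h1|]; last lra.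
have h2 := uL (p + t *: basis R j) (q + t *: basis R j); have h3 := uL p q.
rewrite (_ : _ + _ - _ = p - q) in h2; last by rewrite opprD addrACA subrr addr0.
have h4 : L * `|p - q| <= e / 2 * `|w|.
  rewrite distrC; apply: (le_trans (ler_wpM2l (ltW L0) qp)).
  by rewrite le_eqVlt; apply/orP; left; apply/eqP; field; rewrite gt_eqF.
have h5 : e * `|t| <= e * `|w| by rewrite ler_wpM2l// ltW.
rewrite (_ : _ - _ = (u (q + t *: basis R j) - u q - t * a 0 j) +
  (u (p + t *: basis R j) - u (q + t *: basis R j)) - (u p - u q)); last by ring.
apply: (le_trans (ler_normB _ _)); move: (ler_normD (u (q + t *: basis R j) - u q - t * a 0 j) (u (p + t *: basis R j) - u (q + t *: basis R j))).
lra.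
Qed.

(** Slopes with rational coordinates keep the union countable, hence
    measurable. *)
Definition approx_set u (e : R) n :=
  \bigcup_(q : 'rV[rat]_k) affine_approx u e n.+1%:R^-1 (map_mx (@ratr R) q).

Lemma measurable_approx_set u (L e : R) n : (forall x y, `|u x - u y| <= L * `|x - y|) ->
  lebesgue_measurable (approx_set u e n).
Proof.
move=> uL; apply: countable_bigcupT_measurable; first exact: countableP.
by move=> p; apply: closed_lebesgue_measurable; exact: closed_affine_approx uL.
Qed.

Lemma approx_setS u (e : R) : nondecreasing_seq (approx_set u e).
Proof.
move=> m n mn; apply/subsetPset => x [q _ xq]; exists q => //.
by apply: affine_approxS xq; rewrite lef_pV2 ?posrE// ler_nat.
Qed.

(** Almost every point is a density point of the set where, for suitable rational
    a and scale, all the partial increments are linear with slope a up to e'. *)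
Lemma approx_set_ae u (L e : R) : (0 < k)%N -> 0 < L -> (forall x y, `|u x - u y| <= L * `|x - y|) ->
  0 < e -> mu (~` \bigcup_n approx_set u e n) = 0%E.
Proof.
move=> k0 L0 uL e0.
pose e' := e / (k%:R * 2).
have k0' : (0 : R) < k%:R by rewrite ltr0n.
have e'0 : 0 < e' by rewrite divr_gt0// mulr_gt0.
pose B (p : 'rV[rat]_k * nat) := [set y | forall j, line_approx u e' p.2.+1%:R^-1 j (ratr (p.1 0 j)) y].
have mB (p : 'rV[rat]_k * nat) : lebesgue_measurable (B p).
  apply: closed_lebesgue_measurable.
  have -> : B p = \bigcap_(j in setT) line_approx u e' p.2.+1%:R^-1 j (ratr (p.1 0 j)).
    by apply/seteqP; split=> [y By j _|y By j]; exact: By.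
  by apply: closed_bigI => j _; exact: closed_line_approx uL.
pose N1 := \bigcup_j (~` \bigcup_(p : rat * nat) line_approx u e' p.2.+1%:R^-1 j (ratr p.1)).
pose N2 := \bigcup_p [set x | B p x /\ ~ dense_at (B p) x].
apply: (@null_subset _ _ _ (N1 `|` N2)); last first.
  apply: null_setU; apply: null_countable_bigcup.
    by move=> j; exact: line_approx_ae uL _.
  by move=> p; exact: dense_at_ae.
move=> x Hx; apply: contrapT => /not_orP[n1 n2]; apply: Hx.
have H j : exists p : rat * nat, line_approx u e' p.2.+1%:R^-1 j (ratr p.1) x.
  apply: contrapT => h; apply: n1; exists j => // -[p _ hp]; apply: h; by exists p.
have [p Hp] := choice H.
pose n := (\max_j (p j).2)%N.
pose q : 'rV[rat]_k := \row_j (p j).1.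
have Bx : B (q, n) x.
  move=> j /=; rewrite mxE; apply: line_approxS (Hp j).
  by rewrite lef_pV2 ?posrE// ler_nat ltnS; exact: (@leq_bigmax _ (fun j => (p j).2)).
have dx : dense_at (B (q, n)) x.
  by apply: contrapT => h; apply: n2; exists (q, n).
have [||h' h'0] := @dense_line_approx u L e' n.+1%:R^-1 (map_mx (@ratr R) q) x k0 L0 uL e'0.
- by rewrite invr_gt0.
- by apply: dense_atS dx => y By j; rewrite mxE; exact: By.
rewrite (_ : k%:R * (2 * e') = e) => [Hx|]; last by rewrite /e'; field; rewrite gt_eqF.
have [m mh] := small_inv h'0.
by exists m => //; exists q => //; apply: affine_approxS Hx; exact: ltW.
Qed.

Lemma approx_set_large u (L e M d : R) : (0 < k)%N -> 0 < L -> 0 <= M ->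
  (forall x y, `|u x - u y| <= L * `|x - y|) -> 0 < e -> 0 < d ->
  exists n, (mu (cube 0 M `\` approx_set u e n) < d%:E)%E.
Proof.
move=> k0 L0 M0 uL e0 d0.
pose F n := cube 0 M `\` approx_set u e n.
have mF n : lebesgue_measurable (F n).
  by apply: measurableD; [exact: measurable_box|exact: measurable_approx_set uL].
have mI : lebesgue_measurable (\bigcap_n F n) by apply: bigcapT_measurable.
have I0 : mu (\bigcap_n F n) = 0%E.
  apply: null_subset (approx_set_ae k0 L0 uL e0) => x Fx [n _ xn].
  by have [_] := Fx n I; apply.
have : (lebesgue_rV R k \o F) n @[n --> \oo] --> lebesgue_rV R k (\bigcap_n F n).
  apply: nonincreasing_cvg_mu => //.
    apply: (@le_lt_trans _ _ (mu (cube 0 M))).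
      by apply: le_lebesgue_outer; exact: subIsetl.
    by rewrite lebesgue_outer_cube// ltry.
  move=> m n mn; apply/subsetPset; apply: setDS; apply/subsetPset; exact: approx_setS.
rewrite [X in _ --> X]I0 => /(_ [set t | (t < d%:E)%E]) [].
  by apply: open_nbhs_nbhs; split; [exact: open_ereal_lt_ereal|rewrite /= lte_fin].
by move=> n _ /(_ n (leqnn n)) Hn; exists n.
Qed.

End Rademacher.

(** * Smoothing by symmetric averages *)

Section Primitive.
Context (R : realType).
Notation leb := (@lebesgue_measure R).
Implicit Types (a b c h s t x y : R) (f F G : R -> R).

Lemma has_slope_comb F G s c m l : has_slope F s m -> has_slope G s l ->
  has_slope (fun x => F x + c * G x) s (m + c * l).
Proof.
move=> HF HG e e0.
have c1 : 0 < 2 * (`|c| + 1) by rewrite mulr_gt0// ltr_wpDl.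
have e2 : 0 < e / 2 by rewrite divr_gt0.
have ec : 0 < e / (2 * (`|c| + 1)) by rewrite divr_gt0.
have [d d0 Hd] := HF _ e2; have [d' d'0 Hd'] := HG _ ec.
exists (Num.min d d'); first by rewrite lt_min d0.
move=> t; rewrite lt_min => /andP[/Hd h1 /Hd' h2].
rewrite (_ : _ - _ = (F (s + t) - F s - t * m) + c * (G (s + t) - G s - t * l)); last by ring.
apply: (le_trans (ler_normD _ _)); rewrite normrM.
have h3 : `|c| * `|G (s + t) - G s - t * l| <= `|c| * (e / (2 * (`|c| + 1)) * `|t|) by rewrite ler_wpM2l.
have h4 : `|c| * (e / (2 * (`|c| + 1)) * `|t|) <= e / 2 * `|t|.
  have c1' : 0 < `|c| + 1 by rewrite ltr_wpDl.
  rewrite (_ : `|c| * _ = `|c| / (`|c| + 1) * (e / 2 * `|t|)); last by field; rewrite gt_eqF.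
  have et0 : 0 <= e / 2 * `|t| by rewrite mulr_ge0// ltW.
  by rewrite ler_piMl// ler_pdivrMr// mul1r lerDl.
lra.
Qed.

Lemma has_slope_near F G s m d : 0 < d -> (forall t, `|t| < d -> F (s + t) = G (s + t)) ->
  has_slope F s m -> has_slope G s m.
Proof.
move=> d0 FG HF e e0; have [d' d'0 Hd'] := HF e e0.
exists (Num.min d d'); first by rewrite lt_min d0.
move=> t; rewrite lt_min => /andP[td /Hd']; rewrite FG//.
by have := FG 0; rewrite normr0 addr0 => ->.
Qed.

Lemma has_slope_shift F s c m : has_slope F (s + c) m -> has_slope (fun x => F (x + c)) s m.
Proof. by move=> HF e /HF[d d0 Hd]; exists d => // t /Hd; rewrite (addrAC s c t). Qed.

Lemma has_slope_quadratic b c s : has_slope (fun x => b * x + c * x ^+ 2 / 2) s (b + c * s).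
Proof.
move=> e e0; exists (e / (`|c| + 1)); first by rewrite divr_gt0// ltr_wpDl.
have c1 : 0 < `|c| + 1 by rewrite ltr_wpDl.
move=> t; rewrite ltr_pdivlMr// => te.
rewrite (_ : _ - _ = c * t / 2 * t); last by field.
rewrite normrM ler_wpM2r//.
rewrite normrM [`|2^-1|]ger0_norm; last by rewrite invr_ge0.
rewrite ler_pdivrMr// normrM; have := normr_ge0 t; have := normr_ge0 c; nra.
Qed.

Lemma le_increment F a b (m : R) : a <= b -> (forall s, a <= s <= b -> slope_le F s m) ->
  F b - F a <= m * (b - a).
Proof.
move=> ab H; apply/ler_addgt0Pr => e e0.
have ba1 : 0 < b - a + 1 by lra.
pose e' := e / (b - a + 1).
have e'0 : 0 < e' by rewrite divr_gt0.
suff : F b - F a <= (m + e') * (b - a).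
  move=> /le_trans; apply; rewrite mulrDl lerD2l /e' mulrAC ler_pdivrMr//.
  by rewrite ler_wpM2l ?ltW// ltrDl.
apply: (@real_induction R a b (fun x => F x - F a <= (m + e') * (x - a))) => //.
  by rewrite !subrr mulr0.
move=> c acb; have [d d0 Hd] := H c acb _ e'0.
exists d => // x y ax xc cy yb dx yd Hx.
have := Hd x y dx xc cy yd; lra.
Qed.

Lemma has_slopeN F s m : has_slope F s m -> has_slope (fun x => - F x) s (- m).
Proof.
move=> HF e /HF[d d0 Hd]; exists d => // t /Hd; rewrite -normrN.
by congr (_ <= _); congr `|_|; ring.
Qed.


Lemma mean_value_le F a b (B : R) : a <= b ->
  (forall s, a <= s <= b -> exists2 m, has_slope F s m & `|m| <= B) ->
  `|F b - F a| <= B * (b - a).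
Proof.
move=> ab H; rewrite ler_norml; apply/andP; split.
  rewrite lerNl; apply: le_trans (_ : - F b - - F a <= _); first by rewrite opprB addrC opprK.
  apply: (@le_increment (fun x => - F x)) => // s /H[m /has_slopeN/has_slope_le Fm].
  by rewrite ler_norml => /andP[? ?]; apply: slope_leW Fm; rewrite lerNl.
apply: le_increment => // s /H[m /has_slope_le Fm].
by rewrite ler_norml => /andP[? ?]; apply: slope_leW Fm.
Qed.

Lemma mean_value_eq F G a b : a <= b ->
  (forall s, a <= s <= b -> exists2 m, has_slope F s m & has_slope G s m) ->
  F b - F a = G b - G a.
Proof.
move=> ab H; apply/eqP; rewrite -subr_eq0 -normr_le0.
have := @mean_value_le (fun x => F x + (-1) * G x) a b 0 ab.
rewrite mul0r; rewrite (_ : _ - _ = F b + -1 * G b - (F a + -1 * G a)); last by ring.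
apply=> s /H[m mF mG]; exists (m + (-1) * m); first exact: has_slope_comb.
by rewrite mulN1r subrr normr0.
Qed.

(** The integral from a, where the fundamental theorem of calculus holds to the
    right of a. *)
Lemma local_primitive f a : continuous f ->
  exists F, forall x, a < x -> has_slope F x (f x).
Proof.
move=> cf; exists (fun x => \int[leb]_(t in `[a, x]) f t) => x ax.
have xx : x < x + 1 by rewrite ltrDl.
have intf : leb.-integrable `[a, x + 1] (EFin \o f).
  apply: continuous_compact_integrable; first exact: segment_compact.
  exact: continuous_subspaceT.
have [dF <-] := continuous_FTC1_closed xx intf ax (cf x).
exact: derivable_has_slope.
Qed.

(** The integrals from - n.+1, normalised at 0, agree where they are defined. *)
Lemma ex_primitive f : continuous f -> exists F, forall x, has_slope F x (f x).
Proof.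
move=> cf.
have [F HF] := choice (fun n : nat => local_primitive (- n.+1%:R) cf).
have agree (m n : nat) s : - m.+1%:R < s -> - n.+1%:R < s ->
    F m s - F m 0 = F n s - F n 0.
  move=> ms ns.
  have m0 : - m.+1%:R < 0 :> R by rewrite oppr_lt0 ltr0n.
  have n0 : - n.+1%:R < 0 :> R by rewrite oppr_lt0 ltr0n.
  have [s0|s0] := leP 0 s.
    apply: mean_value_eq => // t /andP[t0 _]; exists (f t); apply: HF; exact: lt_le_trans t0.
  apply: oppr_inj; rewrite !opprB.
  apply: mean_value_eq => [|t /andP[t0 _]]; first exact: ltW.
  by exists (f t); apply: HF; exact: lt_le_trans t0.
have [N HN] := choice (fun x : R => nat_above `|x|).
have NN x : - (N x).+1%:R < x.
  have := HN x; rewrite ltr_norml => /andP[h _]; apply: le_lt_trans h.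
  by rewrite lerN2 ler_nat.
exists (fun x => F (N x) x - F (N x) 0) => x.
have d0 : 0 < x + (N x).+1%:R by rewrite -ltrBlDr sub0r.
apply: (@has_slope_near (fun y => F (N x) y + (-1) * F (N x) 0) _ _ _ _ d0).
  move=> t; rewrite ltr_norml opprD => /andP[h _].
  rewrite mulN1r; apply: agree => //; lra.
have slope0 : has_slope (fun=> F (N x) 0) x 0.
  by move=> e e0; exists 1 => // t _; rewrite subrr mulr0 subr0 normr0 mulr_ge0// ltW.
have := has_slope_comb (-1) (HF (N x) x (NN x)) slope0.
by rewrite mulr0 addr0.
Qed.

Definition primitive f := xget (fun=> 0) [set F | forall x, has_slope F x (f x)].

Lemma primitiveP f x : continuous f -> has_slope (primitive f) x (f x).
Proof. by move=> /ex_primitive cf; exact: (xgetPex (fun=> 0) cf). Qed.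

(** The average of f over [-h, h]. *)
Definition mean h f := (primitive f h - primitive f (- h)) / (2 * h).

Lemma mean_comb h f1 f2 f3 c B : 0 < h -> continuous f1 -> continuous f2 -> continuous f3 ->
  (forall s, `|s| <= h -> `|f1 s - f2 s - c * f3 s| <= B) ->
  `|mean h f1 - mean h f2 - c * mean h f3| <= B.
Proof.
move=> h0 c1 c2 c3 H.
pose F x := (primitive f1 x + (-1) * primitive f2 x) + (- c) * primitive f3 x.
have := @mean_value_le F (- h) h B; rewrite opprK.
have h2 : 0 < 2 * h by rewrite mulr_gt0.
rewrite (_ : h + h = 2 * h); last by ring.
rewrite -ler_pdivrMr// -[X in _ / X](gtr0_norm h2) -normf_div => Hm.
rewrite (_ : _ - _ = (F h - F (- h)) / (2 * h)); last by rewrite /F /mean; field; rewrite gt_eqF.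
apply: Hm; first lra.
move=> s; rewrite -ler_norml => /H sB; exists ((f1 s + (-1) * f2 s) + (- c) * f3 s).
  by apply: has_slope_comb; [apply: has_slope_comb|]; exact: primitiveP.
by rewrite mulN1r mulNr.
Qed.

(** The symmetric average does not see the linear part. *)
Lemma mean_affine h f b c B : 0 < h -> continuous f ->
  (forall s, `|s| <= h -> `|f s - (b + s * c)| <= B) -> `|mean h f - b| <= B.
Proof.
move=> h0 cf H.
pose F x := primitive f x + (-1) * (b * x + c * x ^+ 2 / 2).
have := @mean_value_le F (- h) h B; rewrite opprK.
have h2 : 0 < 2 * h by rewrite mulr_gt0.
rewrite (_ : h + h = 2 * h); last by ring.
rewrite -ler_pdivrMr// -[X in _ / X](gtr0_norm h2) -normf_div => Hm.
rewrite (_ : _ - _ = (F h - F (- h)) / (2 * h)); last by rewrite /F /mean; field; rewrite gt_eqF.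
apply: Hm; first lra.
move=> s; rewrite -ler_norml => /H sB; exists (f s + (-1) * (b + c * s)).
  by apply: has_slope_comb; [exact: primitiveP|exact: has_slope_quadratic].
by rewrite mulN1r (mulrC c).
Qed.

(** The average is differentiable under translations, and its derivative is the
    symmetric difference quotient. *)
Lemma mean_shift h f L t : 0 < h -> 0 <= L -> (forall x y, `|f x - f y| <= L * `|x - y|) ->
  `|mean h (fun s => f (s + t)) - mean h f - t * ((f h - f (- h)) / (2 * h))| <= L / h * t ^+ 2.
Proof.
move=> h0 L0 fL.
have cf : continuous f by exact: (@lip_continuous R R R _ L).
have cft : continuous (fun s => f (s + t)).
  apply: (@lip_continuous R R R _ L) => x y; apply: le_trans (fL _ _) _.
  by rewrite opprD addrACA subrr addr0.
pose P := primitive f.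
have E : primitive (fun s => f (s + t)) h - primitive (fun s => f (s + t)) (- h) =
    P (h + t) - P (- h + t).
  apply: (@mean_value_eq _ (fun s => P (s + t))); first lra.
  move=> s _; exists (f (s + t)); first exact: (primitiveP s cft).
  by apply: has_slope_shift; exact: primitiveP.
have D c : `|P (c + t) - P c - t * f c| <= L * t ^+ 2.
  pose F s := P s + (- f c) * (1 * s + 0 * s ^+ 2 / 2).
  have FS s : has_slope F s (f s + (- f c) * (1 + 0 * s)).
    by apply: has_slope_comb; [exact: primitiveP|exact: has_slope_quadratic].
  have E1 : F (c + t) - F c = P (c + t) - P c - t * f c by rewrite /F; field.
  have FB s : `|s - c| <= `|t| -> exists2 m, has_slope F s m & `|m| <= L * `|t|.
    move=> st; exists (f s + (- f c) * (1 + 0 * s)) => //.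
    by rewrite mul0r addr0 mulr1; apply: le_trans (fL _ _) _; rewrite ler_wpM2l.
  rewrite -E1; have [t0|t0] := leP 0 t.
    apply: le_trans (mean_value_le (B := L * `|t|) _ _) _; first lra.
      by move=> s /andP[? ?]; apply: FB; rewrite (ger0_norm t0) ger0_norm; lra.
    by rewrite ger0_norm// addrAC subrr add0r expr2 mulrA.
  rewrite distrC; apply: le_trans (mean_value_le (B := L * `|t|) _ _) _; first lra.
    by move=> s /andP[? ?]; apply: FB; rewrite (ltr0_norm t0) ler0_norm; lra.
  by rewrite ltr0_norm// opprD addrA subrr add0r -mulrA mulrNN.
rewrite /mean E -/P.
have h2 : 0 < 2 * h by rewrite mulr_gt0.
have := D h; have := D (- h); set a1 := `|_|; set a2 := `|_| => h3 h4.
rewrite (_ : _ - _ = ((P (h + t) - P h - t * f h) - (P (- h + t) - P (- h) - t * f (- h))) / (2 * h)).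
  rewrite normf_div (gtr0_norm h2) ler_pdivrMr//.
  apply: (le_trans (ler_normB _ _)); rewrite -/a1 -/a2.
  rewrite (_ : L / h * t ^+ 2 * (2 * h) = 2 * (L * t ^+ 2)); first lra.
  by field; rewrite gt_eqF.
by field; rewrite gt_eqF.
Qed.

End Primitive.

Section Smoothing.
Context (R : realType) (k : nat).
Notation V := ('rV[R]_k).
Implicit Types (p x y : V) (u v : V -> R) (s : seq 'I_k).

Notation lipschitz_fun L u := (forall x y, `|u x - u y| <= L * `|x - y|).

Definition line_mean h j u x := mean h (fun t => u (x + t *: basis R j)).

Lemma line_lip u L x j : 0 <= L -> lipschitz_fun L u ->
  forall s t : R, `|u (x + s *: basis R j) - u (x + t *: basis R j)| <= L * `|s - t|.
Proof.
move=> L0 uL s t; apply: le_trans (uL _ _) _; rewrite ler_wpM2l//.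
by rewrite opprD addrACA subrr add0r -scalerBl norm_shift.
Qed.

Lemma line_continuous u L x j : 0 <= L -> lipschitz_fun L u ->
  continuous (fun t : R => u (x + t *: basis R j)).
Proof. by move=> L0 uL; apply: (@lip_continuous R R R _ L); exact: line_lip. Qed.

Lemma line_mean_comb h j u1 u2 u3 L x1 x2 x3 (c B : R) : 0 < h -> 0 <= L ->
  lipschitz_fun L u1 -> lipschitz_fun L u2 -> lipschitz_fun L u3 ->
  (forall t : R, `|t| <= h -> `|u1 (x1 + t *: basis R j) - u2 (x2 + t *: basis R j)
     - c * u3 (x3 + t *: basis R j)| <= B) ->
  `|line_mean h j u1 x1 - line_mean h j u2 x2 - c * line_mean h j u3 x3| <= B.
Proof.
by move=> h0 L0 u1L u2L u3L H; apply: mean_comb => //;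
  [exact: line_continuous u1L|exact: line_continuous u2L|exact: line_continuous u3L].
Qed.

Lemma line_mean_lip h j u L : 0 < h -> 0 <= L -> lipschitz_fun L u ->
  lipschitz_fun L (line_mean h j u).
Proof.
move=> h0 L0 uL x y.
have := @line_mean_comb h j u u u L x y y 0 (L * `|x - y|) h0 L0 uL uL uL.
rewrite mul0r subr0; apply=> t _; rewrite mul0r subr0.
by apply: le_trans (uL _ _) _; rewrite opprD addrACA subrr addr0.
Qed.

(** v is obtained from u by averaging at scale h in the directions of s, and g is
    the gradient of v in these directions.  [smoothing_affine]: where u is affine
    up to e, so is v, and as g is a difference quotient at scale h of a function
    affine up to e, it is the slope up to e / h. *)
Record smoothing (h : R) s u (L : R) v (g : 'I_k -> V -> R) (M : R) : Prop := Smoothing {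
  smoothing_lip : lipschitz_fun L v;
  smoothing_const : 0 <= M;
  smoothing_grad_lip : forall j, j \in s -> lipschitz_fun M (g j);
  smoothing_grad : forall j, j \in s -> forall x (t : R),
    `|v (x + t *: basis R j) - v x - t * g j x| <= M * t ^+ 2;
  smoothing_affine : forall x (c : R) D (e r : R), 
    (forall y, `|y - x| <= (size s)%:R * h + r -> `|u y - (c + dot D (y - x))| <= e) ->
    forall p, `|p - x| <= r -> `|v p - (c + dot D (p - x))| <= e /\
      forall j, j \in s -> `|g j p - D 0 j| <= e / h }.

(** Averaging in one more direction j keeps all the estimates on the previous
    directions, as they are inequalities between values at translated points;
    in direction j itself the gradient is a symmetric difference quotient. *)
Lemma ex_smoothing h s u L : 0 < h -> 0 <= L -> lipschitz_fun L u ->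
  exists v g M, smoothing h s u L v g M.
Proof.
move=> h0 L0 uL; elim: s => [|j s [v [g [M [vL M0 gM vg va]]]]].
  exists u, (fun _ => u), 0; split=> // x c D e r H p px; split=> //.
  by apply: H; rewrite mul0r add0r.
pose g' i x := if i == j then (v (x + h *: basis R j) - v (x - h *: basis R j)) / (2 * h)
               else line_mean h j (g i) x.
have Lh : 0 <= L / h by rewrite divr_ge0// ltW.
have h2 : 0 < 2 * h by rewrite mulr_gt0.
have ins i : i \in j :: s -> i != j -> i \in s by rewrite inE => /orP[->|].
exists (line_mean h j v), g', (M + L / h); split.
- exact: line_mean_lip.
- by rewrite addr_ge0.
- move=> i ijs x y; rewrite /g'; case: eqVneq => [_|ij]; last first.
    apply: le_trans (line_mean_lip j h0 M0 (gM i (ins i ijs ij)) x y) _.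
    by rewrite ler_wpM2r// lerDl.
  have h3 := vL (x + h *: basis R j) (y + h *: basis R j).
  have h4 := vL (x - h *: basis R j) (y - h *: basis R j).
  rewrite opprD addrACA subrr addr0 in h3; rewrite opprD addrACA subrr addr0 in h4.
  rewrite -mulrBl normf_div (gtr0_norm h2) ler_pdivrMr//.
  rewrite (_ : _ - _ = (v (x + h *: basis R j) - v (y + h *: basis R j)) -
     (v (x - h *: basis R j) - v (y - h *: basis R j))); last by ring.
  apply: (le_trans (ler_normB _ _)).
  apply: (@le_trans _ _ (2 * (L * `|x - y|))); first lra.
  rewrite (_ : 2 * (L * `|x - y|) = L / h * `|x - y| * (2 * h)); last by field; rewrite gt_eqF.
  by apply: ler_wpM2r; [exact: ltW|apply: ler_wpM2r => //; rewrite lerDr].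
- move=> i ijs x t; rewrite /g'; case: eqVneq => [->|ij].
    have := mean_shift t h0 L0 (line_lip x j L0 vL).
    rewrite scaleNr /line_mean.
    rewrite (_ : (fun s0 : R => v (x + (s0 + t) *: basis R j)) =
                 (fun s0 : R => v (x + t *: basis R j + s0 *: basis R j))); last first.
      by apply/funext => t'; rewrite scalerDl addrA addrAC.
    move=> /le_trans; apply; rewrite ler_wpM2r ?sqr_ge0// lerDr//.
  have is_ := ins i ijs ij.
  have LM : 0 <= L + M by rewrite addr_ge0.
  have vLM : lipschitz_fun (L + M) v.
    by move=> y z; apply: le_trans (vL _ _) _; rewrite ler_wpM2r// lerDl.
  have gLM : lipschitz_fun (L + M) (g i).
    by move=> y z; apply: le_trans (gM _ is_ _ _) _; rewrite ler_wpM2r// lerDr.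
  apply: (@line_mean_comb _ _ v v (g i) (L + M)) => // t' _.
  rewrite (addrAC x (t *: _)).
  by apply: le_trans (vg _ is_ _ _) _; rewrite ler_wpM2r ?sqr_ge0// lerDl.
move=> x c D e r H p px.
have va' t : `|t| <= h -> `|v (p + t *: basis R j) - (c + dot D (p - x) + t * D 0 j)| <= e /\
    forall i, i \in s -> `|g i (p + t *: basis R j) - D 0 i| <= e / h.
  move=> th; have pt : `|p + t *: basis R j - x| <= h + r.
    rewrite addrAC addrC; apply: (le_trans (ler_normD _ _)); rewrite lerD//.
    exact: le_trans (norm_shift _ _) th.
  have [|h3 h4] := va x c D e (h + r) _ _ pt.
    by move=> y yx; apply: H => //; move: yx; rewrite /= -natr1 mulrDl mul1r addrA.
  split=> //; move: h3; rewrite (addrAC p _ (- x)) (dotDr D (p - x)) dotZr dot_basis.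
  by rewrite addrA.
split.
  by apply: (@mean_affine _ h _ _ (D 0 j)) => //; [exact: line_continuous vL|move=> t /va'[]].
move=> i ijs; rewrite /g'; case: eqVneq => [->|ij]; last first.
  apply: (@mean_affine _ _ _ _ 0) => //; first exact: line_continuous (gM _ (ins i ijs ij)).
  by move=> t /va'[_ h3]; rewrite mulr0 addr0; apply: h3; exact: ins.
have [|h3 _] := va' h; first by rewrite ger0_norm// ltW.
have [|h4 _] := va' (- h); first by rewrite normrN ger0_norm// ltW.
rewrite scaleNr in h4.
rewrite (_ : _ - _ = ((v (p + h *: basis R j) - (c + dot D (p - x) + h * D 0 j)) -
   (v (p - h *: basis R j) - (c + dot D (p - x) + - h * D 0 j))) / (2 * h)); last by field; rewrite gt_eqF.
rewrite normf_div (gtr0_norm h2) ler_pdivrMr//.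
apply: (le_trans (ler_normB _ _)).
rewrite (_ : e / h * (2 * h) = e + e); first exact: lerD.
by field; rewrite gt_eqF.
Qed.

End Smoothing.

(** * Lusin approximation by C^1 functions *)

Section Step.
Context (R : realType) (k : nat).
Notation V := ('rV[R]_k).
Notation mu := (@lebesgue_outer R k).
Implicit Types (p x y w : V) (u v : V -> R).
Notation lipschitz_fun L u := (forall x y, `|u x - u y| <= L * `|x - y|).

Lemma has_slope_line v (gj : V -> R) j (M : R) p (s : R) : 0 <= M ->
  (forall x (t : R), `|v (x + t *: basis R j) - v x - t * gj x| <= M * t ^+ 2) ->
  has_slope (fun t => v (p + t *: basis R j)) s (gj (p + s *: basis R j)).
Proof.
move=> M0 vg e e0; have M1 : 0 < M + 1 by rewrite ltr_wpDl.
exists (e / (M + 1)); first by rewrite divr_gt0.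
move=> t; rewrite ltr_pdivlMr// => te; rewrite scalerDl addrA.
apply: le_trans (vg _ _) _; rewrite -real_normK ?num_real// expr2 mulrA ler_wpM2r//.
have := normr_ge0 t; lra.
Qed.

(** The mean value inequality for v minus the linear function of slope b. *)
Lemma line_increment v (gj : V -> R) j (M B : R) p (b t : R) : 0 <= M ->
  (forall x (t : R), `|v (x + t *: basis R j) - v x - t * gj x| <= M * t ^+ 2) ->
  (forall s : R, `|s| <= `|t| -> `|gj (p + s *: basis R j) - b| <= B) ->
  `|v (p + t *: basis R j) - v p - t * b| <= B * `|t|.
Proof.
move=> M0 vg H.
pose F s := v (p + s *: basis R j) + (-1) * (b * s + 0 * s ^+ 2 / 2).
have FS s : has_slope F s (gj (p + s *: basis R j) + (-1) * (b + 0 * s)).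
  by apply: has_slope_comb; [exact: has_slope_line vg|exact: has_slope_quadratic].
have FB s : `|s| <= `|t| -> exists2 m, has_slope F s m & `|m| <= B.
  by move=> /H st; exists (gj (p + s *: basis R j) + (-1) * (b + 0 * s)) => //; rewrite mul0r addr0 mulN1r.
have -> : v (p + t *: basis R j) - v p - t * b = F t - F 0.
  by rewrite /F scale0r addr0; field.
have [t0|t0] := leP 0 t.
  apply: le_trans (mean_value_le (B := B) t0 _) _; last by rewrite subr0 ger0_norm.
  by move=> s /andP[? ?]; apply: FB; rewrite (ger0_norm t0) ger0_norm.
rewrite distrC; apply: le_trans (mean_value_le (B := B) (ltW t0) _) _; last by rewrite sub0r ltr0_norm.
by move=> s /andP[? ?]; apply: FB; rewrite (ltr0_norm t0) ler0_norm// lerN2.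
Qed.

Definition quadratic_gradient v (G : V -> V) (M : R) := 0 <= M /\
  (forall x y, `|G x - G y| <= M * `|x - y|) /\
  (forall x w, `|v (x + w) - v x - dot (G x) w| <= M * `|w| ^+ 2).

Lemma partials_gradient v (g : 'I_k -> V -> R) (M : R) : 0 <= M ->
  (forall j, lipschitz_fun M (g j)) ->
  (forall j x (t : R), `|v (x + t *: basis R j) - v x - t * g j x| <= M * t ^+ 2) ->
  exists M', quadratic_gradient v (fun x => \row_j g j x) M'.
Proof.
move=> M0 gM vg; exists (M + k%:R * (2 * M)).
have M2 : 0 <= k%:R * (2 * M) by rewrite !mulr_ge0.
split; first exact: addr_ge0.
split=> [x y|x w].
  apply/norm_leP => [|j]; first by rewrite mulr_ge0// addr_ge0.
  by rewrite !mxE; apply: le_trans (gM j x y) _; rewrite ler_wpM2r// lerDl.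
apply: (@le_trans _ _ (k%:R * (2 * M * `|w| ^+ 2))); last first.
  rewrite (_ : k%:R * (2 * M * _) = k%:R * (2 * M) * `|w| ^+ 2); last by ring.
  by rewrite ler_wpM2r ?exprn_ge0// lerDr.
apply: coord_walk => p j t px tw; rewrite mxE.
have h1 := vg j p t; have h2 := gM j p x.
rewrite (_ : _ - _ = (v (p + t *: basis R j) - v p - t * g j p) + t * (g j p - g j x)); last by ring.
apply: (le_trans (ler_normD _ _)); rewrite normrM.
have h3 : M * t ^+ 2 <= M * `|w| ^+ 2.
  by rewrite ler_wpM2l// -real_normK ?num_real// lerXn2r ?nnegrE.
have h4 : `|t| * `|g j p - g j x| <= `|w| * (M * `|w|).
  by rewrite ler_pM//; apply: (le_trans h2); rewrite ler_wpM2l.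
move: h1 h3 h4; rewrite expr2; lra.
Qed.

(** On the set of uniform affine approximation with error e1 at scales below a,
    v is the smoothing of u at a scale h with (k + 1) h <= a.  At distances at
    least h / 2 the difference u - v itself is O(e1 h) at both points; at smaller
    distances u and v have the same slope up to O(e1), since the smoothing at
    scale h only sees points at distance O(h). *)
Lemma lusin_step u (L e d M : R) : (0 < k)%N -> 0 < L -> lipschitz_fun L u ->
  0 < e -> 0 < d -> 0 <= M ->
  exists v G K, [/\ lebesgue_measurable K, (mu (cube 0 M `\` K) < d%:E)%E,
    forall x y, K x -> K y -> `|(u x - v x) - (u y - v y)| <= e * `|x - y| &
    [/\ forall x, `|u x - v x| <= e, lipschitz_fun L v, exists M', quadratic_gradient v G M' &
    forall x, `|G x| <= k%:R * L]].
Proof.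
move=> k0 L0 uL e0 d0 M0.
have k1 : (1 : R) <= k%:R by rewrite ler1n.
(* The two cases of the estimate of u - v need 4 k e1 <= e and
   (k (k + 1) + 1) e1 <= e. *)
pose e1 := e / (6 * (k%:R + 1) ^+ 2).
have kk : 0 < 6 * (k%:R + 1) ^+ 2 :> R by rewrite mulr_gt0// exprn_gt0// ltr_wpDl.
have e10 : 0 < e1 by rewrite divr_gt0.
have ee : e = e1 * (6 * (k%:R + 1) ^+ 2) by rewrite /e1 divfK// gt_eqF.
have [n Hn] := approx_set_large k0 L0 M0 uL e10 d0.
pose a : R := n.+1%:R^-1.
have a0 : 0 < a by rewrite invr_gt0.
(* The second bound on h makes v uniformly close to u. *)
pose h := Num.min (a / (k%:R + 1)) (e / (L * k%:R)).
have h0 : 0 < h by rewrite lt_min !divr_gt0// ?mulr_gt0// ?ltr0n// ltr_wpDl.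
have ha : (k%:R + 1) * h <= a.
  by rewrite mulrC -ler_pdivlMr ?ltr_wpDl// /h ge_min lexx.
have he : L * (k%:R * h) <= e.
  by rewrite mulrA mulrC -ler_pdivlMr ?mulr_gt0// ?ltr0n// /h ge_min lexx orbT.
have [v [g [M' [vL M'0 gM vg va]]]] := ex_smoothing (enum 'I_k) h0 (ltW L0) uL.
have ink j : j \in enum 'I_k by rewrite mem_enum.
have sk : size (enum 'I_k) = k by rewrite size_enum_ord.
exists v, (fun x => \row_j g j x), (approx_set u e1 n); split => //.
- exact: measurable_approx_set uL.
- move=> x y Kx Ky.
  (* What [smoothing_affine] says around a point of affine approximation. *)
  have near z (q : V) r : 0 <= r -> (k%:R * h + r) <= a -> affine_approx u e1 a q z ->
      forall p, `|p - z| <= r -> `|v p - (u z + dot q (p - z))| <= e1 * (k%:R * h + r) /\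
      forall j, `|g j p - q 0 j| <= e1 * (k%:R * h + r) / h.
    move=> r0 ra Hq p pz.
    have [|h1 h2] := va z (u z) q (e1 * (k%:R * h + r)) r _ p pz.
      rewrite sk => y' y'z; have := Hq (y' - z) (le_trans y'z ra).
      rewrite [z + _]addrC subrK opprD addrA => /le_trans; apply.
      by rewrite ler_wpM2l// ltW.
    by split=> // j; exact: h2.
  have dist z : approx_set u e1 n z -> `|u z - v z| <= e1 * (k%:R * h).
    move=> [q _ Hq]; have [||h1 _] := near z (map_mx ratr q) 0 (lexx 0) _ Hq z _.
      by rewrite addr0; apply: le_trans ha; rewrite mulrDl lerDl mul1r ltW.
    by rewrite subrr normr0.
    by move: h1; rewrite subrr dot0r !addr0 distrC.
  have [hxy|xyh] := leP h (2 * `|x - y|).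
    apply: (le_trans (ler_normB _ _)).
    have h1 := dist x Kx; have h2 := dist y Ky.
    have h3 : e1 * (k%:R * h) <= e1 * (k%:R * (2 * `|x - y|)).
      by rewrite !ler_wpM2l// ltW.
    have h4 : 0 <= e1 * `|x - y| by rewrite mulr_ge0// ltW.
    rewrite ee; nra.
  have [q _ Hq] := Kx; set b := map_mx ratr q in Hq.
  pose w := y - x.
  have wE : `|w| = `|x - y| by rewrite /w distrC.
  have yE : y = x + w by rewrite /w addrC subrK.
  
  have wa : `|w| <= a.
    rewrite wE; apply: le_trans ha; nra.
  have h1 := Hq w wa.
  have h2 : `|v (x + w) - v x - dot b w| <= k%:R * (e1 * (k%:R * h + h) / h * `|w|).
    apply: coord_walk => p j t px tw.
    apply: le_trans (_ : e1 * (k%:R * h + h) / h * `|t| <= _); last first.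
      have kh0 : 0 <= k%:R * h + h by rewrite addr_ge0 ?mulr_ge0// ?ltW.
      by rewrite ler_wpM2l// divr_ge0 ?(ltW h0)// mulr_ge0// ltW.
    apply: (@line_increment v (g j) j M') => //; first by move=> z s; exact: vg.
    move=> s st; have [||_ h2] := near x b h (ltW h0) _ Hq (p + s *: basis R j) _.
    - by apply: le_trans ha; rewrite mulrDl mul1r.
    - rewrite addrAC; apply: (le_trans (ler_normD _ _)).
      have := norm_shift s j; rewrite wE in px tw; lra.
    - exact: h2.
  rewrite -yE in h1 h2.
  rewrite (_ : _ - _ = (v y - v x - dot b w) - (u y - u x - dot b w)); last by ring.
  apply: (le_trans (ler_normB _ _)).
  rewrite -wE.
  have h3 : k%:R * (e1 * (k%:R * h + h) / h * `|w|) = e1 * `|w| * (k%:R * (k%:R + 1)).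
    by field; rewrite gt_eqF.
  rewrite h3 in h2; have h4 : 0 <= e1 * `|w| by rewrite mulr_ge0// ltW.
  rewrite ee; nra.
split => //.
- move=> x; have [||h1 _] := va x (u x) 0 (L * (k%:R * h)) 0 _ x _.
  + move=> y; rewrite sk addr0 => yx.
    rewrite (_ : dot 0 (y - x) = 0); last by rewrite /dot big1// => j _; rewrite mxE mul0r.
    by rewrite addr0; apply: le_trans (uL _ _) _; rewrite ler_wpM2l// ltW.
  + by rewrite subrr normr0.
  + by move: h1; rewrite subrr dot0r addr0 distrC => /le_trans; apply.
- apply: (@partials_gradient v g M') => // j; first by exact: gM.
  by exact: vg.
- move=> x; have [||_ h1] := va x (u x) 0 (L * (k%:R * h)) 0 _ x _.
  + move=> y; rewrite sk addr0 => yx.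
    rewrite (_ : dot 0 (y - x) = 0); last by rewrite /dot big1// => j _; rewrite mxE mul0r.
    by rewrite addr0; apply: le_trans (uL _ _) _; rewrite ler_wpM2l// ltW.
  + by rewrite subrr normr0.
  + apply/norm_leP => [|j]; first by rewrite mulr_ge0// ltW.
    rewrite mxE; have := h1 j (ink j); rewrite mxE subr0.
    by rewrite (_ : _ / h = k%:R * L)//; field; rewrite gt_eqF.
Qed.

End Step.

Section Limit.
Context (R : realType) (k : nat).
Notation V := ('rV[R]_k).
Notation half := (2^-1 : R).
Implicit Types (x y w : V) (a : nat -> R).

Lemma half_small (c e : R) : 0 < e -> exists N, c * half ^+ N < e.
Proof.
move=> e0; have [n cn] := nat_above (`|c| / e).
exists n; apply: (@le_lt_trans _ _ (`|c| * half ^+ n)).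
  by rewrite ler_wpM2r ?exprn_ge0 ?invr_ge0// ler_norm.
rewrite exprVn ltr_pdivrMr ?exprn_gt0// mulrC -ltr_pdivrMr//.
by apply: (lt_le_trans cn); rewrite -natrX ler_nat ltnW// ltn_expl.
Qed.

Lemma half_eq0 (b c : R) : (forall N, `|b| <= c * half ^+ N) -> b = 0.
Proof.
move=> H; apply/eqP; rewrite -normr_le0; apply/ler_addgt0Pr => e e0; rewrite add0r.
by have [N /ltW] := half_small c e0; exact: le_trans.
Qed.

(** The limit is the supremum of the lower bounds a N - 2 C / 2^N. *)
Lemma geometric_limit a (C : R) : (forall N, `|a N.+1 - a N| <= C * half ^+ N) ->
  exists l, forall N, `|l - a N| <= 2 * C * half ^+ N.
Proof.
move=> H.
have H1 n d : `|a (n + d)%N - a n| <= 2 * C * (half ^+ n - half ^+ (n + d)).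
  elim: d => [|d IH]; first by rewrite addn0 !subrr normr0 mulr0.
  rewrite addnS; have h1 := H (n + d)%N.
  rewrite (_ : a (n + d).+1 - a n = (a (n + d).+1 - a (n + d)%N) + (a (n + d)%N - a n)); last by ring.
  apply: (le_trans (ler_normD _ _)); rewrite exprS; lra.
have C0 : 0 <= C by have := H 0%N; rewrite expr0 mulr1; exact: le_trans.
have H2 n m : (n <= m)%N -> `|a m - a n| <= 2 * C * half ^+ n.
  move=> nm; have := H1 n (m - n)%N; rewrite subnKC// => /le_trans; apply.
  by rewrite ler_wpM2l ?mulr_ge0// gerBl exprn_ge0// invr_ge0.
pose S := range (fun n => a n - 2 * C * half ^+ n).
have ubS n : ubound S (a n + 2 * C * half ^+ n).
  move=> _ [m _ <-].
  have p0 i : 0 <= 2 * C * half ^+ i by rewrite !mulr_ge0// exprn_ge0// invr_ge0.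
  have [nm|/ltnW mn] := leqP n m.
    have := H2 _ _ nm; rewrite ler_distl => /andP[_ ?]; have := p0 m; lra.
  have := H2 _ _ mn; rewrite ler_distl => /andP[? _]; have := p0 n; lra.
have hS : has_sup S by split; [exists (a 0%N - 2 * C * half ^+ 0); exists 0%N|exists (a 0%N + 2 * C * half ^+ 0); exact: ubS].
exists (sup S) => n; rewrite ler_distl; apply/andP; split.
  by apply: ub_le_sup; [exact: hS.2|exists n].
by apply: ge_sup; [exact: hS.1|exact: ubS].
Qed.

(** Continuous differentiability in explicit epsilon form, for which the limit of
    a sequence is elementary; [gradient_C1] recovers the differential. *)
Definition gradient (g : V -> R) (G : V -> V) :=
  (forall x (e : R), 0 < e -> exists2 d : R, 0 < d &
    forall w, `|w| < d -> `|g (x + w) - g x - dot (G x) w| <= e * `|w|) /\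
  (forall x (e : R), 0 < e -> exists2 d : R, 0 < d &
    forall w, `|w| < d -> `|G (x + w) - G x| <= e).

Lemma quadratic_gradientW v G (M : R) : quadratic_gradient v G M -> gradient v G.
Proof.
move=> [M0 [GM vM]]; have M1 : 0 < M + 1 by rewrite ltr_wpDl.
split=> x e e0; exists (e / (M + 1)); rewrite ?divr_gt0// => w; rewrite ltr_pdivlMr// => we.
  apply: le_trans (vM _ _) _.
  rewrite expr2 mulrA ler_wpM2r//; have := normr_ge0 w; lra.
apply: le_trans (GM _ _) _; rewrite addrAC subrr add0r; have := normr_ge0 w; lra.
Qed.

Lemma gradientD f g F G : gradient f F -> gradient g G ->
  gradient (fun x => f x + g x) (fun x => F x + G x).
Proof.
move=> [fF cF] [gG cG]; split=> x e e0; have e2 : 0 < e / 2 by rewrite divr_gt0.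
  have [d d0 Hd] := fF x _ e2; have [d' d'0 Hd'] := gG x _ e2.
  exists (Num.min d d'); first by rewrite lt_min d0.
  move=> w; rewrite lt_min => /andP[/Hd h1 /Hd' h2]; rewrite dotDl.
  rewrite (_ : _ - _ = (f (x + w) - f x - dot (F x) w) + (g (x + w) - g x - dot (G x) w)); last by ring.
  apply: (le_trans (ler_normD _ _)); lra.
have [d d0 Hd] := cF x _ e2; have [d' d'0 Hd'] := cG x _ e2.
exists (Num.min d d'); first by rewrite lt_min d0.
move=> w; rewrite lt_min => /andP[/Hd h1 /Hd' h2]; rewrite opprD addrACA.
apply: (le_trans (ler_normD _ _)); lra.
Qed.

Lemma eps_continuous (T1 T2 : normedModType R) (f : T1 -> T2) :
  (forall (x : T1) (e : R), 0 < e -> exists2 d : R, 0 < d &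
    forall w : T1, `|w| < d -> `|f (x + w) - f x| <= e) -> continuous f.
Proof.
move=> H x; apply/cvgrPdist_le => e e0; have [d d0 Hd] := H x e e0.
apply/nbhs_ballP; exists d => //= y; rewrite -ball_normE /ball_ /= distrC => /Hd.
by rewrite [x + _]addrC subrK distrC.
Qed.

Lemma gradient_C1 g G : gradient g G -> C1 g /\ forall x w, 'd g x w = dot (G x) w.
Proof.
move=> [gG cG].
have lin x : linear_for *%R (dot (G x)).
  by move=> c w w'; rewrite dotDr dotZr.
pose D x : {linear V -> R} := HB.pack (dot (G x)) (GRing.isLinear.Build _ _ _ _ _ (lin x)).
have cD x : continuous (D x).
  apply: (@lip_continuous R V R _ (k%:R * `|G x|)) => w w'.
  by rewrite /D /= -(raddfB (D x)); exact: norm_dot_le.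
have E x : (g \o shift x : V -> R) = cst (g x) + (D x : V -> R) +o_ (0 : V) id.
  apply/eqaddoP => e e0; apply/nbhs_ballP.
  have [d d0 Hd] := gG x e e0; exists d => //= w.
  rewrite -ball_normE /ball_ /= sub0r normrN => /Hd.
  by rewrite !fctE /= [w + x]addrC opprD addrA.
have dE x : 'd g x = D x :> (V -> R) by apply: diff_unique.
have dg x : differentiable g x.
  by apply/diff_locallyP; split; [rewrite dE|rewrite dE; exact: E].
split; last by move=> x w; rewrite dE.
split=> // w.
rewrite (_ : (fun y => 'd g y w) = (fun y => dot (G y) w)); last by apply/funext => y; rewrite dE.
apply: (@eps_continuous V R) => x e e0.
have w1 : 0 < k%:R * `|w| + 1 by rewrite ltr_wpDl// mulr_ge0.
have [d d0 Hd] := cG x _ (divr_gt0 e0 w1).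
exists d => //= y /Hd; rewrite ler_pdivlMr// => h.
rewrite -dotNl -dotDl; apply: le_trans (norm_dot_le _ _) _.
apply: le_trans h; rewrite -mulrA mulrCA ler_wpM2l// lerDl//.
Qed.

(** A sequence converging geometrically in C^1: compare g with s N, where N makes
    the Lipschitz constant of g - s N and the distance of the gradients small. *)
Lemma gradient_limit (s : nat -> V -> R) (S : nat -> V -> V) (C : R) :
  (forall N, gradient (s N) (S N)) ->
  (forall N x, `|s N.+1 x - s N x| <= C * half ^+ N) ->
  (forall N x y, `|(s N.+1 x - s N x) - (s N.+1 y - s N y)| <= C * half ^+ N * `|x - y|) ->
  (forall N x, `|S N.+1 x - S N x| <= C * half ^+ N) ->
  exists g, C1 g /\ forall N x, `|g x - s N x| <= 2 * C * half ^+ N.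
Proof.
move=> sS s1 s2 S1.
have C0 : 0 <= C by have := s1 0%N 0; rewrite expr0 mulr1; exact: le_trans.
have p0 i : 0 <= half ^+ i by rewrite exprn_ge0// invr_ge0.
have [g Hg] := choice (fun x => geometric_limit (s1 ^~ x)).
have HG x : exists y : V, forall N, `|y - S N x| <= 2 * C * half ^+ N.
  have H j : exists l, forall N, `|l - S N x 0 j| <= 2 * C * half ^+ N.
    apply: geometric_limit => N; apply: le_trans (S1 N x).
    by have := norm_le_coord (S N.+1 x - S N x) j; rewrite !mxE.
  have [l Hl] := choice H.
  exists (\row_j l j) => N; apply/norm_leP => [|j]; first by rewrite !mulr_ge0.
  by rewrite !mxE; exact: Hl.
have [G {}HG] := choice HG.
have Hg2 N x y : `|(g x - s N x) - (g y - s N y)| <= 2 * C * half ^+ N * `|x - y|.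
  have [|l Hl] := @geometric_limit (fun N => s N x - s N y) (C * `|x - y|).
    move=> m; have := s2 m x y.
    by rewrite mulrAC; congr (_ <= _); congr `|_|; ring.
  have lE : l = g x - g y.
    apply/eqP; rewrite -subr_eq0; apply/eqP.
    apply: (@half_eq0 _ (2 * (C * `|x - y|) + 4 * C)) => m.
    have h1 := Hl m; have h2 := Hg x m; have h3 := Hg y m.
    rewrite (_ : l - (g x - g y) = (l - (s m x - s m y)) - (g x - s m x) + (g y - s m y)); last by ring.
    apply: (le_trans (ler_normD _ _)); have := ler_normB (l - (s m x - s m y)) (g x - s m x).
    lra.
  have := Hl N; rewrite lE.
  rewrite (_ : 2 * C * half ^+ N * `|x - y| = 2 * (C * `|x - y|) * half ^+ N); last by ring.
  by congr (_ <= _); congr `|_|; ring.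
exists g; split => [|N x]; last exact: Hg.
suff /gradient_C1[] : gradient g G by [].
split=> x e e0.
  have e2 : 0 < e / 2 by rewrite divr_gt0.
  have [N HN] := half_small (2 * C + k%:R * (2 * C)) e2.
  have [d d0 Hd] := (sS N).1 x _ e2.
  exists d => // w /Hd h1.
  have h2 := Hg2 N (x + w) x; rewrite (addrAC x w) subrr add0r in h2.
  have h3 := norm_dot_le (G x - S N x) w.
  rewrite (_ : _ - _ = ((g (x + w) - s N (x + w)) - (g x - s N x)) +
    (s N (x + w) - s N x - dot (S N x) w) - dot (G x - S N x) w); last by rewrite dotDl dotNl; ring.
  apply: (le_trans (ler_normB _ _)).
  have := ler_normD ((g (x + w) - s N (x + w)) - (g x - s N x)) (s N (x + w) - s N x - dot (S N x) w).
  have h4 : k%:R * `|G x - S N x| * `|w| <= k%:R * (2 * C * half ^+ N) * `|w|.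
    by rewrite ler_wpM2r// ler_wpM2l.
  have h5 : (2 * C + k%:R * (2 * C)) * half ^+ N * `|w| <= e / 2 * `|w|.
    by rewrite ler_wpM2r// ltW.
  lra.
have [N HN] := half_small (2 * C) (divr_gt0 e0 (ltr0n R 3)).
have [d d0 Hd] := (sS N).2 x _ (divr_gt0 e0 (ltr0n R 3)).
exists d => // w /Hd h1; have h2 := HG x N; have h3 := HG (x + w) N.
rewrite (_ : _ - _ = (G (x + w) - S N (x + w)) + (S N (x + w) - S N x) - (G x - S N x)); last first.
  by rewrite addrA subrK opprB addrA subrK.
apply: (le_trans (ler_normB _ _)).
have := ler_normD (G (x + w) - S N (x + w)) (S N (x + w) - S N x); lra.
Qed.

End Limit.

Section Lusin.
Context (R : realType) (k : nat).
Notation V := ('rV[R]_k).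
Notation mu := (@lebesgue_outer R k).
Notation half := (2^-1 : R).
Implicit Types (x y w : V) (u v : V -> R) (E K : set V).
Notation lipschitz_fun L u := (forall x y, `|u x - u y| <= L * `|x - y|).

(** The McShane extension, the infimum of the cones u y + L |x - y| with y in K. *)
Lemma lipschitz_extension K u (L : R) : 0 <= L ->
  (forall x y, K x -> K y -> `|u x - u y| <= L * `|x - y|) ->
  exists u', lipschitz_fun L u' /\ forall x, K x -> u' x = u x.
Proof.
move=> L0 uL; have [[y0 Ky0]|K0] := pselect (exists y, K y); last first.
  exists (fun=> 0); split=> [x y|x Kx]; first by rewrite subrr normr0 mulr_ge0.
  by case: K0; exists x.
pose S x := [set u y + L * `|x - y| | y in K].
have lbS x : lbound (S x) (u y0 - L * `|x - y0|).
  move=> _ [y Ky <-]; have := uL y y0 Ky Ky0; rewrite ler_distl => /andP[h _].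
  have : L * `|y - y0| <= L * `|x - y| + L * `|x - y0|.
    rewrite -mulrDr ler_wpM2l// (distrC x y); apply: le_trans (ler_normD _ _).
    by rewrite addrA subrK.
  lra.
have S0 x : nonempty (S x) by exists (u y0 + L * `|x - y0|); exists y0.
have hS x : has_lbound (S x) by exists (u y0 - L * `|x - y0|); exact: lbS.
have le x y : inf (S x) - L * `|x - y| <= inf (S y).
  apply: lb_le_inf => // _ [z Kz <-].
  have : inf (S x) <= u z + L * `|x - z| by apply: ge_inf => //; exists z.
  have : L * `|x - z| <= L * `|x - y| + L * `|y - z|.
    rewrite -mulrDr ler_wpM2l//; apply: le_trans (ler_normD _ _).
    by rewrite addrA subrK.
  lra.
exists (fun x => inf (S x)); split=> [x y|x Kx].
  rewrite ler_distl; have := le x y; have := le y x; rewrite (distrC y x) => ? ?.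
  by apply/andP; split; lra.
apply/eqP; rewrite eq_le; apply/andP; split.
  apply: (@le_trans _ _ (u x + L * `|x - x|)); last by rewrite subrr normr0 mulr0 addr0.
  by apply: ge_inf => //; exists x.
apply: lb_le_inf => // _ [y Ky <-].
by have := uL x y Kx Ky; rewrite ler_distl => /andP[].
Qed.

(** On K, u is the sum of a C^1 function v and a remainder r, whose Lipschitz
    constant and supremum norm are at most L / 2. *)
Definition splitting (M d L : R) u (p : (V -> R) * (V -> V) * set V * (V -> R)) :=
  let: (v, G, K, r) := p in
  [/\ lebesgue_measurable K, (mu (cube 0 M `\` K) < d%:E)%E,
    forall x, K x -> u x = v x + r x,
    lipschitz_fun (L / 2) r /\ (forall x, `|r x| <= L / 2) &
    [/\ gradient v G, lipschitz_fun L v, forall x, `|G x| <= k%:R * L &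
        forall x, `|u x - v x| <= L / 2]].

Lemma ex_splitting u (L M d : R) : (0 < k)%N -> 0 < L -> lipschitz_fun L u ->
  0 < d -> 0 <= M -> exists p, splitting M d L u p.
Proof.
move=> k0 L0 uL d0 M0; have L2 : 0 < L / 2 by rewrite divr_gt0.
have [v [G [K [mK Kd KL [uv vL [M' vG] GL]]]]] := lusin_step k0 L0 uL L2 d0 M0.
have [r [rL ruv]] := @lipschitz_extension K (fun x => u x - v x) (L / 2) (ltW L2) KL.
have L2' : - (L / 2) <= L / 2 by lra.
(* The extension is clamped, as it has to be small on the whole space. *)
exists (v, G, K, fun x => clamp (- (L / 2)) (L / 2) (r x)); split => //.
- move=> x Kx; rewrite ruv//; have := uv x; rewrite ler_norml => /andP[? ?].
  by rewrite clamp_id// addrC subrK.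
- split=> [x y|x]; first exact: le_trans (clamp_lip _ _ L2') (rL x y).
  by rewrite ler_norml clamp_itv.
- by split=> //; exact: quadratic_gradientW vG.
Qed.

(** Iterate [ex_splitting] on the remainders U m, whose Lipschitz constants
    decrease geometrically; on the intersection of the sets K m they tend to 0,
    so that u is the sum of the smooth parts v m. *)
Lemma lusin_C1 u (L M d : R) : (0 < k)%N -> 0 < L -> lipschitz_fun L u ->
  0 < d -> 0 <= M -> exists g K, [/\ C1 g, lebesgue_measurable K,
    (mu (cube 0 M `\` K) <= d%:E)%E & forall x, K x -> g x = u x].
Proof.
move=> k0 L0 uL d0 M0.
pose l m := L * half ^+ m.
have l0 m : 0 < l m by rewrite mulr_gt0// exprn_gt0// invr_gt0.
have lS m : l m.+1 = l m / 2 by rewrite /l exprS mulrCA mulrC.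
pose dm m : R := d / (2 ^ m.+1)%:R.
have dm0 m : 0 < dm m by rewrite divr_gt0// ltr0n expn_gt0.
have H (mw : nat * (V -> R)) : exists p, lipschitz_fun (l mw.1) mw.2 ->
    splitting M (dm mw.1) (l mw.1) mw.2 p.
  case: mw => m w /=.
  have [wL|nL] := pselect (lipschitz_fun (l m) w).
    by have [p Hp] := ex_splitting k0 (l0 m) wL (dm0 m) M0; exists p.
  by exists (w, fun=> 0, set0, w) => wL.
have [F HF] := choice H.
pose U := fix U m := if m is m'.+1 then (F (m', U m')).2 else u.
pose v m := (F (m, U m)).1.1.1; pose G m := (F (m, U m)).1.1.2; pose K m := (F (m, U m)).1.2.
have UE m : U m.+1 = (F (m, U m)).2 by [].
have UL m : lipschitz_fun (l m) (U m).
  elim: m => [|m IH]; first by rewrite /l expr0 mulr1.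
  move: (HF (m, U m) IH); rewrite lS UE /=.
  by case: (F (m, U m)) => [[[? ?] ?] ?] [_ _ _ [] + _] _.
have {}H m : splitting M (dm m) (l m) (U m) (v m, G m, K m, U m.+1).
  move: (HF (m, U m) (UL m)); rewrite UE /v /G /K /=.
  by case: (F (m, U m)) => [[[? ?] ?] ?].
have mK m : lebesgue_measurable (K m) by have [] := H m.
have Kd m : (mu (cube 0 M `\` K m) <= (dm m)%:E)%E by have [_ /ltW] := H m.
have Uv m x : K m x -> U m x = v m x + U m.+1 x by have [_ _ h _ _] := H m; exact: h.
have Ub m x : `|U m.+1 x| <= l m.+1 by rewrite lS; have [_ _ _ [_ h] _] := H m; exact: h.
have vG m : gradient (v m) (G m) by have [_ _ _ _ []] := H m.
have vL m : lipschitz_fun (l m) (v m) by have [_ _ _ _ []] := H m.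
have Gb m x : `|G m x| <= k%:R * l m by have [_ _ _ _ [_ _ h _]] := H m; exact: h.
have Uvb m x : `|U m x - v m x| <= l m.+1 by rewrite lS; have [_ _ _ _ [_ _ _ h]] := H m; exact: h.
(* The partial sums start with v 0, the only term that is not small. *)
pose s := fix s N x : R := if N is N'.+1 then s N' x + v N x else v 0%N x.
pose S := fix S N x : V := if N is N'.+1 then S N' x + G N x else G 0%N x.
have sS N : gradient (s N) (S N) by elim: N => [|N IH]; [exact: vG|exact: gradientD].
have sE N x : s N.+1 x - s N x = v N.+1 x by rewrite /= addrC addKr.
have SE N x : S N.+1 x - S N x = G N.+1 x by rewrite /= addrC addKr.
pose C := (k%:R + 1) * L.
have p0 N : 0 <= half ^+ N by rewrite exprn_ge0// invr_ge0.
have k0' : (0 : R) <= k%:R by [].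
have lC N : l N.+1 <= C * half ^+ N /\ k%:R * l N.+1 <= C * half ^+ N /\ l N.+1 + l N.+2 <= C * half ^+ N.
  have CE : C * half ^+ N = k%:R * l N + l N by rewrite /C /l; ring.
  have := mulr_ge0 k0' (ltW (l0 N)); have := l0 N.
  by rewrite CE !lS => ? ?; split; [|split]; lra.
have [||||g [gC1 Hg]] := @gradient_limit R k s S C.
- exact: sS.
- move=> N x; rewrite sE; have [_ [_ h]] := lC N; apply: le_trans h.
  have := Ub N x; have := Uvb N.+1 x; rewrite distrC => h1 h2.
  rewrite (_ : v N.+1 x = U N.+1 x + (v N.+1 x - U N.+1 x)); last by ring.
  by apply: (le_trans (ler_normD _ _)); rewrite lerD.
- move=> N x y; rewrite !sE; have [h _] := lC N; apply: le_trans (vL _ _ _) _.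
  by rewrite ler_wpM2r.
- by move=> N x; rewrite SE; have [_ [h _]] := lC N; apply: le_trans h; exact: Gb.
exists g, (\bigcap_m K m); split=> //.
- exact: bigcapT_measurable.
- apply: le_trans (epsilon_trick0 xpredT (ltW d0)).
  apply: (@le_trans _ _ (\sum_(m <oo) mu (cube 0 M `\` K m))%E); last first.
    by apply: lee_nneseries => // m _ *; exact: lebesgue_outer_ge0.
  apply: le_trans (lebesgue_outer_sigma_subadditive _).
  by apply: le_lebesgue_outer; rewrite setDE setC_bigcap setI_bigcupr.
move=> x Kx.
have us N : u x = s N x + U N.+1 x.
  elim: N => [|N IH]; first exact: (Uv 0%N x (Kx 0%N I)).
  by rewrite IH (Uv N.+1 x (Kx N.+1 I)) /= addrA.
apply/eqP; rewrite -subr_eq0; apply/eqP; apply: (@half_eq0 _ _ (3 * C)) => N.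
rewrite (us N) opprD addrA; apply: (le_trans (ler_normB _ _)).
have := Hg N x; have := Ub N x; have [h _] := lC N; lra.
Qed.

(** N1 collects the points of a cube of radius m left out by all the sets of
    agreement K m n, and N2 the points of some E `&` K m n at which this set does
    not have density 1. *)
Lemma lipschitz_ap_diff_ae E u (L : R) : (0 < k)%N -> lebesgue_measurable E -> 0 < L ->
  lipschitz_fun L u ->
  mu [set x | E x /\ ~ exists l : {linear V -> R}, is_ap_diff1 E u x l] = 0%E.
Proof.
move=> k0 mE L0 uL.
have H (mn : nat * nat) : exists gK : (V -> R) * set V, [/\ C1 gK.1, lebesgue_measurable gK.2,
    (mu (cube 0 mn.1%:R `\` gK.2) <= (mn.2.+1%:R^-1)%:E)%E & forall x, gK.2 x -> gK.1 x = u x].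
  have [||g [K h]] := @lusin_C1 u L mn.1%:R mn.2.+1%:R^-1 k0 L0 uL => //.
  by exists (g, K).
have [F HF] := choice H.
pose g m n := (F (m, n)).1; pose K m n := (F (m, n)).2.
pose N1 := \bigcup_m \bigcap_n (cube 0 m%:R `\` K m n).
pose N2 := \bigcup_m \bigcup_n [set x | (E `&` K m n) x /\ ~ dense_at (E `&` K m n) x].
have mEK m n : lebesgue_measurable (E `&` K m n).
  by apply: measurableI => //; have [] := HF (m, n).
apply: (@null_subset _ _ _ (N1 `|` N2)); last first.
  apply: null_setU; apply: null_bigcup => m; last first.
    by apply: null_bigcup => n; exact: dense_at_ae.
  apply/eqP; rewrite eq_le lebesgue_outer_ge0 andbT; apply/lee_addgt0Pr => e e0; rewrite add0e.
  have [n ne] := small_inv e0.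
  have [_ _ h _] := HF (m, n).
  apply: (@le_trans _ _ (mu (cube 0 m%:R `\` K m n))).
    by apply: le_lebesgue_outer => x; apply.
  by apply: (le_trans h); rewrite lee_fin ltW.
move=> x [Ex nx]; apply: contrapT => /not_orP[n1 n2]; apply: nx.
have [m xm] := in_large_cube x.
have [n Kx] : exists n, K m n x.
  apply: contrapT => h; apply: n1; exists m => // n _; split=> // Kx; apply: h; by exists n.
have [gC1 _ _ gu] := HF (m, n).
exists ('d (g m n) x); exists (E `&` K m n), (g m n); split=> //.
- by move=> y; rewrite inE => -[_]; exact: gu.
- apply: dense_density_point => //; apply: contrapT => h; apply: n2.
  by exists m => //; exists n.
Qed.

Lemma is_ap_diff1S E E' u u' x l : E' `<=` E -> (forall y, E' y -> u' y = u y) ->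
  is_ap_diff1 E' u' x l -> is_ap_diff1 E u x l.
Proof.
move=> EE uu [K [g [[mK KE] gC1 gu dK lE]]]; exists K, g; split=> //.
  by split=> //; exact: subset_trans EE.
by move=> y yK; rewrite gu// uu//; apply: KE; rewrite inE in yK.
Qed.

End Lusin.

(** * Approximate derivatives of maps into the Heisenberg group *)

Section Final.
Context (R : realType) (n k : nat).
Notation V := ('rV[R]_k).
Notation mu := (@lebesgue_outer R k).
Implicit Types (x y w : V) (E : set V) (f : V -> heis R n).

(** Rational cubes, with an integer Lipschitz constant as a further index, give a
    countable cover of E by sets on which f is Lipschitz. *)
Definition lipschitz_piece E (p : 'rV[rat]_k * rat * nat) : set V :=
  E `&` cube (map_mx (@ratr R) p.1.1) (ratr p.1.2).

Definition lipschitz_on_piece E f p := forall y z,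
  lipschitz_piece E p y -> lipschitz_piece E p z ->
  (dcc (f y) (f z) <= (p.2%:R * enorm (y - z))%:E)%E.

Lemma lipschitz_piece_cover E f x : locally_lipschitz E f -> E x ->
  exists2 p, lipschitz_on_piece E f p & lipschitz_piece E p x.
Proof.
move=> fL Ex; have [r [C [r0 H]]] := fL x Ex.
have r1 : 0 < r / (2 * k.+1%:R) by rewrite divr_gt0// mulr_gt0.
have [s] := @rat_in_itvoo R _ _ r1; rewrite in_itv/= => /andP[s0 s1].
have [q Hq] := choice (fun j => near_rat (x 0 j) s0).
have [N CN] := nat_above C.
pose c := map_mx (@ratr R) (\row_j q j).
have xc : `|x - c| <= ratr s.
  by apply/norm_leP => [|j]; [exact: ltW|rewrite !mxE distrC ltW].
have sub : lipschitz_piece E (\row_j q j, s, N) `<=` E `&` eball x r.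
  move=> y [Ey /cube_normP yc]; split=> //.
  apply: (@lt_le_trans _ _ (k.+1%:R * (2 * ratr s))).
    apply: cube_sub_eball; first by rewrite mulr_gt0.
    apply/cube_normP; first by rewrite mulr_ge0// ltW.
    have := yc (ltW s0); rewrite /= -/c => {}yc.
    rewrite (_ : y - x = (y - c) - (x - c)); last by rewrite opprB addrA subrK.
    apply: (le_trans (ler_normB _ _)); lra.
  have : ratr s * (2 * k.+1%:R) < r by rewrite -ltr_pdivlMr// mulr_gt0.
  lra.
exists (\row_j q j, s, N); last by split=> //; apply/cube_normP => //; exact: ltW.
move=> y z /sub Ey /sub Ez; apply: (le_trans (H _ _ Ey Ez)).
by rewrite lee_fin ler_wpM2r ?sqrtr_ge0// ltW.
Qed.

Lemma coordinate_lipschitz E f p j y z : lipschitz_on_piece E f p ->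
  lipschitz_piece E p y -> lipschitz_piece E p z ->
  `|(f y).1 0 j - (f z).1 0 j| <= (p.2%:R * k%:R + 1) * `|y - z|.
Proof.
move=> H Ey Ez; have [h _] := dcc_le (H y z Ey Ez).
have := norm_le_coord ((f z).1 - (f y).1) j; rewrite !mxE distrC => /le_trans; apply.
apply: (le_trans h); apply: le_trans (_ : p.2%:R * (k%:R * `|y - z|) <= _).
  by rewrite ler_wpM2l// enorm_le_norm.
by rewrite mulrA ler_wpM2r// lerDl.
Qed.

(** On each piece the components of z are Lipschitz and extend to the whole space;
    approximate derivatives on a subset of E are approximate derivatives on E. *)
Lemma ap_diff_ae E f : (0 < k)%N -> lebesgue_measurable E -> locally_lipschitz E f ->
  mu [set x | E x /\ ~ exists L : 'Hom(V, 'rV[R]_(n + n)),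
    is_ap_diff E (@heis_proj R n \o f) x L] = 0%E.
Proof.
move=> k0 mE fL.
pose S := lipschitz_piece E.
pose u j y := (f y).1 0 j.
pose N (p : 'rV[rat]_k * rat * nat) := \bigcup_(j : 'I_(n + n))
  [set x | lipschitz_on_piece E f p /\ (S p x /\
     ~ exists l : {linear V -> R}, is_ap_diff1 E (u j) x l)].
apply: (@null_subset _ _ _ (\bigcup_p N p)); last first.
  apply: null_countable_bigcup => p; apply: null_countable_bigcup => j.
  have [Hp|nHp] := pselect (lipschitz_on_piece E f p); last first.
    rewrite (_ : [set x | _] = set0) ?lebesgue_outer0//.
    by apply/seteqP; split=> // x [].
  have L0 : 0 <= p.2%:R * k%:R + 1 :> R by rewrite addr_ge0// mulr_ge0.
  have [|u' [u'L u'E]] := @lipschitz_extension R k (S p) (u j) _ L0.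
    by move=> y z; exact: coordinate_lipschitz.
  have mS : lebesgue_measurable (S p) by apply: measurableI => //; exact: measurable_box.
  have Lp : 0 < p.2%:R * k%:R + 1 :> R by rewrite ltr_wpDl// mulr_ge0.
  apply: null_subset (lipschitz_ap_diff_ae k0 mS Lp u'L) => x [_ [Sx nx]].
  split=> // -[l Hl]; apply: nx; exists l.
  by apply: is_ap_diff1S Hl => //; exact: subIsetl.
move=> x [Ex nx]; apply: contrapT => Nx; apply: nx.
have [p Hp Sx] := lipschitz_piece_cover fL Ex.
have H j : exists l : {linear V -> R}, is_ap_diff1 E (u j) x l.
  by apply: contrapT => h; apply: Nx; exists p => //; exists j.
have [l Hl] := choice H.
have lin : linear (fun v : V => \row_j l j v : 'rV[R]_(n + n)).
  by move=> a v w; apply/rowP => j; rewrite !mxE linearP.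
pose T : {linear V -> 'rV[R]_(n + n)} :=
  HB.pack (fun v : V => \row_j l j v : 'rV[R]_(n + n)) (GRing.isLinear.Build _ _ _ _ _ lin).
exists (linfun T) => j; have := Hl j.
by rewrite (_ : (fun v => linfun T v 0 j) = l j)//; apply/funext => v; rewrite lfunE /= mxE.
Qed.

End Final.

Theorem mainTheorem3 (R : realType) (n k : nat) (n_gt0 : (0 < n)%N)
  (n_lt_k : (n < k)%N) (E : set 'rV[R]_k) (mE : lebesgue_measurable E)
  (f : 'rV[R]_k -> heis R n) (f_lip : locally_lipschitz E f) :
  {ae lebesgue_rV R k, forall x, E x ->
    (exists L : 'Hom('rV[R]_k, 'rV[R]_(n + n)),
      is_ap_diff E (heis_proj (n:=n) \o f) x L) /\
    (forall L : 'Hom('rV[R]_k, 'rV[R]_(n + n)),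
      is_ap_diff E (heis_proj (n:=n) \o f) x L -> isotropic (limg L))}.
Proof.
have k0 : (0 < k)%N by exact: leq_ltn_trans n_lt_k.
have N0 := ap_diff_ae k0 mE f_lip; set N := [set x | _] in N0.
have mN : lebesgue_measurable N.
  apply: le_caratheodory_measurable => X.
  have -> : (lebesgue_outer_measure R k) (X `&` N) = 0%E.
    by apply: null_subset N0; exact: subIsetr.
  by rewrite add0e; apply: le_lebesgue_outer; exact: subIsetl.
exists N; split=> // x /not_implyP[Ex H]; split=> // HL; apply: H.
by split=> // L; exact: isotropic_ap_diff.
Qed.
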